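(* Let $(K,\nu)$ be a valued field, $\omega$ a valuation transcendental extension of $\nu$ to $K(x)$, and $K(a)$ a minimal field of definition for $\omega$. Take an extension $\overline{\omega}$ of $\omega$ to $\overline{K}(x)$ which has $(a,\gamma)$ as a minimal pair of definition for some $\gamma\in\overline{\omega}\,\overline{K}(x)$, and fix an extension of $\overline{\omega}$ to $\overline{K(x)}$, again denoted by $\overline{\omega}$. Assume that $a$ is separable over $K$ and $a\notin K$. Then the following hold: (i) Assume that $\gamma>\mathrm{kras}(a,K)$. Then $IC(K(x)|K,\omega)=K(a)^h$. (ii) Assume that $\omega$ is value transcendental, $\nu$ admits a unique extension from $K$ to $K(a)$, and $\gamma<\mathrm{kras}(a,K)$. Then $(\overline{\omega}K(a,x):\omega K(x))=j$, where $j$ is the number of conjugates $a_i$ of $a$ over $K$ (including $a$ itself) with $\overline{\omega}(a-a_i)>\gamma$. Consequently, $IC(K(x)|K,\omega)\subsetneq K(a)^h$. (iii) Assume that $\omega$ is residue transcendental, $\nu$ admits a unique extension from $K$ to $K(a)$, and $\gamma\leq\mathrm{kras}(a,K)$. Then either $\overline{\omega}K(a,x)\neq\omega K(x)$, or $[K(a,x)\overline{\omega}:K(x)\omega]=j$, where $j$ is the number of conjugates $a_i$ of $a$ over $K$ (including $a$ itself) with $\overline{\omega}(a-a_i)\geq\gamma$. Consequently, $IC(K(x)|K,\omega)\subsetneq K(a)^h$.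
   Context: Values are written additively, $\nu 0=\infty$; for a valued field $(L,\nu)$, $\nu L$ and $L\nu$ denote the value group and residue field. $\overline{K}$ is a fixed algebraic closure of $K$. An extension $\omega$ of $\nu$ to the rational function field $K(x)$ is value transcendental if $\dim_{\mathbb{Q}}\big((\omega K(x)/\nu K)\otimes_{\mathbb{Z}}\mathbb{Q}\big)=1$, residue transcendental if $\mathrm{trdeg}[K(x)\omega:K\nu]=1$, and valuation transcendental if it is one of these. Given an extension $\overline{\omega}$ of $\omega$ to $\overline{K}(x)$, write $\overline{\nu}$ for its restriction to $\overline{K}$. For $a\in\overline{K}$ and $\gamma$ in an ordered abelian group containing $\overline{\nu}\,\overline{K}$, $\overline{\nu}_{a,\gamma}$ is the valuation on $\overline{K}(x)$ determined by $\overline{\nu}_{a,\gamma}\big(\sum_i c_i(x-a)^i\big)=\min_i\{\overline{\nu}c_i+i\gamma\}$ ($c_i\in\overline{K}$). A pair $(a,\gamma)$ with $a\in\overline{K}$, $\gamma\in\overline{\omega}\,\overline{K}(x)$ is a pair of definition for $\omega$ (with respect to $\overline{\omega}$) if $\overline{\omega}=\overline{\nu}_{a,\gamma}$; it is a minimal pair of definition if moreover for every $b\in\overline{K}$, $\overline{\nu}(a-b)\geq\gamma$ implies $[K(a):K]\leq[K(b):K]$. A minimal field of definition for $\omega$ is a field $K(a)$ where $(a,\gamma)$ is a minimal pair of definition for $\omega$ (with respect to some such extension $\overline{\omega}$). For $a\in\overline{K}\setminus K$ not purely inseparable over $K$, the Krasner constant is $\mathrm{kras}(a,K):=\max\{\overline{\nu}(\sigma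 a-\tau a)\mid \sigma,\tau\in\mathrm{Gal}(\overline{K}|K),\ \sigma a\neq\tau a\}$; it does not depend on the choice of $\overline{\nu}$. For $L|K$ algebraic, $L\subseteq\overline{K}$, $L^h$ is the henselization of $L$ inside $\overline{K}$ with respect to $\overline{\nu}$. $K(x)^h$ is the henselization of $(K(x),\omega)$ inside $\overline{K(x)}$ with respect to the fixed extension of $\overline{\omega}$, where $\overline{K(x)}$ is an algebraic closure of $\overline{K}(x)$. The implicit constant field is $IC(K(x)|K,\omega):=\overline{K}\cap K(x)^h$. *)

(* Defs.v *)
From HB Require Import structures.
From mathcomp Require Import all_boot all_order all_algebra.
From mathcomp Require Import finmap boolp classical_sets functions cardinality.
From mathcomp Require Import generic_quotient ring_quotient fraction.
From mathcomp Require Import separable.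

Set Implicit Arguments.
Unset Strict Implicit.
Unset Printing Implicit Defensive.

Import Order.TTheory GRing.Theory.
Local Open Scope classical_set_scope.
Local Open Scope card_scope.
Local Open Scope ring_scope.

(* A record over [porderZmodType], whose order and addition are not required
   to be compatible: an HB structure joining [orderType] and [zmodType] is
   rejected, because [realDomainType] is already declared above both. *)
Record oagType := OAGType {
  oag_sort :> porderZmodType;
  oag_total : total (<=%R : rel oag_sort);
  oag_leD2r : forall x y z : oag_sort, x <= y -> x + z <= y + z
}.

(* [G] with a top element [infty] adjoined; it carries the display of [G], so
   that [<=], [<] and [Order.min] are available in [ring_scope]. *)
Definition ext (G : oagType) : Type := option G.

Section Ext.
Variable G : oagType.
HB.instance Definition _ := Choice.on (ext G).

Definition infty : ext G := None.
Definition fin (g : G) : ext G := Some g.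

Definition ext_le (u w : ext G) : bool :=
  match u, w with
  | _, None => true
  | None, Some _ => false
  | Some g, Some h => g <= h
  end.

Definition ext_add (u w : ext G) : ext G :=
  match u, w with
  | Some g, Some h => fin (g + h)
  | _, _ => infty
  end.

Lemma ext_le_refl : reflexive ext_le.
Proof. by case=> /=. Qed.
Lemma ext_le_anti : antisymmetric ext_le.
Proof. by case=> [g|] [h|] //= /le_anti ->. Qed.
Lemma ext_le_trans : transitive ext_le.
Proof. by case=> [g|] [h|] [k|] //=; apply: le_trans. Qed.
Lemma ext_le_total : total ext_le.
Proof. by case=> [g|] [h|] //=; apply: oag_total. Qed.

HB.instance Definition _ := Order.Le_isPOrder.Build ring_display (ext G)
  ext_le_refl ext_le_anti ext_le_trans.
HB.instance Definition _ :=
  Order.POrder_isTotal.Build ring_display (ext G) ext_le_total.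
End Ext.
Arguments infty {G}.

Section Subfields.
Variable F : fieldType.
Implicit Types (E L S : set F) (z : F).

Definition subfield E : Prop := GRing.divring_closed (mem E).

Definition gen_field S : set F := smallest subfield S.

(* [L] has dimension [n] as an [E]-vector space; this is used for fields
   [E `<=` L]. *)
Definition is_degree E L (n : nat) : Prop :=
  exists b : 'I_n -> F, [/\ forall i, L (b i),
    forall c : 'I_n -> F, (forall i, E (c i)) ->
      \sum_(i < n) c i * b i = 0 -> forall i, c i = 0 &
    forall z, L z -> exists2 c : 'I_n -> F,
      (forall i, E (c i)) & z = \sum_(i < n) c i * b i].

Definition algebraic_over E z : Prop :=
  exists p : {poly F}, [/\ p != 0, forall i, E p`_i & root p z].

(* The transcendence degree of [L] over [E] is [1]: there is a transcendence
   basis [{t}]. *)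
Definition trdeg1 E L : Prop :=
  exists t, [/\ L t, ~ algebraic_over E t &
    forall z, L z -> algebraic_over (gen_field (E `|` [set t])) z].

End Subfields.

Section Groups.
Variable G : oagType.
Implicit Types (A B : set G) (g h : G).

Definition group_index (A B : set G) (n : nat) : Prop :=
  [set [set g + h | h in B] | g in A] #= `I_n.

(* [dim_Q ((A / B) (x)_Z Q) = 1] for groups [B `<=` A]: the image of some
   [g \in A] is a basis of the localisation of [A / B] at the nonzero
   integers. *)
Definition rational_rank1 A B : Prop :=
  exists2 g, A g &
    (forall n, (0 < n)%N -> ~ B (g *+ n)) /\
    (forall h, A h -> exists n (m : int), (0 < n)%N /\ B (h *+ n - g *~ m)).

End Groups.

Section Valuations.
Variable F : fieldType.
Variable G : oagType.

Definition valuation_on (H : oagType) (L : set F) (w : F -> ext H) : Prop :=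
  [/\ forall y, L y -> (w y = infty <-> y = 0),
      forall y z, L y -> L z -> w (y * z) = ext_add (w y) (w z) &
      forall y z, L y -> L z -> Order.min (w y) (w z) <= w (y + z)].

(* The value group is the set of finite values, not all of [G]. *)
Record valuation := Valuation {
  vfun :> F -> ext G;
  valuationP : valuation_on [set: F] vfun
}.

Definition equivalent_on (H : oagType) (L : set F) (w : F -> ext H)
    (v : F -> ext G) : Prop :=
  forall y z, L y -> L z -> (w y <= w z) = (v y <= v z).

(* Valuations are compared up to equivalence, extensions being allowed to take
   their values in any ordered abelian group. *)
Definition unique_extension (v : valuation) (E L : set F) : Prop :=
  forall (H : oagType) (w : F -> ext H), valuation_on L w ->
    equivalent_on E w v -> equivalent_on L w v.

(* [henselian] and [henselization] are meant for [F] an algebraic closure of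
   [E], resp. of [L]. *)
Definition henselian (v : valuation) (E : set F) : Prop :=
  unique_extension v E [set: F].

Definition henselization (v : valuation) (L : set F) : set F :=
  smallest (fun E => subfield E /\ henselian v E) L.

Definition value_group (v : valuation) (L : set F) : set G :=
  [set g | exists2 z, L z & v z = fin g].

End Valuations.

Definition extends (F F' : fieldType) (G : oagType) (f : F -> F')
    (w : valuation F' G) (v : valuation F G) : Prop :=
  forall z, w (f z) = v z.

Section Pullback.
Variables (F F' : fieldType) (G : oagType).
Variables (f : {rmorphism F -> F'}) (w : valuation F' G).

Lemma restriction_subproof : valuation_on [set: F] (fun z => w (f z)).
Proof.
have [w1 w2 w3] := valuationP w; split=> [y _|y z _ _|y z _ _].
- by rewrite w1 //; split=> [/eqP|->]; rewrite ?rmorph0 ?fmorph_eq0 // => /eqP.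
- by rewrite rmorphM w2.
- by rewrite rmorphD w3.
Qed.

Definition restriction : valuation F G := Valuation restriction_subproof.
End Pullback.

Section ResidueField.
Variables (F : fieldType) (G : oagType) (v : valuation F G).

Lemma val0 : v 0 = infty.
Proof. by have [h _ _] := valuationP v; apply/h. Qed.

Lemma val_neq0 z : z != 0 -> {g | v z = fin g}.
Proof.
move=> z0; case E: (v z) => [g|]; first by exists g.
by have [h _ _] := valuationP v; move/h: E => /(_ I) /eqP; rewrite (negPf z0).
Qed.

Lemma valM y z : v (y * z) = ext_add (v y) (v z).
Proof. by have [_ h _] := valuationP v; apply: h. Qed.

Lemma valD y z : Order.min (v y) (v z) <= v (y + z).
Proof. by have [_ _ h] := valuationP v; apply: h. Qed.

Lemma val1 : v 1 = fin 0.
Proof.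
have [g vg] := val_neq0 (oner_neq0 F); have := valM 1 1.
rewrite mulr1 vg /= /fin => -[] /eqP.
by rewrite -subr_eq subrr eq_sym => /eqP ->.
Qed.

Lemma oag_addrr0 (g : G) : g + g = 0 -> g = 0.
Proof.
move=> gg; have eN : g = - g by apply/eqP; rewrite -subr_eq0 opprK gg.
apply: le_anti; have /orP[h|h] := oag_total g 0; rewrite h ?andbT /=;
  by have := oag_leD2r (- g) h; rewrite subrr sub0r -eN.
Qed.

Lemma valN z : v (- z) = v z.
Proof.
have vN1 : v (-1) = fin 0.
  have [|g vg] := @val_neq0 (-1); first by rewrite oppr_eq0 oner_neq0.
  have := valM (-1) (-1); rewrite mulrNN mulr1 val1 vg /= => -[] /esym.
  by move=> /oag_addrr0 ->.
by rewrite -mulN1r valM vN1; case: (v z) => //= g; rewrite add0r.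
Qed.

Lemma valV z g : v z = fin g -> v z^-1 = fin (- g).
Proof.
move=> vg; have z0 : z != 0 by apply: contra_eq_neq vg => ->; rewrite val0.
have [|h vh] := @val_neq0 z^-1; first by rewrite invr_eq0.
have := valM z z^-1; rewrite mulfV // val1 vg vh /= => -[] /esym /eqP.
by rewrite addrC addr_eq0 => /eqP ->.
Qed.

Definition vring_pred : pred F := fun z => fin 0 <= v z.

Lemma vring_closed : subring_closed vring_pred.
Proof.
split=> [|y z|y z]; rewrite !unfold_in; first by rewrite val1.
  move=> hy hz; apply: le_trans (valD _ _); rewrite valN.
  by rewrite le_min; apply/andP.
rewrite valM; case: (v y) => [g|] //; case: (v z) => [h|] //= h1 h2.
by apply: (le_trans h2); have := oag_leD2r h h1; rewrite add0r.
Qed.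

HB.instance Definition _ := GRing.isSubringClosed.Build F vring_pred vring_closed.

Record vring := VRing { vring_val : F; _ : vring_val \in vring_pred }.

HB.instance Definition _ := [isSub for vring_val].
HB.instance Definition _ := [Choice of vring by <:].
HB.instance Definition _ := [SubChoice_isSubComNzRing of vring by <:].

Definition maxideal : pred vring := fun z => fin 0 < v (val z).

Lemma maxideal_closed : idealr_closed maxideal.
Proof.
split=> [||c y z]; rewrite !unfold_in ?rmorph0 ?val0 // ?rmorph1 ?val1 ?ltxx //.
move=> hy hz; rewrite [val _]rmorphD rmorphM.
apply: lt_le_trans (valD _ _); rewrite lt_min; apply/andP; split=> //.
rewrite valM; have := valP c; rewrite unfold_in /vring_pred.
move: hy; case: (v _) => [g|] //; case: (v _) => [h|] //= g0 h0.
by apply: (lt_le_trans g0); have := oag_leD2r g h0; rewrite add0r.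
Qed.

HB.instance Definition _ := isIdealr.Build vring maxideal maxideal_closed.

Local Notation quotient := (Quotient.quot (maxideal : idealr vring)).

Definition resfield : Type := quotient.

HB.instance Definition _ := GRing.ComNzRing.on resfield.

Definition residue (z : vring) : resfield := \pi_quotient%qT z.

Lemma residue_eq0 z : (residue z == 0) = (z \in maxideal).
Proof. by rewrite -[0 : resfield](rmorph0 \pi_quotient%qT) -Quotient.idealrBE subr0. Qed.

Definition res_inv (q : resfield) : resfield :=
  if q == 0 then 0 else residue (insubd 0 (val (repr (q : quotient)))^-1).

Lemma res_mulVf (q : resfield) : q != 0 -> res_inv q * q = 1.
Proof.
move=> q0; rewrite /res_inv (negPf q0).
have qE : q = residue (repr (q : quotient)) by rewrite /residue reprK.
move: q0; rewrite {1 3}qE residue_eq0; set z := repr _ => zM.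
have := valP z; rewrite unfold_in /vring_pred => z0.
have vz : v (val z) = fin 0.
  by apply: le_anti; rewrite z0 andbT leNgt; move: zM; rewrite unfold_in.
have hV : (val z)^-1 \in vring_pred by rewrite unfold_in /vring_pred (valV vz) oppr0.
rewrite /residue -rmorphM -(rmorph1 \pi_quotient%qT); congr (\pi_quotient%qT _).
have zV := insubdK (0 : vring) hV.
apply: val_inj; rewrite [LHS]rmorphM [RHS]rmorph1 /=; rewrite /= in zV vz.
rewrite zV mulVf //; by apply: contra_eq_neq vz => ->; rewrite val0.
Qed.

Lemma res_inv0 : res_inv 0 = 0.
Proof. by rewrite /res_inv eqxx. Qed.

HB.instance Definition _ :=
  GRing.ComNzRing_isField.Build resfield res_mulVf res_inv0.

End ResidueField.

Definition residue_set (F : fieldType) (G : oagType) (v : valuation F G)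
    (L : set F) : set (resfield v) :=
  [set residue z | z in [set z : vring v | L (val z)]].
Arguments residue_set {F G} v L _ : rename.

(* The rational function field [F(x)]; [x] is [ratvar]. *)
Notation ratfun F := {fraction {poly F}}.
Notation ratpoly := (@FracField.tofrac _).
Notation ratvar := (ratpoly 'X).
Definition ratconst (F : fieldType) (c : F) : ratfun F := ratpoly c%:P.

Section RatPoly.
Variable F : fieldType.

Lemma ratconst_is_zmod_morphism : zmod_morphism (@ratconst F).
Proof. by move=> p q; rewrite /ratconst !rmorphB. Qed.
Lemma ratconst_is_monoid_morphism : monoid_morphism (@ratconst F).
Proof. by split=> [|p q]; rewrite /ratconst ?rmorph1 ?rmorphM. Qed.
HB.instance Definition _ := GRing.isZmodMorphism.Build _ _ (@ratconst F)
  ratconst_is_zmod_morphism.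
HB.instance Definition _ := GRing.isMonoidMorphism.Build _ _ (@ratconst F)
  ratconst_is_monoid_morphism.

Lemma ratfun_repr (r : ratfun F) :
  r * ratpoly \d_(repr r) = ratpoly \n_(repr r).
Proof.
rewrite -{1}[r]reprK; unlock FracField.tofrac.
rewrite -[LHS]FracField.pi_mul; apply/eqmodP.
rewrite /= FracField.equivfE /FracField.mulf.
rewrite !numden_Ratio ?mulf_neq0 ?oner_eq0 ?denom_ratioP //.
by rewrite !mulr1 mulrC.
Qed.

Lemma ratfunP (r : ratfun F) :
  exists p q : {poly F}, q != 0 /\ r = ratpoly p / ratpoly q.
Proof.
exists (\n_(repr r)), (\d_(repr r)); split; first exact: denom_ratioP.
by rewrite -ratfun_repr mulfK // tofrac_eq0 denom_ratioP.
Qed.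
End RatPoly.

Section RatMap.
Variables (F F' : fieldType) (f : {rmorphism F -> F'}).
Local Notation fX p := (ratpoly (map_poly f p)).

(* The embedding [F(x) -> F'(x)] induced by [f]. *)
Definition ratmap (r : ratfun F) : ratfun F' :=
  fX \n_(repr r) / fX \d_(repr r).

Lemma ratmapE (p q : {poly F}) :
  q != 0 -> ratmap (ratpoly p / ratpoly q) = fX p / fX q.
Proof.
move=> q0; rewrite /ratmap; set r : ratfun F := ratpoly p / ratpoly q.
have d0 : \d_(repr r) != 0 by exact: denom_ratioP.
have /eqP : ratpoly p / ratpoly q = ratpoly \n_(repr r) / ratpoly \d_(repr r).
  by rewrite -ratfun_repr mulfK // tofrac_eq0.
rewrite eqr_div ?tofrac_eq0 // -!rmorphM tofrac_eq => /eqP e.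
apply/eqP; rewrite eqr_div ?tofrac_eq0 ?map_poly_eq0 //.
by rewrite -!rmorphM e.
Qed.

Lemma ratmap_is_zmod_morphism : zmod_morphism ratmap.
Proof.
move=> r s; have [p [q [q0 ->]]] := ratfunP r.
have [p' [q' [q'0 ->]]] := ratfunP s.
rewrite -mulNr -rmorphN addf_div ?tofrac_eq0 // -!rmorphM -rmorphD.
rewrite !ratmapE ?mulf_neq0 // -mulNr -!rmorphN addf_div ?tofrac_eq0 ?map_poly_eq0 //.
by do !rewrite ?rmorphM ?rmorphD ?rmorphN /=.
Qed.

Lemma ratmap_is_monoid_morphism : monoid_morphism ratmap.
Proof.
split=> [|r s].
  have -> : 1 = ratpoly 1 / ratpoly 1 :> ratfun F by rewrite !rmorph1 divr1.
  by rewrite ratmapE ?oner_eq0 // !rmorph1 divr1.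
have [p [q [q0 ->]]] := ratfunP r; have [p' [q' [q'0 ->]]] := ratfunP s.
by rewrite mulf_div -!rmorphM !ratmapE ?mulf_neq0 // mulf_div -!rmorphM.
Qed.

HB.instance Definition _ := GRing.isZmodMorphism.Build _ _ ratmap
  ratmap_is_zmod_morphism.
HB.instance Definition _ := GRing.isMonoidMorphism.Build _ _ ratmap
  ratmap_is_monoid_morphism.
End RatMap.

Section ValuationTranscendental.
Variables (K : fieldType) (G : oagType) (omega : valuation (ratfun K) G).

Definition value_transcendental : Prop :=
  rational_rank1 (value_group omega [set: ratfun K])
                 (value_group omega (range (@ratconst K))).

Definition residue_transcendental : Prop :=
  trdeg1 (residue_set omega (range (@ratconst K)))
         (residue_set omega [set: ratfun K]).

Definition valuation_transcendental : Prop :=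
  value_transcendental \/ residue_transcendental.

End ValuationTranscendental.

(* [Kbar] with [iota] is meant to be an algebraic closure of [K]. *)
Section AlgebraicClosure.
Variables (K : fieldType) (Kbar : closedFieldType).
Variable iota : {rmorphism K -> Kbar}.
Implicit Types a b : Kbar.

Definition separable_over a : Prop :=
  exists p : {poly K}, [/\ irreducible_poly p, root (map_poly iota p) a &
    separable_poly p].

Definition adjoin a : set Kbar := gen_field (range iota `|` [set a]).

Definition absolute_galois : set {rmorphism Kbar -> Kbar} :=
  [set s | bijective s /\ forall c, s (iota c) = iota c].

Definition conjugates a : set Kbar := [set s a | s in absolute_galois].

(* [K(x)] and [K(a, x)] inside [Kbar(x)] *)
Definition base_ratfun : set (ratfun Kbar) := range (ratmap iota).
Definition adjoin_ratfun a : set (ratfun Kbar) :=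
  gen_field (base_ratfun `|` [set ratconst a]).

Variable G : oagType.

(* The maximum, when it exists, is a value [fin g]; [infty] is a default. *)
Definition kras (nu : valuation Kbar G) a : ext G :=
  let D := [set k | exists s t : {rmorphism Kbar -> Kbar},
    [/\ absolute_galois s, absolute_galois t, s a != t a &
        k = nu (s a - t a)]] in
  xget infty [set k | D k /\ forall k', D k' -> k' <= k].

Variable omega : valuation (ratfun Kbar) G.

Definition const_valuation : valuation Kbar G :=
  restriction (@ratconst Kbar) omega.

Local Notation nu := const_valuation.

(* Polynomials in [x - a] are all polynomials in [x], and their values
   determine a valuation on [Kbar(x)]. *)
Definition is_monomial_valuation a (gamma : G) : Prop :=
  forall p : {poly Kbar},
    omega (ratpoly (p \Po ('X - a%:P))) =
    \big[Order.min/infty]_(i < size p) ext_add (nu p`_i) (fin (gamma *+ i)).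

Definition pair_of_definition a (gamma : G) : Prop :=
  value_group omega [set: ratfun Kbar] gamma /\ is_monomial_valuation a gamma.

Definition minimal_pair a (gamma : G) : Prop :=
  pair_of_definition a gamma /\
  forall b (m n : nat), fin gamma <= nu (a - b) ->
    is_degree (range iota) (adjoin a) m ->
    is_degree (range iota) (adjoin b) n -> (m <= n)%N.

Variables (Omega : closedFieldType) (j : {rmorphism ratfun Kbar -> Omega}).
Variable omega' : valuation Omega G.

(* The implicit constant field, as a subset of [Kbar]; [Omega] with [j] is
   meant to be an algebraic closure of [Kbar(x)]. *)
Definition implicit_constant_field : set Kbar :=
  [set c | henselization omega' (j @` base_ratfun) (j (ratconst c))].

End AlgebraicClosure.

(* Main.v *)
(* Write [y = x - a]. Call the last index at which the least value of the
   Taylor terms [c_k y^k] of a polynomial is attained its lead; it is additive,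
   and no cancellation occurs in a sum of polynomials with distinct leads. By
   minimality of [(a, gamma)], a nonzero polynomial over [K] of degree less
   than [K(a) : K] has lead [0], so it is residually equal to its value at
   [a], while the minimal polynomial of [a] has lead [d], the number of
   conjugates [b] with [nu (a - b) >= gamma]. Hence the leads of
   polynomials over [K] are multiples of [d], and [1, y, ..., y^(d-1)] yields
   coset representatives of the value groups in (ii), and, after scaling by an
   element of [K(x)] of value [gamma], a basis of the residue fields in (iii).

   An element of a henselization is fixed by every valuation-preserving
   automorphism over the base, since the fixed field of such an automorphism is
   henselian. Automorphisms [s] of [Kbar] that preserve the valuation and satisfy
   [nu (a - s a) >= gamma] extend to [Kbar(x)], by [x |-> x], and then to its
   algebraic closure, preserving the valuations. This gives [IC <= K(a)^h]
   (purely inseparable elements are excluded by a maximal subfield avoiding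
   them), and [IC <> K(a)^h] in (ii) and (iii), where unique extension provides
   such an automorphism with [s a <> a]. In (i), Krasner's lemma puts [a] in
   every henselian field containing [K(x)]. *)
From HB Require Import structures.
From mathcomp Require Import all_boot all_order all_algebra.
From mathcomp Require Import finmap boolp classical_sets functions cardinality.
From mathcomp Require Import fraction separable.
Require Import Defs.

Set Implicit Arguments.
Unset Strict Implicit.
Unset Printing Implicit Defensive.

Import Order.TTheory GRing.Theory.
Local Open Scope classical_set_scope.
Local Open Scope ring_scope.

(** * Valuations *)

(** The lead of a polynomial is the number of its roots [z] with [nu (a - z) >= gamma]: a linear
    factor contributes 1 or 0, and additivity is Gauss's lemma for the last index of least value.
    Minimality of the pair is used as a statement about roots: one that close to [a] has degree at
    least [[K(a) : K]]. Automorphisms must be extended together with the valuation, which is the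
    conjugacy of extensions of valuations. It is proved for one element at a time, by prime
    avoidance in the ring of elements all of whose conjugates are integral, and carried to the whole
    closure by Zorn's lemma. Polynomials need a coefficient type, while subfields occur as sets;
    hence a subfield is repeatedly replaced by a field type with an embedding whose range it is.
    Partial isomorphisms are kept as subfields of [F * F], so that inclusion orders them. Equivalent
    valuations that agree on the base are equal because ordered groups are torsion-free. *)

Lemma div_neq0 (F : fieldType) (x z : F) : x != 0 -> z != 0 -> x / z != 0.
Proof. by move=> x0 z0; rewrite mulf_neq0 // invr_eq0. Qed.

Section ExtTheory.
Variable G : oagType.
Implicit Types (g h : G) (u w t : ext G).

Lemma oag_muln_eq0 g n : (0 < n)%N -> g *+ n = 0 -> g = 0.
Proof.
have pos h : 0 <= h -> forall m, 0 <= h *+ m.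
  move=> h0; elim=> [|m IH]; first by rewrite mulr0n.
  rewrite mulrS; apply: le_trans IH _.
  by have := oag_leD2r (h *+ m) h0; rewrite add0r.
have npos h : 0 <= h -> (0 < n)%N -> h *+ n = 0 -> h = 0.
  move=> h0; case: n => // m _; rewrite mulrS => /eqP; rewrite addr_eq0 => /eqP e.
  apply: le_anti; rewrite h0 andbT e.
  by have := pos _ h0 m => /(oag_leD2r (- (h *+ m))); rewrite subrr add0r.
move=> n0 gn; have /orP[h|h] := oag_total 0 g; first exact: npos gn.
apply: oppr_inj; rewrite oppr0; apply: npos => //; last by rewrite mulNrn gn oppr0.
by have := oag_leD2r (- g) h; rewrite subrr add0r.
Qed.

Lemma fin_inj : injective (@fin G). Proof. by move=> g h []. Qed.

Lemma fin_ltoo g : fin g < infty. Proof. by []. Qed.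

Lemma le_infty u : u <= infty. Proof. by case: u. Qed.

Lemma ext_addC u w : ext_add u w = ext_add w u.
Proof. by case: u; case: w => //= g h; rewrite addrC. Qed.

Lemma ext_addA u w t : ext_add u (ext_add w t) = ext_add (ext_add u w) t.
Proof. by case: u; case: w; case: t => //= g h k; rewrite addrA. Qed.

Lemma ext_add0 u : ext_add (fin 0) u = u.
Proof. by case: u => //= g; rewrite add0r. Qed.

Lemma ext_leD2r t u w : u <= w -> ext_add u t <= ext_add w t.
Proof. by case: u; case: w; case: t => //= g h k; apply: oag_leD2r. Qed.

Lemma ext_leD2rE g u w : (ext_add u (fin g) <= ext_add w (fin g)) = (u <= w).
Proof.
apply/idP/idP; last exact: ext_leD2r.
move=> /(ext_leD2r (fin (- g))); rewrite -!ext_addA /= subrr.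
by rewrite !(ext_addC _ (fin 0)) !ext_add0.
Qed.

Lemma ext_ltD2rE g u w : (ext_add u (fin g) < ext_add w (fin g)) = (u < w).
Proof. by rewrite !ltNge ext_leD2rE. Qed.

Lemma ext_lt_leD u u' w w' : u < u' -> w <= w' -> w != infty ->
  ext_add u w < ext_add u' w'.
Proof.
move=> uu' ww'; case: w ww' => // g gw' _.
have gu : ext_add u (fin g) < ext_add u' (fin g) by rewrite ext_ltD2rE.
by apply: lt_le_trans gu _; rewrite ![ext_add u' _]ext_addC; apply: ext_leD2r.
Qed.

Lemma ext_leD u u' w w' : u <= u' -> w <= w' -> ext_add u w <= ext_add u' w'.
Proof.
move=> uu' ww'; apply: le_trans (ext_leD2r w uu') _.
by rewrite ![ext_add u' _]ext_addC; apply: ext_leD2r.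
Qed.
End ExtTheory.

Section ValTheory.
Variables (F : fieldType) (G : oagType) (v : valuation F G).
Implicit Types (x y z : F) (t : ext G).

Lemma val_eq_infty x : (v x == infty) = (x == 0).
Proof.
have [h _ _] := valuationP v.
by apply/eqP/eqP => /h; apply.
Qed.

Lemma val_lt_infty x : (v x < infty) = (x != 0).
Proof. by rewrite lt_neqAle le_infty andbT val_eq_infty. Qed.

Lemma valB_ge t x y : t <= v x -> t <= v y -> t <= v (x - y).
Proof. by move=> hx hy; apply: le_trans (valD _ _ _); rewrite valN le_min hx hy. Qed.

Lemma valD_ge t x y : t <= v x -> t <= v y -> t <= v (x + y).
Proof. by move=> hx hy; apply: le_trans (valD _ _ _); rewrite le_min hx hy. Qed.

Lemma valD_gt t x y : t < v x -> t < v y -> t < v (x + y).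
Proof. by move=> hx hy; apply: lt_le_trans (valD _ _ _); rewrite lt_min hx hy. Qed.

Lemma valB_gt t x y : t < v x -> t < v y -> t < v (x - y).
Proof. by move=> hx hy; apply: valD_gt; rewrite ?valN. Qed.

Lemma valDl x y : v x < v y -> v (x + y) = v x.
Proof.
move=> xy; apply: le_anti; rewrite valD_ge ?(ltW xy) // andbT leNgt.
apply/negP => h; have : v x < v ((x + y) - y) by apply: valB_gt.
by rewrite addrK ltxx.
Qed.

Lemma val_sum_ge (I : Type) (r : seq I) (P : pred I) (E : I -> F) t :
  (forall i, P i -> t <= v (E i)) -> t <= v (\sum_(i <- r | P i) E i).
Proof.
move=> h; elim/big_ind: _ => //; first by rewrite val0 le_infty.
by move=> x y; apply: valD_ge.
Qed.

Lemma val_sum_gt (I : Type) (r : seq I) (P : pred I) (E : I -> F) t :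
  t < infty -> (forall i, P i -> t < v (E i)) -> t < v (\sum_(i <- r | P i) E i).
Proof.
move=> t0 h; elim/big_ind: _ => //; first by rewrite val0.
by move=> x y; apply: valD_gt.
Qed.

Lemma valMl_le x y z : z != 0 -> (v (z * x) <= v (z * y)) = (v x <= v y).
Proof.
by move=> /(val_neq0 v)[g vg]; rewrite !valM vg !(ext_addC (fin g)) ext_leD2rE.
Qed.

Lemma valMl_lt x y z : z != 0 -> (v (z * x) < v (z * y)) = (v x < v y).
Proof. by move=> z0; rewrite !ltNge valMl_le. Qed.

Lemma valMl_eq x y z : z != 0 -> (v (z * x) = v (z * y)) -> (v x = v y).
Proof. by move=> z0 e; apply: le_anti; rewrite -(valMl_le x y z0) -(valMl_le y x z0) e lexx. Qed.

Lemma valM_ge0 x y : fin 0 <= v x -> fin 0 <= v y -> fin 0 <= v (x * y).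
Proof. by move=> hx hy; rewrite valM -[fin 0](ext_add0 (fin 0)); apply: ext_leD. Qed.

Lemma valM_gt0 x y : fin 0 < v x -> fin 0 <= v y -> fin 0 < v (x * y).
Proof.
by move=> hx hy; rewrite valM -[X in X < _](ext_add0 (fin 0)); apply: ext_lt_leD.
Qed.

Lemma valX_ge0 x n : fin 0 <= v x -> fin 0 <= v (x ^+ n).
Proof.
by move=> hx; elim: n => [|n IH]; rewrite ?expr0 ?val1 // exprS; apply: valM_ge0.
Qed.

Lemma valX_gt0 x n : (0 < n)%N -> fin 0 < v x -> fin 0 < v (x ^+ n).
Proof. by case: n => // n _ hx; rewrite exprS valM_gt0 // valX_ge0 // ltW. Qed.

Lemma valX x n g : v x = fin g -> v (x ^+ n) = fin (g *+ n).
Proof.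
move=> vg; elim: n => [|n IH]; first by rewrite expr0 val1.
by rewrite exprS valM vg IH /= -mulrS.
Qed.

Lemma valV_ge0 x : x != 0 -> (fin 0 <= v x^-1) = (v x <= fin 0).
Proof.
by move=> x0; rewrite -(val1 v) -(@valMl_le x 1 x^-1) ?invr_eq0 // mulr1 mulVf.
Qed.

Lemma valV_gt0 x : x != 0 -> (fin 0 < v x^-1) = (v x < fin 0).
Proof.
by move=> x0; rewrite -(val1 v) -(@valMl_lt x 1 x^-1) ?invr_eq0 // mulr1 mulVf.
Qed.

Lemma val_div_eq0 x y : y != 0 -> (v (x / y) = fin 0) <-> v x = v y.
Proof.
move=> y0; split=> [e|e].
  by apply: (@valMl_eq _ _ y^-1); rewrite ?invr_eq0 // mulVf // val1 mulrC.
by have [g vg] := val_neq0 v y0; rewrite valM (valV vg) e vg /= subrr.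
Qed.

Lemma val_div_ge0 x y : y != 0 -> (fin 0 <= v (x / y)) = (v y <= v x).
Proof.
by move=> y0; rewrite -(val1 v) -(@valMl_le y x y^-1) ?invr_eq0 // mulVf // mulrC.
Qed.

Lemma val_div_gt0 x y : y != 0 -> (fin 0 < v (x / y)) = (v y < v x).
Proof.
by move=> y0; rewrite -(val1 v) -(@valMl_lt y x y^-1) ?invr_eq0 // mulVf // mulrC.
Qed.

(** If the least value were attained by a single nonzero term, that term would be minus a sum of
    terms of larger value. *)
Lemma val_sum_eq0 (I : eqType) (r : seq I) (E : I -> F) :
  uniq r -> \sum_(i <- r) E i = 0 -> forall k, k \in r -> E k != 0 ->
  exists i j, [/\ i \in r, j \in r, i != j, E i != 0 & v (E i) = v (E j)].
Proof.
elim: r => [|i0 r IH] //= /andP[i0r ur] s0 k kr Ek.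
pose m := [seq i <- i0 :: r | E i != 0].
have km : k \in m by rewrite mem_filter Ek.
have [i im imin] : exists2 i, i \in m & forall l, l \in m -> v (E i) <= v (E l).
  elim: m k km {Ek kr} => // a m IHm k _.
  case: m IHm => [|b m] IHm; first by exists a => [|l]; rewrite ?inE // => /eqP->.
  have [i im imin] := IHm b (mem_head _ _).
  have [le|/ltW le] := leP (v (E a)) (v (E i)).
    exists a; rewrite ?mem_head // => l; rewrite inE => /predU1P[->//|/imin].
    exact: le_trans.
  exists i; first by rewrite inE im orbT.
  by move=> l; rewrite inE => /predU1P[->//|/imin].
move: (im); rewrite mem_filter => /andP[Ei ir].
have [/hasP[l lr /andP[li /eqP e]]|/hasPn no] :=
  boolP (has (fun l => (l != i) && (v (E l) == v (E i))) (i0 :: r)).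
  by exists i, l; split; rewrite // 1?eq_sym.
have ur0 : uniq (i0 :: r) by rewrite /= i0r.
move: s0; rewrite (bigD1_seq i) //= => /eqP; rewrite addr_eq0 => /eqP Es.
have : v (E i) < v (E i); last by rewrite ltxx.
rewrite {2}Es valN big_seq_cond; apply: val_sum_gt; first by rewrite val_lt_infty.
move=> l /andP[lr li]; have [El|El] := eqVneq (E l) 0.
  by rewrite El val0 val_lt_infty.
rewrite lt_neqAle imin ?mem_filter ?El // andbT eq_sym.
by have := no _ lr; rewrite li.
Qed.

(** Valuation rings are integrally closed: if [v x < fin 0], dividing the equation by the top power
    of [x] writes 1 as a sum of elements of positive value. *)
Lemma val_integral (p : {poly F}) x : p \is monic -> root p x ->
  (forall i, fin 0 <= v p`_i) -> fin 0 <= v x.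
Proof.
move=> mp rp pi; rewrite leNgt; apply/negP => vx.
have x0 : x != 0 by apply: contraTneq vx => ->; rewrite val0 ltNge le_infty.
have sp : (0 < size p)%N by rewrite size_poly_gt0 monic_neq0.
have vV : fin 0 < v x^-1 by rewrite valV_gt0.
move: rp; rewrite rootE horner_coef -(prednK sp) big_ord_recr /=.
have -> : p`_(size p).-1 = 1 by apply/eqP; exact: mp.
rewrite mul1r addrC addr_eq0 => /eqP e.
have : fin 0 < v 1; last by rewrite val1 ltxx.
have -> : 1 = - \sum_(i < (size p).-1) p`_i * x^-1 ^+ ((size p).-1 - i).
  apply: (@mulIf _ (x ^+ (size p).-1)); first exact: expf_neq0.
  rewrite mul1r {1}e mulNr mulr_suml; congr (- _); apply: eq_bigr => i _.
  rewrite -mulrA; congr (_ * _).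
  have -> : x ^+ (size p).-1 = x ^+ ((size p).-1 - i) * x ^+ i.
    by rewrite -exprD subnK // ltnW.
  by rewrite exprVn mulrA mulVf ?mul1r // expf_neq0.
rewrite valN; apply: val_sum_gt => // i _.
by rewrite mulrC valM_gt0 // valX_gt0 // subn_gt0.
Qed.

Lemma val_prod_XsubC (rs : seq F) : (forall x, x \in rs -> fin 0 <= v x) ->
  forall i, fin 0 <= v (\prod_(z <- rs) ('X - z%:P))`_i.
Proof.
move=> h i.
have /polyOverP /(_ i) : \prod_(z <- rs) ('X - z%:P) \is a polyOver (vring_pred v).
  rewrite big_seq; apply: rpred_prod => z zr.
  rewrite rpredB ?polyOverX ?polyOverC //.
  by rewrite unfold_in; apply: h.
by [].
Qed.

End ValTheory.

Lemma trivial_valuation_subproof (F : fieldType) (G : oagType) :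
  valuation_on [set: F] (fun x : F => if x == 0 then infty else fin (0 : G)).
Proof.
split=> [y _|y z _ _|y z _ _].
- by have [->|y0] := eqVneq y 0; split=> // /eqP; rewrite (negPf y0).
- rewrite mulf_eq0; case: eqP => //=; case: eqP => //= _ _.
  by congr fin; rewrite addr0.
have [->|y0] := eqVneq y 0; first by rewrite add0r ge_min lexx orbT.
have [->|z0] := eqVneq z 0; first by rewrite addr0 (negPf y0) ge_min lexx.
by rewrite minxx; case: eqP.
Qed.

(** Equality of two trivial values only says that both elements vanish or neither does; with it,
    results on value-preserving maps specialise to plain field embeddings. *)
Definition trivial_valuation (F : fieldType) (G : oagType) : valuation F G :=
  Valuation (trivial_valuation_subproof F G).

(** * Subfields and minimal polynomials *)

(* Used both for subfields of a field [F] and for graphs, in [F * F], of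
   isomorphisms between such subfields. *)
Record fieldset (R : comUnitRingType) := FieldSet {
  fset_carrier :> set R;
  fset_divring : GRing.divring_closed (mem fset_carrier);
  fset_unit : forall x, fset_carrier x -> x != 0 -> x \is a GRing.unit
}.

Section FieldSetType.
Variables (R : comUnitRingType) (S : fieldset R).

Definition fieldset_pred : pred R := fun x => x \in (S : set R).

Lemma fieldset_pred_closed : GRing.divring_closed fieldset_pred.
Proof. exact: fset_divring. Qed.

HB.instance Definition _ :=
  GRing.isDivringClosed.Build R fieldset_pred fieldset_pred_closed.

Record fieldset_type := FieldSetElt { fs_val : R; _ : fs_val \in fieldset_pred }.

HB.instance Definition _ := [isSub for fs_val].
HB.instance Definition _ := [Choice of fieldset_type by <:].
HB.instance Definition _ := [SubChoice_isSubComUnitRing of fieldset_type by <:].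

Lemma fieldset_type_field : GRing.field_axiom fieldset_type.
Proof.
move=> x x0; have xS : fset_carrier S (fs_val x).
  by have := valP x; rewrite unfold_in /fieldset_pred inE.
have xU : fs_val x \is a GRing.unit.
  apply: fset_unit xS _; apply: contra x0 => /eqP e.
  by apply/eqP/val_inj; rewrite [LHS]e rmorph0.
have iS : (fs_val x)^-1 \in fieldset_pred by rewrite rpredV; exact: valP.
apply/unitrP; exists (FieldSetElt iS).
by split; apply: val_inj; rewrite rmorphM rmorph1 /= ?mulVr ?divrr.
Qed.

HB.instance Definition _ :=
  GRing.ComUnitRing_isField.Build fieldset_type fieldset_type_field.

Lemma fs_valP (x : fieldset_type) : fset_carrier S (fs_val x).
Proof. by have := valP x; rewrite unfold_in /fieldset_pred inE. Qed.

Lemma fs_val_ex x : fset_carrier S x -> exists y : fieldset_type, fs_val y = x.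
Proof.
by move=> xS; have xP : x \in fieldset_pred; [exact/mem_set|exists (FieldSetElt xP)].
Qed.
End FieldSetType.

Section Subfield.
Variables (F : fieldType) (E : set F) (sE : subfield E).

Lemma subfield_fieldset_unit x : E x -> x != 0 -> x \is a GRing.unit.
Proof. by rewrite unitfE. Qed.

Definition subfield_fieldset : fieldset F :=
  FieldSet sE subfield_fieldset_unit.

Lemma subfield_inclusion :
  exists (T : fieldType) (i : {rmorphism T -> F}), range i = E.
Proof.
exists (fieldset_type subfield_fieldset), val.
apply/seteqP; split=> [_ [x _ <-]|x Ex].
  exact: (@fs_valP _ subfield_fieldset x).
by have [y <-] := @fs_val_ex _ subfield_fieldset x Ex; exists y.
Qed.

Lemma subfield1 : E 1. Proof. by have [/set_mem] := sE. Qed.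
Lemma subfieldB x y : E x -> E y -> E (x - y).
Proof. by have [_ h _] := sE => /mem_set hx /mem_set hy; apply/set_mem/h. Qed.
Lemma subfield_div x y : E x -> E y -> E (x / y).
Proof. by have [_ _ h] := sE => /mem_set hx /mem_set hy; apply/set_mem/h. Qed.
Lemma subfield0 : E 0.
Proof. by rewrite -(subrr 1); apply: subfieldB; exact: subfield1. Qed.
Lemma subfieldN x : E x -> E (- x).
Proof. by rewrite -sub0r; apply: subfieldB; exact: subfield0. Qed.
Lemma subfieldD x y : E x -> E y -> E (x + y).
Proof. by move=> hx hy; rewrite -[y]opprK; apply/subfieldB/subfieldN. Qed.
Lemma subfieldV x : E x -> E x^-1.
Proof. by rewrite -div1r; apply: subfield_div; exact: subfield1. Qed.
Lemma subfieldM x y : E x -> E y -> E (x * y).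
Proof. by move=> hx hy; rewrite -[y]invrK; apply/subfield_div/subfieldV. Qed.
Lemma subfieldX x n : E x -> E (x ^+ n).
Proof.
by move=> hx; elim: n => [|n IH]; [exact: subfield1|rewrite exprS; exact: subfieldM].
Qed.
Lemma subfield_sum (I : Type) (r : seq I) (P : pred I) (h : I -> F) :
  (forall i, P i -> E (h i)) -> E (\sum_(i <- r | P i) h i).
Proof. by move=> Eh; elim/big_ind: _ => //; [exact: subfield0|exact: subfieldD]. Qed.
End Subfield.

Lemma subfieldP (F : fieldType) (E : set F) :
  E 1 -> (forall x y, E x -> E y -> E (x - y)) ->
  (forall x y, E x -> E y -> E (x / y)) -> subfield E.
Proof.
move=> h1 hB hD; split; first exact: mem_set.
  by move=> x y /set_mem hx /set_mem hy; apply/mem_set/hB.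
by move=> x y /set_mem hx /set_mem hy; apply/mem_set/hD.
Qed.

Lemma subfield_range (T F : fieldType) (i : {rmorphism T -> F}) :
  subfield (range i).
Proof.
apply: subfieldP; first by exists 1; rewrite ?rmorph1.
  by move=> _ _ [x _ <-] [y _ <-]; exists (x - y); rewrite ?rmorphB.
by move=> _ _ [x _ <-] [y _ <-]; exists (x / y); rewrite ?fmorph_div.
Qed.

Lemma gen_field_subfield (F : fieldType) (S : set F) : subfield (gen_field S).
Proof.
apply: subfieldP => [E [sE _]|x y hx hy E [sE SE]|x y hx hy E [sE SE]].
- exact: subfield1.
- by apply: subfieldB => //; [apply: hx|apply: hy].
- by apply: subfield_div => //; [apply: hx|apply: hy].
Qed.

Lemma gen_field_min (F : fieldType) (S E : set F) :
  subfield E -> S `<=` E -> gen_field S `<=` E.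
Proof. by move=> sE SE x; apply. Qed.

Lemma sub_gen_field (F : fieldType) (S : set F) : S `<=` gen_field S.
Proof. by move=> x Sx E [_]; apply. Qed.

Section MinimalPolynomial.
Variables (T F : fieldType) (i : {rmorphism T -> F}).
Local Notation "g ^i" := (map_poly i g) (at level 2, format "g ^i").

Definition is_minpoly (f : {poly T}) (z : F) : Prop :=
  [/\ f \is monic, root f^i z & forall g, root g^i z -> f %| g].

Lemma minpoly_exists z : algebraicOver i z -> exists f, is_minpoly f z.
Proof.
move=> [p p0 pz].
pose P n := `[< exists g : {poly T}, [/\ g != 0, root g^i z & size g = n] >].
have /ex_minnP[n /asboolP[g [g0 gz sg]] nmin] : exists n, P n.
  by exists (size p); apply/asboolP; exists p.
have lg : lead_coef g != 0 by rewrite lead_coef_eq0.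
exists ((lead_coef g)^-1 *: g); split.
- by rewrite monicE lead_coefZ mulVf.
- by rewrite map_polyZ rootZ // fmorph_eq0 invr_eq0.
move=> h hz; rewrite dvdpZl ?invr_eq0 //; apply/modp_eq0P/eqP/negPn/negP => r0.
have : (n <= size (h %% g)%R)%N.
  apply: nmin; apply/asboolP; exists (h %% g); split=> //.
  have -> : h %% g = h - h %/ g * g by rewrite {2}(divp_eq h g) addrAC subrr add0r.
  rewrite rmorphB rmorphM /= /root !hornerE (rootP hz) (rootP gz).
  by rewrite mulr0 subrr.
by rewrite -sg leqNgt ltn_modp g0.
Qed.

Lemma minpoly_neq0 f z : is_minpoly f z -> f != 0.
Proof. by move=> [/monic_neq0]. Qed.

Lemma minpoly_size f z : is_minpoly f z -> (1 < size f)%N.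
Proof.
move=> [mf fz _]; rewrite -(size_map_poly i); apply: root_size_gt1 fz.
by rewrite map_poly_eq0 monic_neq0.
Qed.

Lemma minpolyP f z g : is_minpoly f z -> root g^i z = (f %| g).
Proof.
move=> [mf fz h]; apply/idP/idP; first exact: h.
move=> /dvdpP[q ->]; rewrite rmorphM /= rootM.
by apply/orP; right.
Qed.

(** A common divisor [d] of [f] and [g] does not vanish at [z], since otherwise [f] divides [d],
    hence [g]. So the cofactor of [d] in [f] vanishes at [z], is divisible by [f], and [d] is
    constant by degrees. *)
Lemma minpoly_Bezout f z g : is_minpoly f z -> ~~ root g^i z ->
  exists u w, u * f + w * g = 1.
Proof.
move=> mf gz.
suff /Bezout_eq1_coprimepP[[u w] /= e] : coprimep f g by exists u, w.
apply/coprimepP => d df dg; rewrite -size_poly_eq1.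
move: df (df) => /dvdpP[q e] df.
have : root f^i z by case: mf.
rewrite e rmorphM rootM => /orP[|dz]; last first.
  by move: gz; rewrite (minpolyP _ mf) (dvdp_trans _ dg) // -(minpolyP _ mf).
rewrite (minpolyP _ mf) {1}e => dq.
have f0 := minpoly_neq0 mf.
have [q0 d0] : q != 0 /\ d != 0 by apply/andP; rewrite -negb_or -mulf_eq0 -e.
move: (dvdp_leq q0 dq); rewrite size_mul //.
rewrite (polySpred d0) addnS /= -{2}[size q]addn0 leq_add2l leqn0 => /eqP ->.
by [].
Qed.

Lemma range_horner_subfield z : algebraicOver i z ->
  subfield (range (fun g => g^i.[z])).
Proof.
move=> /minpoly_exists[f mf]; apply: subfieldP.
- by exists 1; rewrite // rmorph1 hornerC.
- by move=> _ _ [g _ <-] [h _ <-]; exists (g - h); rewrite // rmorphB !hornerE.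
move=> _ _ [g _ <-] [h _ <-]; have [hz|hz] := boolP (root h^i z).
  by exists 0; rewrite // (rootP hz) invr0 mulr0 rmorph0 horner0.
(* Evaluating [u * f + w * h = 1] at [z] shows that [w] gives the inverse of the value of [h]. *)
have [u [w e]] := minpoly_Bezout mf hz; exists (g * w) => //.
have : (u * f + w * h)^i.[z] = 1 by rewrite e rmorph1 hornerC.
have [_ /rootP fz _] := mf.
rewrite rmorphD !rmorphM !hornerE fz mulr0 add0r => wh.
by apply: (@mulIf _ h^i.[z]) => //; rewrite mulfVK // -mulrA wh mulr1.
Qed.

Lemma gen_field_horner z : algebraicOver i z ->
  gen_field (range i `|` [set z]) = range (fun g => g^i.[z]).
Proof.
move=> az; apply/seteqP; split.
  apply: gen_field_min; first exact: range_horner_subfield.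
  move=> _ [[x _ <-]|->]; first by exists x%:P; rewrite // map_polyC hornerC.
  by exists 'X; rewrite // map_polyX hornerX.
move=> _ [g _ <-] E [sE zE]; rewrite horner_poly.
apply: subfield_sum => // k _; apply: subfieldM => //; last first.
  by apply: subfieldX => //; apply: zE; right.
by apply: zE; left; exists g`_k.
Qed.

Lemma adjoin_degree f z : is_minpoly f z ->
  is_degree (range i) (gen_field (range i `|` [set z])) (size f).-1.
Proof.
move=> mf; have [_ fz _] := mf; have f0 := minpoly_neq0 mf.
have sf : size f = (size f).-1.+1 by rewrite (polySpred f0).
rewrite gen_field_horner; last by exists f.
exists (fun k : 'I_(size f).-1 => z ^+ k); split.
- by move=> k; exists 'X^k; rewrite // map_polyXn hornerXn.
- move=> c hc c0.
  have [k|d dE] := @choice 'I_(size f).-1 T (fun k x => i x = c k) _.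
    by have [x _ <-] := hc k; exists x.
  pose g := \poly_(k < (size f).-1) (if insub k is Some l then d l else 0).
  have gk (k : 'I__) : g`_k = d k by rewrite coef_poly ltn_ord valK.
  have : root g^i z.
    rewrite rootE (@horner_coef_wide _ (size f).-1); last first.
      by rewrite size_map_poly size_poly.
    apply/eqP; rewrite -[RHS]c0; apply: eq_bigr => k _.
    by rewrite coef_map /= gk dE.
  rewrite (minpolyP _ mf) => /dvdp_leq h.
  have [g0|/h/leq_trans/(_ (size_poly _ _)) le] := eqVneq g 0; last first.
    by exfalso; move: le; rewrite leqNgt ltn_predL size_poly_gt0 f0.
  by move=> k; rewrite -dE -gk g0 coef0 rmorph0.
move=> _ [g _ <-]; exists (fun k => i (g %% f)`_k) => [k|]; first by exists (g %% f)`_k.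
rewrite {1}(divp_eq g f) rmorphD rmorphM !hornerE (rootP fz) mulr0 add0r.
rewrite (@horner_coef_wide _ (size f).-1) ?size_map_poly.
  by apply: eq_bigr => k _; rewrite coef_map.
by rewrite -ltnS -sf ltn_modp.
Qed.
End MinimalPolynomial.

(** * Extension of embeddings *)

Lemma algebraicOver_sub (T T' F : fieldType) (i : {rmorphism T -> F})
    (i' : {rmorphism T' -> F}) z :
  range i `<=` range i' -> algebraicOver i z -> algebraicOver i' z.
Proof.
move=> ii' [p p0 pz].
have [t|f fE] := @choice T T' (fun t t' => i' t' = i t) _.
  by have [t' _ <-] := ii' (i t) (imageT _ _); exists t'.
pose p' := \poly_(k < size p) f p`_k.
have p'E : map_poly i' p' = map_poly i p.
  apply/polyP => k; rewrite !coef_map coef_poly.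
  case: ltnP => [_|h]; first exact: fE.
  rewrite (nth_default _ h); exact: etrans (rmorph0 i') (esym (rmorph0 i)).
exists p'; last by rewrite p'E.
by rewrite -(map_poly_eq0 i') p'E map_poly_eq0.
Qed.

Lemma pair_div (F : fieldType) (x y z t : F) : z != 0 -> t != 0 ->
  ((x, y) : F * F) / (z, t) = (x / z, y / t).
Proof.
move=> z0 t0; have u : ((z, t) : F * F) \is a GRing.unit.
  by rewrite /GRing.unit /= unfold_in /= !unitfE z0.
by apply: (mulIr u); rewrite mulrVK //; congr pair; rewrite /= mulfVK.
Qed.

Section Graphs.
Variables (F : closedFieldType) (G : oagType) (v1 v2 : valuation F G).

(** The graph of a value-preserving isomorphism between two subfields. That it is single-valued and
    injective follows from the preservation of values, as only 0 has value [infty]. *)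
Definition is_graph (A : set (F * F)) : Prop :=
  GRing.divring_closed (mem A) /\ forall x, A x -> v1 x.1 = v2 x.2.

Lemma graph_eq0 A x : is_graph A -> A x -> (x.1 == 0) = (x.2 == 0).
Proof. by move=> [_ h] /h e; rewrite -(val_eq_infty v1) e val_eq_infty. Qed.

Lemma graph_unit A : is_graph A -> forall x, A x -> x != 0 -> x \is a GRing.unit.
Proof.
move=> gA x Ax; have := graph_eq0 gA Ax; case: x {Ax} => x y /= e.
rewrite /GRing.unit /= unfold_in !unitfE /= -e andbb.
by apply: contra => x0; move: (x0); rewrite e => y0; apply/andP.
Qed.

Section OfTwoEmbeddings.
Variables (T : fieldType) (i1 i2 : {rmorphism T -> F}) (z z' : F).
Hypothesis compat :
  forall g, v1 (map_poly i1 g).[z] = v2 (map_poly i2 g).[z'].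
Local Notation e1 g := (map_poly i1 g).[z].
Local Notation e2 g := (map_poly i2 g).[z'].

(** The isomorphism from [i1(T)(z)] to [i2(T)(z')] that sends [i1 t] to [i2 t] and [z] to [z'];
    [compat] makes it well defined and value-preserving. *)
Definition simple_graph : set (F * F) :=
  [set x | exists g h, e1 h != 0 /\ x = (e1 g / e1 h, e2 g / e2 h)].

Lemma compat_eq0 g : (e1 g == 0) = (e2 g == 0).
Proof. by rewrite -(val_eq_infty v1) compat val_eq_infty. Qed.

Lemma simple_graph_poly g : simple_graph (e1 g, e2 g).
Proof. by exists g, 1; rewrite !rmorph1 !hornerC oner_eq0 !divr1. Qed.

Lemma simple_graph_is_graph : is_graph simple_graph.
Proof.
split=> [|_ [g [h [h0 ->]]] /=]; last first.
  have h0' : e2 h != 0 by rewrite -compat_eq0.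
  have [a va] := val_neq0 v1 h0.
  by rewrite !valM (valV va) compat (valV (g := a)) // -compat.
split=> [|x y /set_mem[g [h [h0 ->]]] /set_mem[g' [h' [h'0 ->]]]
         |x y /set_mem[g [h [h0 ->]]] /set_mem[g' [h' [h'0 ->]]]]; apply/mem_set.
- by have := simple_graph_poly 1; rewrite !rmorph1 !hornerC.
- have k0 : e2 h != 0 by rewrite -compat_eq0.
  have k0' : e2 h' != 0 by rewrite -compat_eq0.
  exists (g * h' - g' * h), (h * h'); split.
    by rewrite rmorphM hornerM mulf_neq0.
  rewrite !(rmorphB, rmorphM) !(hornerM, hornerD, hornerN) /=.
  by congr pair; rewrite -[LHS]/(_ / _ - _ / _) -mulNr addf_div // mulNr.
(* If the divisor is 0 in [F * F], the quotient is 0 by the convention for inverses. *)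
have [g'0|g'0] := eqVneq (e1 g') 0.
  have k : e2 g' = 0 by apply/eqP; rewrite -compat_eq0 g'0.
  rewrite g'0 k !mul0r -[(0, 0)]/(0 : F * F) invr0 mulr0; exists 0, 1.
  by rewrite !rmorph1 !hornerC oner_eq0 !rmorph0 !horner0 !mul0r.
have k : e2 g' != 0 by rewrite -compat_eq0.
have k0 : e2 h != 0 by rewrite -compat_eq0.
have k0' : e2 h' != 0 by rewrite -compat_eq0.
exists (g * h'), (h * g'); split; first by rewrite rmorphM hornerM mulf_neq0.
rewrite pair_div ?mulf_neq0 ?invr_eq0 // !rmorphM !hornerM /=.
by congr pair; rewrite invf_div mulf_div.
Qed.

End OfTwoEmbeddings.

Lemma graph_of_embeddings (T : fieldType) (i1 i2 : {rmorphism T -> F}) :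
  (forall t, v1 (i1 t) = v2 (i2 t)) -> is_graph [set (i1 t, i2 t) | t in [set: T]].
Proof.
move=> e; split=> [|_ [t _ <-]]; last exact: e.
split=> [|x y /set_mem[s _ <-] /set_mem[t _ <-]
         |x y /set_mem[s _ <-] /set_mem[t _ <-]]; apply/mem_set.
- by exists 1 => //; rewrite !rmorph1.
- by exists (s - t) => //; rewrite !rmorphB.
exists (s / t) => //; have [->|t0] := eqVneq t 0.
  by rewrite invr0 mulr0 !rmorph0 -[(0, 0)]/(0 : F * F) invr0 mulr0.
by rewrite pair_div ?fmorph_eq0 // !fmorph_div.
Qed.

Lemma is_graph_bigcup (C : set (set (F * F))) : C !=set0 ->
  (forall A, C A -> is_graph A) -> total_on C subset ->
  is_graph (\bigcup_(A in C) A).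
Proof.
move=> [A0 CA0] gC tC.
have common x y : (\bigcup_(A in C) A) x -> (\bigcup_(A in C) A) y ->
    exists A, [/\ C A, A x & A y].
  move=> [A CA Ax] [B CB Bx]; have [AB|BA] := tC _ _ CA CB.
    by exists B; split=> //; apply: AB.
  by exists A; split=> //; apply: BA.
split=> [|x [A CA Ax]]; last exact: (gC _ CA).2.
split=> [|x y /set_mem Ux /set_mem Uy|x y /set_mem Ux /set_mem Uy].
- apply/mem_set; exists A0 => //.
  by have [[/set_mem]] := gC _ CA0.
- have [A [CA /mem_set Ax /mem_set Ay]] := common _ _ Ux Uy.
  by apply/mem_set; exists A => //; apply/set_mem; have [[_ + _] _] := gC _ CA; apply.
- have [A [CA /mem_set Ax /mem_set Ay]] := common _ _ Ux Uy.
  by apply/mem_set; exists A => //; apply/set_mem; have [[_ _ +] _] := gC _ CA; apply.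
Qed.

(** A graph thus becomes the common source of two embeddings, the form in which a further element
    can be adjoined to it. *)
Lemma graph_field A : is_graph A ->
  exists (T : fieldType) (i1 i2 : {rmorphism T -> F}),
    A = [set (i1 t, i2 t) | t in [set: T]].
Proof.
move=> gA; pose S := FieldSet gA.1 (graph_unit gA).
exists (fieldset_type S), (GRing.RMorphism.clone _ _ (fst \o val) _),
  (GRing.RMorphism.clone _ _ (snd \o val) _).
apply/seteqP; split=> [x Ax|_ [t _ <-] /=].
  by have [y <-] := @fs_val_ex _ S x Ax; exists y => //=; rewrite -surjective_pairing.
by rewrite -surjective_pairing; apply: (@fs_valP _ S t).
Qed.

(** Two images of [x] differ by an image of 0, which has value [infty]; so the graph is a function,
    and its closure under differences and quotients makes this function a morphism. *)
Lemma total_graph_morphism A : is_graph A -> (forall x, exists y, A (x, y)) ->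
  exists s : {rmorphism F -> F}, forall x y, A (x, y) <-> s x = y.
Proof.
move=> gA totA; have [s sA] := choice totA.
have [[A1 AB AD] _] := gA.
have funA x y : A (x, y) <-> s x = y.
  split=> [Axy|<- //]; apply/eqP; rewrite -subr_eq0.
  have Axx : A (0, s x - y).
    rewrite -[0](subrr x); apply/set_mem; apply: (AB (x, s x) (x, y)); exact: mem_set.
  by rewrite -(graph_eq0 gA Axx).
have sB : zmod_morphism s.
  move=> x y; apply/funA/set_mem; apply: (AB (x, s x) (y, s y)); exact: mem_set.
have sM : monoid_morphism s.
  split; first by apply/funA/set_mem.
  move=> x y; have [->|y0] := eqVneq y 0.
    by have s00 := sB 0 0; rewrite !subrr in s00; rewrite mulr0 s00 mulr0.
  apply/funA.
  have s0 : s y != 0 by rewrite -(graph_eq0 gA (sA y)).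
  have h z : A (z, s z) -> A (z / y, s z / s y).
    move=> Az; rewrite -pair_div //; apply/set_mem/AD; exact: mem_set.
  have AV : A (y^-1, (s y)^-1).
    rewrite -[y^-1]div1r -[(s y)^-1]div1r -pair_div //; apply/set_mem/AD => //.
    exact: mem_set.
  rewrite -[X in A (x * X, _)]invrK -[X in A (_, s x * X)]invrK -pair_div ?invr_eq0 //.
  by apply/set_mem/AD; exact: mem_set.
exists (HB.pack_for {rmorphism F -> F} s (GRing.isZmodMorphism.Build _ _ s sB)
  (GRing.isMonoidMorphism.Build _ _ s sM)).
exact: funA.
Qed.

(* [T -> F] is extended by a maximal graph; a proper one would be enlarged by
   adjoining a single element. *)
Lemma embedding_extension (T0 : fieldType) (i1 i2 : {rmorphism T0 -> F}) :
  (forall z, algebraicOver i1 z) -> (forall t, v1 (i1 t) = v2 (i2 t)) ->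
  (forall (T : fieldType) (k1 k2 : {rmorphism T -> F}),
     (forall z, algebraicOver k1 z) -> (forall t, v1 (k1 t) = v2 (k2 t)) ->
     forall z, exists z', forall g,
       v1 (map_poly k1 g).[z] = v2 (map_poly k2 g).[z']) ->
  exists s : {rmorphism F -> F},
    (forall t, s (i1 t) = i2 t) /\ (forall x, v2 (s x) = v1 x).
Proof.
move=> alg e step; pose A0 := [set (i1 t, i2 t) | t in [set: T0]].
have gA0 : is_graph A0 by exact: graph_of_embeddings.
pose P (A : set (F * F)) := A = set0 \/ (is_graph A /\ A0 `<=` A).
have [|A [PA Amax]] := @Zorn_bigcup (F * F)%type P.
  move=> C CP tC; have [[A [CA An0]]|no] := pselect (exists A, C A /\ A !=set0).
    right; pose D := [set B | C B /\ B !=set0].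
    have -> : \bigcup_(B in C) B = \bigcup_(B in D) B.
      apply/seteqP; split=> [x [B CB Bx]|x [B [CB _] Bx]]; exists B => //.
      by split=> //; exists x.
    have DP B : D B -> is_graph B /\ A0 `<=` B.
      by move=> [/CP[->|//] [x]].
    split; last by move=> x A0x; exists A; [split|apply: (DP A _).2 => //; split].
    apply: is_graph_bigcup; first by exists A.
      by move=> B /DP[].
    by move=> B B' [CB _] [CB' _]; apply: tC.
  left; apply/seteqP; split=> // x [A CA Ax]; apply: no; exists A; split=> //.
  by exists x.
have [gA A0A] : is_graph A /\ A0 `<=` A.
  case: PA => // A_0; exfalso; apply: (Amax A0); last by right; split.
  rewrite A_0; split; first exact: sub0set.
  by move=> /(_ (i1 1, i2 1)); apply; exists 1.
have [T [k1 [k2 AE]]] := graph_field gA.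
have tot x : exists y, A (x, y).
  have [|t|z' hz] := step T k1 k2 _ _ x.
  - move=> z; apply: algebraicOver_sub (alg z) => _ [t _ <-].
    have : A (i1 t, i2 t) by apply: A0A; exists t.
    by rewrite AE => -[s _ [<- _]]; exists s.
  - by apply: (gA.2 (k1 t, k2 t)); rewrite AE; exists t.
  have gB := simple_graph_is_graph hz; set B := simple_graph k1 k2 x z' in gB.
  have AB : A `<=` B.
    rewrite AE => _ [t _ <-]; have := simple_graph_poly k1 k2 x z' t%:P.
    by rewrite !map_polyC !hornerC.
  have Bx : B (x, z') by have := simple_graph_poly k1 k2 x z' 'X; rewrite !map_polyX !hornerX.
  exists z'; apply: contrapT => nA; apply: (Amax B); last first.
    by right; split=> //; apply: subset_trans AB.
  by split=> // BA; apply: nA; apply: BA.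
have [s sA] := total_graph_morphism gA tot.
exists s; split=> [t|x]; first by apply/sA/A0A; exists t.
by have /gA.2 /= -> : A (x, s x) by apply/sA.
Qed.

End Graphs.

(** Each [y] is a root of some [p] over [i2], and [s] maps the roots of [p] over [i1] onto those
    over [i2]. *)
Lemma embedding_bijective (F : closedFieldType) (T : fieldType)
    (i1 i2 : {rmorphism T -> F}) (s : {rmorphism F -> F}) :
  (forall z, algebraicOver i2 z) -> (forall t, s (i1 t) = i2 t) -> bijective s.
Proof.
move=> alg si.
have surj y : exists x, s x = y.
  have [p p0 py] := alg y.
  have [r e] := closed_field_poly_normal (map_poly i1 p).
  have : map_poly i2 p = map_poly s (map_poly i1 p).
    by rewrite -map_poly_comp; apply: eq_map_poly => t /=; rewrite si.
  rewrite e map_polyZ rmorph_prod => e2; move: py; rewrite e2 rootZ; last first.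
    by rewrite fmorph_eq0 lead_coef_eq0 map_poly_eq0.
  rewrite (eq_bigr (fun x => 'X - (s x)%:P)); last first.
    by move=> x _; rewrite rmorphB /= map_polyX map_polyC.
  rewrite -(big_map s xpredT (fun x => 'X - x%:P)) root_prod_XsubC.
  by move=> /mapP[x _ ->]; exists x.
have [g gK] := choice surj.
by exists g => // x; apply: (fmorph_inj s); rewrite gK.
Qed.

Definition int_oag : oagType :=
  @OAGType int (@le_total _ int) (fun x y z h => etrans (Num.Theory.lerD2r z x y) h).

Section EmbeddingExt.
Variables (F : closedFieldType) (T : fieldType).

Lemma map_poly_horner_morph (i1 i2 : {rmorphism T -> F})
    (s : {rmorphism F -> F}) (si : forall t, s (i1 t) = i2 t) g z :
  s (map_poly i1 g).[z] = (map_poly i2 g).[s z].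
Proof.
rewrite -horner_map /= -map_poly_comp; congr _.[_].
by apply: eq_map_poly => t /=; rewrite si.
Qed.

Lemma minpoly_compat (i1 i2 : {rmorphism T -> F}) f z z' :
  is_minpoly i1 f z -> root (map_poly i2 f) z' ->
  forall g, root (map_poly i1 g) z = root (map_poly i2 g) z'.
Proof.
move=> mf fz' g; have [gz|gz] := boolP (root _ z).
  move: gz; rewrite (minpolyP _ mf) => /dvdpP[q ->].
  by rewrite rmorphM /= rootM fz' orbT.
have [u [w e]] := minpoly_Bezout mf gz.
apply/esym/negP => /rootP gz'.
have : (map_poly i2 (u * f + w * g)).[z'] = 1 by rewrite e rmorph1 hornerC.
rewrite rmorphD !rmorphM !hornerE (rootP fz') gz' !mulr0 addr0 => /eqP.
by rewrite eq_sym oner_eq0.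
Qed.

End EmbeddingExt.

Lemma isomorphism_extension (F : closedFieldType) (T : fieldType)
    (i1 i2 : {rmorphism T -> F}) :
  (forall z, algebraicOver i1 z) ->
  exists s : {rmorphism F -> F}, forall t, s (i1 t) = i2 t.
Proof.
move=> alg; pose v := trivial_valuation F int_oag.
have [t|T' k1 k2 alg' _ z|s [si _]] := @embedding_extension F int_oag v v T i1 i2 alg.
- by rewrite /v /= !fmorph_eq0.
- have [f mf] := minpoly_exists (alg' z).
  have [|z' fz'] := @closed_rootP F (map_poly k2 f) _.
    by rewrite size_map_poly gtn_eqF // (minpoly_size mf).
  exists z' => g; have := minpoly_compat mf fz' g.
  by rewrite /v /= !rootE => ->.
by exists s.
Qed.

(** * Automorphisms over a subfield, and values of algebraic elements *)

Section GaloisTheory.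
Variables (F : closedFieldType) (T : fieldType).
Variable i : {rmorphism T -> F}.
Hypothesis alg : forall z, algebraicOver i z.

Lemma galois_of_fix (s : {rmorphism F -> F}) :
  (forall t, s (i t) = i t) -> absolute_galois i s.
Proof. by move=> si; split=> //; apply: embedding_bijective alg si. Qed.

Lemma galois_conjugate f z z' : is_minpoly i f z -> root (map_poly i f) z' ->
  exists2 s, absolute_galois i s & s z = z'.
Proof.
move=> mf fz'; pose v := trivial_valuation F int_oag.
have hz g : v (map_poly i g).[z] = v (map_poly i g).[z'].
  by have := minpoly_compat mf fz' g; rewrite /v /= !rootE => ->.
have [T' [k1 [k2 E]]] := graph_field (simple_graph_is_graph hz).
have sub g : exists t, k1 t = (map_poly i g).[z] /\ k2 t = (map_poly i g).[z'].
  by have := simple_graph_poly i i z z' g; rewrite E => -[t _ [e1 e2]]; exists t.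
have subi : range i `<=` range k1.
  by move=> _ [t _ <-]; have [u [+ _]] := sub t%:P; rewrite map_polyC hornerC => <-; exists u.
have [x|s sk] := @isomorphism_extension F T' k1 k2.
  exact: algebraicOver_sub (alg x).
exists s; first apply: galois_of_fix => t.
  by have [u []] := sub t%:P; rewrite !map_polyC !hornerC => e1 e2; rewrite -{1}e1 sk e2.
by have [u []] := sub 'X; rewrite !map_polyX !hornerX => <- <-; rewrite sk.
Qed.

Lemma galois_horner s : absolute_galois i s -> forall g z,
  s (map_poly i g).[z] = (map_poly i g).[s z].
Proof. by move=> [_ si] g z; apply: map_poly_horner_morph. Qed.

Lemma galois_root s : absolute_galois i s -> forall g z,
  root (map_poly i g) z -> root (map_poly i g) (s z).
Proof. by move=> gs g z /rootP gz; rewrite rootE -galois_horner // gz rmorph0. Qed.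

Lemma minpoly_split f z : is_minpoly i f z -> exists rs : seq F,
  map_poly i f = \prod_(x <- rs) ('X - x%:P) /\
  forall x, x \in rs -> exists2 s, absolute_galois i s & s z = x.
Proof.
move=> mf; have [rs e] := closed_field_poly_normal (map_poly i f).
have [/monicP lf _ _] := mf.
move: e; rewrite lead_coef_map lf rmorph1 scale1r => e.
exists rs; split=> // x xr; apply: (galois_conjugate mf).
by rewrite e root_prod_XsubC.
Qed.

Section Values.
Variables (G : oagType) (v : valuation F G).

(** Two nonzero terms of an algebraic equation for [y] have the same value; dividing one by the
    other leaves a power of [y] with the value of a constant. *)
Lemma algebraic_value y : y != 0 ->
  exists k c, [/\ (0 < k)%N, c != 0 & v (y ^+ k) = v (i c)].
Proof.
move=> y0; have [p p0 py] := alg y.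
pose E l := i p`_l * y ^+ l.
have [|||l [m [_ _ lm El0 lmE]]] :=
  @val_sum_eq0 F G v _ (index_iota 0 (size p)) E (iota_uniq _ _) _ (size p).-1.
- rewrite big_mkord -[RHS](rootP py) horner_coef size_map_poly.
  by apply: eq_bigr => l _; rewrite coef_map.
- by rewrite mem_index_iota /= ltn_predL size_poly_gt0.
- by rewrite mulf_neq0 ?expf_neq0 // fmorph_eq0 -lead_coefE lead_coef_eq0.
have Em0 : E m != 0 by rewrite -(val_eq_infty v) -lmE val_eq_infty.
have coef k : E k != 0 -> p`_k != 0.
  by apply: contra => /eqP e; rewrite /E e rmorph0 mul0r.
have main k l0 : (l0 < k)%N -> E k != 0 -> E l0 != 0 -> v (E l0) = v (E k) ->
    exists k c, [/\ (0 < k)%N, c != 0 & v (y ^+ k) = v (i c)].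
  move=> lk Ek El e; exists (k - l0)%N, (p`_l0 / p`_k); split.
  - by rewrite subn_gt0.
  - by rewrite mulf_neq0 ?invr_eq0 // coef.
  have ik : i p`_k != 0 by rewrite fmorph_eq0 coef.
  apply: (@valMl_eq _ _ _ _ _ (i p`_k * y ^+ l0)).
    by rewrite mulf_neq0 ?expf_neq0.
  rewrite -mulrA -exprD subnKC ?(ltnW lk) // -[LHS]e fmorph_div.
  by congr (v _); rewrite /E [RHS]mulrC mulrA mulfVK.
by have [h|h|h] := ltngtP l m; [apply: main h _ _ _|apply: main h _ _ _|rewrite h eqxx in lm].
Qed.
End Values.
End GaloisTheory.

(** * Conjugacy of valuations *)

Section Domination.
Variables (F : closedFieldType) (T : fieldType) (i : {rmorphism T -> F}).
Hypothesis alg : forall z, algebraicOver i z.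
Variables (G H : oagType) (v : valuation F G) (w : valuation F H) (A : set F).
Hypotheses (sA : subfield A) (iA : range i `<=` A).
Hypothesis dom : forall y, A y -> fin 0 <= v y -> fin 0 <= w y.

(** The quotient of [y ^+ k] by a constant of the same [v]-value is a unit for [v]; it and its
    inverse are then integral for [w]. *)
Lemma dominated_value y : A y -> y != 0 -> exists k c,
  [/\ (0 < k)%N, c != 0, v (y ^+ k) = v (i c) & w (y ^+ k) = w (i c)].
Proof.
move=> Ay y0; have [k [c [k0 c0 e]]] := algebraic_value alg v y0.
exists k, c; split=> //; have ic : i c != 0 by rewrite fmorph_eq0.
have yk : y ^+ k != 0 by rewrite expf_neq0.
have Ac : A (i c) by apply: iA; exists c.
have Ayk : A (y ^+ k) by exact: subfieldX.
apply: le_anti; rewrite -!val_div_ge0 // !dom ?val_div_ge0 ?e //;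
  exact: subfield_div.
Qed.

Lemma dominated_lt0 : equivalent_on (range i) w v ->
  forall y, A y -> v y < fin 0 -> w y < fin 0.
Proof.
move=> eq_wv y Ay vy.
have y0 : y != 0 by apply: contraTneq vy => ->; rewrite val0 ltNge le_infty.
have [k [c [k0 c0 ve we]]] := dominated_value Ay y0.
have one : range i 1 by exists 1; rewrite ?rmorph1.
have : v (i c) < v 1.
  by rewrite -ve val1 -valV_gt0 ?expf_neq0 // -exprVn; apply: valX_gt0; rewrite ?valV_gt0.
have ic : range i (i c) by exists c.
rewrite !ltNge -eq_wv //.
rewrite -we; apply: contra => wy; rewrite val1.
by rewrite valX_ge0.
Qed.

(** An inclusion of valuation rings is an equality here: if [v y < fin 0], some power of [y] has,
    for both valuations, the value of one constant, and the valuations agree on constants. *)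
Lemma dominated_equivalent : equivalent_on (range i) w v -> equivalent_on A w v.
Proof.
move=> eq_wv y z Ay Az; have [->|y0] := eqVneq y 0.
  by rewrite !val0 !leNgt !val_lt_infty.
have Azy : A (z / y) by exact: subfield_div.
rewrite -!val_div_ge0 //; apply/idP/idP; last exact: dom.
by rewrite !leNgt; apply: contra; apply: dominated_lt0.
Qed.
End Domination.

Lemma dominated_eq (F : closedFieldType) (T : fieldType) (i : {rmorphism T -> F})
    (G : oagType) (v w : valuation F G) (A : set F) :
  (forall z, algebraicOver i z) -> subfield A -> range i `<=` A ->
  (forall y, A y -> fin 0 <= v y -> fin 0 <= w y) ->
  (forall t, v (i t) = w (i t)) -> forall y, A y -> v y = w y.
Proof.
move=> alg sA iA dom e y Ay; have [->|y0] := eqVneq y 0; first by rewrite !val0.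
have [k [c [k0 c0 ve we]]] := dominated_value alg sA iA dom Ay y0.
have [g vg] := val_neq0 v y0; have [h wh] := val_neq0 w y0.
move: ve we; rewrite -e (valX k vg) (valX k wh) vg wh => <- /fin_inj e'.
by congr fin; apply/eqP; rewrite -subr_eq0; apply/eqP/(@oag_muln_eq0 _ _ k) => //;
  rewrite mulrnBl e' subrr.
Qed.

Section PrimeAvoidance.
Variables (F : fieldType) (R I : set F) (J : eqType) (P : J -> set F).
Hypotheses (IR : I `<=` R) (PR : forall j, P j `<=` R).
Hypotheses (I0 : I 0) (ID : forall x y, I x -> I y -> I (x + y)).
Hypothesis IM : forall x y, I x -> R y -> I (x * y).
Hypothesis PB : forall j x y, P j x -> P j y -> P j (x - y).
Hypothesis PM : forall j x y, P j x -> R y -> P j (x * y).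
Hypothesis Pprime : forall j x y, R x -> R y -> P j (x * y) -> P j x \/ P j y.

Lemma prime_avoidance (s : seq J) :
  (forall j, j \in s -> exists2 x, I x & ~ P j x) ->
  exists2 x, I x & forall j, j \in s -> ~ P j x.
Proof.
have [n] := ubnP (size s); elim: n s => // n IH [|j s] sn hs; first by exists 0.
have [[l ls lj]|no] := pselect (exists2 l, l \in s & P l `<=` P j).
  have [||x Ix hx] := IH (j :: rem l s).
  - by rewrite /= size_rem // prednK //; case: (s) ls.
  - move=> k; rewrite inE => /predU1P[->|/mem_rem ks]; apply: hs.
      exact: mem_head.
    by rewrite inE ks orbT.
  have nj : ~ P j x by apply: hx; exact: mem_head.
  exists x => // k; rewrite inE => /predU1P[->//|ks].
  have [->|kl] := eqVneq k l; first by move/lj.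
  by apply: hx; rewrite inE rem_mem ?orbT.
have [||y Iy hy] := IH s; first by rewrite /= in sn.
  by move=> k ks; apply: hs; rewrite inE ks orbT.
have [Py|] := pselect (P j y); last first.
  by move=> nPy; exists y => // k; rewrite inE => /predU1P[->//|/hy].
(* [p] is the product of an element of [I] outside [P j] and of one element of each [P l] outside
   [P j]. *)
have [p [Ip nPp Pp]] : exists p, [/\ I p, ~ P j p & forall l, l \in s -> P l p].
  have : {subset s <= s} by []; move: {1 3}s; elim=> [|l s' IHs] ss.
    by have [t It nt] := hs j (mem_head _ _); exists t.
  have [|p [Ip nPp Pp]] := IHs; first by move=> k ks; apply: ss; rewrite inE ks orbT.
  have [t Pt nPt] : exists2 t, P l t & ~ P j t.
    apply: contrapT => nex; apply: no; exists l; first exact/ss/mem_head.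
    by move=> t Pt; apply: contrapT => nPt; apply: nex; exists t.
  exists (p * t); split; first exact/IM/PR/Pt.
    by move/Pprime => [||//|//]; [exact: IR|exact: PR Pt].
  move=> k; rewrite inE => /predU1P[->|ks]; last exact/PM/PR/Pt/Pp.
  by rewrite mulrC; apply: PM => //; apply: IR.
exists (y + p); first exact: ID.
move=> k; rewrite inE => /predU1P[->|ks] Pk.
  by apply: nPp; rewrite -[p](addKr y) addrC; apply: PB.
by apply: (hy k ks); rewrite -[y](addrK p); apply: PB => //; apply: Pp.
Qed.
End PrimeAvoidance.

Section Conjugacy.
Variables (F : closedFieldType) (T : fieldType) (i : {rmorphism T -> F}).
Hypothesis alg : forall z, algebraicOver i z.
Variables (G : oagType) (v w : valuation F G).
Hypothesis vw : forall t, v (i t) = w (i t).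
Variable z : F.
Local Notation Gal := (absolute_galois i).

(* A field containing [i(T)(z)], on which [s \in Gal] only depends on [s z]. *)
Definition determined : set F :=
  [set y | forall s t : {rmorphism F -> F}, Gal s -> Gal t -> s z = t z -> s y = t y].

(** The integral closure, in [determined], of the valuation ring of the base: the coefficients of a
    minimal polynomial are symmetric functions of the conjugates. *)
Definition conj_integral : set F :=
  [set y | determined y /\ forall s : {rmorphism F -> F}, Gal s -> fin 0 <= w (s y)].

(** The trace of the maximal ideal of [w o s] for [s z = x]; on [determined] the choice of such an
    [s] does not matter. *)
Definition conj_prime (x : F) : set F :=
  [set y | conj_integral y /\
     forall s : {rmorphism F -> F}, Gal s -> s z = x -> fin 0 < w (s y)].

Lemma determined_subfield : subfield determined.
Proof.
apply: subfieldP => [s t _ _ _|x y hx hy s t gs gt e|x y hx hy s t gs gt e].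
- by rewrite !rmorph1.
- by rewrite !rmorphB (hx s t) // (hy s t).
- by rewrite !fmorph_div (hx s t) // (hy s t).
Qed.

Lemma determined_base : range i `<=` determined.
Proof. by move=> _ [t _ <-] s s' [_ es] [_ es'] _; rewrite es es'. Qed.

Lemma determined_horner g : determined (map_poly i g).[z].
Proof. by move=> s t gs gt e; rewrite (galois_horner gs) (galois_horner gt) e. Qed.

(** The minimal polynomial of [y] has coefficients that are integral for [w], being symmetric
    functions of the conjugates, hence integral for [v], which agrees with [w] on the base. *)
Lemma conj_integral_ge0 y :
  (forall s : {rmorphism F -> F}, Gal s -> fin 0 <= w (s y)) -> fin 0 <= v y.
Proof.
move=> h; have [f mf] := minpoly_exists (alg y); have [_ fy _] := mf.
have [rs [e hrs]] := minpoly_split alg mf.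
apply: val_integral fy _; first by rewrite e monic_prod_XsubC.
move=> k; rewrite coef_map vw /= -(coef_map i f k) e.
by apply: val_prod_XsubC => x /hrs[s gs <-]; apply: h.
Qed.

(* [y] is a quotient of conjugate-integral elements whose denominator is a
   unit at [w o s]. *)
Lemma conj_integral_localization (s : {rmorphism F -> F}) y :
  Gal s -> determined y -> fin 0 <= w (s y) ->
  exists u, [/\ conj_integral u, conj_integral (u * y) & w (s u) = fin 0].
Proof.
move=> gs dy wy; have [->|y0] := eqVneq y 0.
  have R1 : conj_integral 1.
    by split=> [|t gt]; [exact: subfield1 determined_subfield|rewrite rmorph1 val1].
  exists 1; rewrite mulr0 rmorph1 val1; split=> //; split=> [|t gt].
    exact: subfield0 determined_subfield.
  by rewrite rmorph0 val0 le_infty.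
have [p p0 py] := alg y.
(* The last index at which the coefficients have least value: after division by that coefficient all
   are integral, and the later ones have positive value. *)
pose Q k := (p`_k != 0) && [forall l : 'I_(size p), w (i p`_k) <= w (i p`_l)].
have exQ : exists k, Q k.
  have sp : (0 < size p)%N by rewrite size_poly_gt0.
  case: (@arg_minP _ _ 'I_(size p) (Ordinal sp) predT (fun l => w (i p`_l))) => // k _ kmin.
  exists k; apply/andP; split; last by apply/forallP => l; apply: kmin.
  have lp : ((size p).-1 < size p)%N by rewrite ltn_predL.
  have := kmin (Ordinal lp) isT; rewrite -(fmorph_eq0 i) -(val_eq_infty w).
  apply: contraTneq => ->; rewrite -ltNge val_lt_infty fmorph_eq0.
  by rewrite -lead_coefE lead_coef_eq0.
have bQ k : Q k -> (k <= size p)%N.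
  by move=> /andP[pk _]; apply: contraNT pk; rewrite -ltnNge => /ltnW h; rewrite nth_default.
have [k /andP[pk /forallP pkmin] kmax] := ex_maxnP exQ bQ.
have ks : (k < size p)%N by rewrite ltnNge; apply: contra pk => h; rewrite nth_default.
pose c l := p`_l / p`_k.
have c_ge0 l : fin 0 <= w (i (c l)).
  rewrite fmorph_div val_div_ge0 ?fmorph_eq0 //.
  have [h|h] := ltnP l (size p); first exact: pkmin (Ordinal h).
  by rewrite (nth_default _ h) rmorph0 val0 le_infty.
have c_gt0 l : (k < l)%N -> fin 0 < w (i (c l)).
  move=> kl; rewrite fmorph_div val_div_gt0 ?fmorph_eq0 // lt_neqAle.
  have [h|h] := ltnP l (size p); last first.
    by rewrite (nth_default _ h) rmorph0 val0 le_infty val_eq_infty fmorph_eq0 pk.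
  rewrite (pkmin (Ordinal h)) andbT; apply: contraL kl => /eqP e.
  rewrite -leqNgt; apply: kmax; apply/andP; split.
    by rewrite -(fmorph_eq0 i) -(val_eq_infty w) -e val_eq_infty fmorph_eq0.
  by apply/forallP => l'; rewrite -e; apply: pkmin.
have ck : c k = 1 by rewrite /c divff.
(* Cutting the equation of [y] at [k] makes [u] a polynomial in [y] and [u * y] one in [y^-1], both
   with integral coefficients. So [u] and [u * y] are integral at every conjugate, whether or not
   [y] is integral there. *)
pose u := \sum_(k <= l < size p) i (c l) * y ^+ (l - k).
have uy : u * y = - \sum_(0 <= l < k) i (c l) * y^-1 ^+ (k - l.+1).
  apply: (@mulIf _ (y ^+ k)); first exact: expf_neq0.
  have e : \sum_(0 <= l < size p) i (c l) * y ^+ l = 0.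
    apply: (@mulfI _ (i p`_k)); first by rewrite fmorph_eq0.
    rewrite mulr0 -[RHS](rootP py) horner_coef size_map_poly mulr_sumr big_mkord.
    by apply: eq_bigr => l _; rewrite coef_map mulrA -rmorphM [p`_k * _]mulrC divfK.
  move: e; rewrite (@big_cat_nat _ _ _ k) ?(ltnW ks) //= => /eqP.
  rewrite addrC addr_eq0 => /eqP e.
  have -> : u * y * y ^+ k = (\sum_(k <= l < size p) i (c l) * y ^+ l) * y.
    rewrite mulrAC; congr (_ * _); rewrite /u mulr_suml !big_nat; apply: eq_bigr.
    by move=> l /andP[kl _]; rewrite -mulrA -exprD subnK.
  rewrite e !mulNr; congr (- _); rewrite !mulr_suml !big_nat; apply: eq_bigr.
  move=> l /andP[_ lk]; rewrite -!mulrA -exprSr; congr (_ * _).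
  have -> : y ^+ k = y ^+ (k - l.+1) * y ^+ l.+1 by rewrite -exprD subnK.
  by rewrite mulrA exprVn mulVf ?mul1r // expf_neq0.
have dc l : determined (i (c l)) by apply: determined_base; exists (c l).
have du : determined u.
  apply: (subfield_sum determined_subfield) => l _.
  by apply: (subfieldM determined_subfield) (dc l) _; apply: (subfieldX determined_subfield).
have wgs t l : Gal t -> w (t (i (c l))) = w (i (c l)) by move=> [_ ->].
have Ru : forall t : {rmorphism F -> F}, Gal t ->
    fin 0 <= w (t u) /\ fin 0 <= w (t (u * y)).
  move=> t gt; have [ty|ty] := leP (fin 0) (w (t y)).
    have tu : fin 0 <= w (t u).
      rewrite /u rmorph_sum; apply: val_sum_ge => l _.
      by rewrite rmorphM rmorphXn; apply: valM_ge0; rewrite ?wgs //; apply: valX_ge0.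
    by split=> //; rewrite rmorphM; apply: valM_ge0.
  have ty0 : t y != 0 by rewrite fmorph_eq0.
  have tyV : fin 0 < w (t y)^-1 by rewrite valV_gt0.
  have tuy : fin 0 <= w (t (u * y)).
    rewrite uy rmorphN valN rmorph_sum; apply: val_sum_ge => l _.
    rewrite rmorphM rmorphXn fmorphV; apply: valM_ge0; rewrite ?wgs //.
    by apply/valX_ge0/ltW.
  split=> //; have -> : t u = t (u * y) * (t y)^-1 by rewrite rmorphM mulfK.
  by apply: valM_ge0 => //; apply: ltW.
exists u; split.
- by split=> // t /Ru[].
- by split=> [|t /Ru[] //]; apply: (subfieldM determined_subfield).
have -> : u = 1 + \sum_(k.+1 <= l < size p) i (c l) * y ^+ (l - k).
  by rewrite /u big_ltn // subnn expr0 mulr1 ck rmorph1.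
rewrite rmorphD rmorph1 valDl ?val1 // rmorph_sum big_nat.
apply: val_sum_gt => // l /andP[kl _].
rewrite rmorphM rmorphXn; apply: valM_gt0; last by apply: valX_ge0.
by rewrite wgs // c_gt0.
Qed.

(** If the centre [m0] of [v] lay in no [conj_prime] of a conjugate of [z], prime avoidance would
    give [x] in [m0] outside all of them; then every conjugate of [x^-1] is integral for [w], so
    [v x^-1 >= fin 0], against [v x > fin 0]. Hence [m0] lies in one [conj_prime], and localization
    puts the ring of [w o s] inside that of [v]. *)
Lemma simple_conjugacy : exists2 s : {rmorphism F -> F}, Gal s &
  forall g, w (map_poly i g).[s z] = v (map_poly i g).[z].
Proof.
have sD := determined_subfield.
have [f mf] := minpoly_exists (alg z); have [rs [rsE hrs]] := minpoly_split alg mf.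
pose m0 : set F := [set y | conj_integral y /\ fin 0 < v y].
have RD x y : conj_integral x -> conj_integral y -> conj_integral (x + y).
  move=> [dx hx] [dy hy]; split=> [|s gs]; first by apply: (subfieldD sD).
  by rewrite rmorphD valD_ge ?hx ?hy.
have RB x y : conj_integral x -> conj_integral y -> conj_integral (x - y).
  move=> [dx hx] [dy hy]; split=> [|s gs]; first by apply: (subfieldB sD).
  by rewrite rmorphB valB_ge ?hx ?hy.
have RM x y : conj_integral x -> conj_integral y -> conj_integral (x * y).
  move=> [dx hx] [dy hy]; split=> [|s gs]; first by apply: (subfieldM sD).
  by rewrite rmorphM valM_ge0 ?hx ?hy.
have Rv y : conj_integral y -> fin 0 <= v y by move=> [_ /conj_integral_ge0].
have [j jr m0j] : exists2 j, j \in rs & m0 `<=` conj_prime j.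
  apply: contrapT => no.
  have dich j (s : {rmorphism F -> F}) x : Gal s -> s z = j -> conj_integral x ->
      fin 0 < w (s x) -> conj_prime j x.
    move=> gs sj [dx Rx] wx; split=> // t gt tj.
    by rewrite (dx t s) // tj.
  have [|||||||||x [Rx vx] hx] :=
      @prime_avoidance F conj_integral m0 F conj_prime _ _ _ _ _ _ _ _ rs.
  - by move=> x [].
  - by move=> j x [].
  - split; last by rewrite val0.
    by split=> [|s gs]; [exact: subfield0|rewrite rmorph0 val0 le_infty].
  - by move=> x y [Rx vx] [Ry vy]; split; [exact: RD|exact: valD_gt].
  - by move=> x y [Rx vx] Ry; split; [exact: RM|apply: valM_gt0 => //; exact: Rv].
  - move=> j x y [Rx Px] [Ry Py]; split; first exact: RB.
    by move=> s gs sj; rewrite rmorphB; apply: valB_gt; [exact: Px|exact: Py].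
  - move=> j x y [Rx Px] Ry; split; first exact: RM.
    by move=> s gs sj; rewrite rmorphM; apply: valM_gt0; [exact: Px|case: Ry => _; apply].
  - move=> j x y Rx Ry [Rxy Pxy].
    have [[s [gs sj]]|nos] := pselect (exists s : {rmorphism F -> F}, Gal s /\ s z = j);
      last by left; split=> // s gs sj; exfalso; apply: nos; exists s.
    have [wx|wx] := ltP (fin 0) (w (s x)); first by left; apply: dich wx.
    right; apply: (dich j s) => //; have := Pxy s gs sj; rewrite rmorphM valM.
    have -> : w (s x) = fin 0 by apply: le_anti; rewrite wx Rx.2.
    by rewrite ext_add0.
  - move=> j jr; apply: contrapT => nex; apply: no; exists j => // x m0x.
    by apply: contrapT => nP; apply: nex; exists x.
  have small (s : {rmorphism F -> F}) : Gal s -> w (s x) <= fin 0.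
    move=> gs; rewrite leNgt; apply/negP => wx; apply: (hx (s z)); last exact: dich wx.
    have [_ fz _] := mf; rewrite -root_prod_XsubC -rsE.
    exact: (galois_root gs).
  have gid : Gal (GRing.RMorphism.clone _ _ idfun _) by exact: galois_of_fix.
  have x0 : x != 0.
    by have := small _ gid; apply: contraTneq => -> /=; rewrite val0.
  suff : fin 0 <= v x^-1 by rewrite valV_ge0 // leNgt vx.
  apply: conj_integral_ge0 => s gs.
  by rewrite fmorphV valV_ge0 ?fmorph_eq0 // small.
have [s gs sz] := hrs j jr; exists s => // g.
have dg := determined_horner g.
rewrite -(galois_horner gs); apply: esym.
pose w' := restriction s w.
have [_ si] := gs.
apply: esym; apply: (@dominated_eq F T i G w' v determined) => //; last first.
- by move=> t; rewrite /w' /= si vw.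
- move=> y dy wy; have [u [Ru Ruy wu]] := conj_integral_localization gs dy wy.
  have vu : v u = fin 0.
    apply: le_anti; rewrite Rv // andbT leNgt; apply/negP => vu.
    have [_ /(_ s gs sz)] : conj_prime j u by apply: m0j.
    by rewrite wu ltxx.
  have := Rv _ Ruy; rewrite valM vu.
  by rewrite ext_add0.
exact: determined_base.
Qed.
End Conjugacy.

(** To adjoin one element, the embedding is first extended without regard to values by some [s1],
    then corrected by the automorphism that conjugacy supplies for [v1] and the pullback of [v2]
    along [s1]. *)
Lemma valued_extension (F : closedFieldType) (T : fieldType)
    (i1 i2 : {rmorphism T -> F}) (G : oagType) (v1 v2 : valuation F G) :
  (forall z, algebraicOver i1 z) -> (forall t, v1 (i1 t) = v2 (i2 t)) ->
  exists s : {rmorphism F -> F},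
    (forall t, s (i1 t) = i2 t) /\ (forall x, v2 (s x) = v1 x).
Proof.
move=> alg e; apply: (embedding_extension alg e) => T' k1 k2 alg' ek z.
have [s1 sk] := isomorphism_extension k2 alg'.
have [|s gs sz] := @simple_conjugacy F T' k1 alg' G v1 (restriction s1 v2) _ z.
  by move=> t; rewrite /= sk.
exists (s1 (s z)) => g; rewrite -sz /=.
by rewrite (map_poly_horner_morph sk).
Qed.

Lemma eq_of_equivalent (F : closedFieldType) (T : fieldType)
    (i : {rmorphism T -> F}) (G : oagType) (v w : valuation F G) (A : set F) :
  (forall z, algebraicOver i z) -> subfield A -> range i `<=` A ->
  (forall t, v (i t) = w (i t)) -> equivalent_on A w v ->
  forall y, A y -> v y = w y.
Proof.
move=> alg sA iA e eq_wv; apply: (dominated_eq alg sA iA) => // y Ay.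
have := eq_wv 1 y (subfield1 sA) Ay.
by rewrite !val1 => ->.
Qed.

(** * Henselianity as invariance of the valuation under automorphisms *)

Section Henselian.
Variables (F : closedFieldType) (T : fieldType) (i : {rmorphism T -> F}).
Hypothesis alg : forall z, algebraicOver i z.
Variables (G : oagType) (v : valuation F G).

Lemma henselian_invariant (s : {rmorphism F -> F}) : henselian v (range i) ->
  absolute_galois i s -> forall x, v (s x) = v x.
Proof.
move=> hv [_ si] x.
have e : equivalent_on [set: F] (restriction s v) v.
  apply: hv; first exact: valuationP.
  by move=> _ _ [y _ <-] [z _ <-] /=; rewrite !si.
apply: esym.
apply: (@eq_of_equivalent F T i G v (restriction s v) [set: F]) => //.
- by apply: subfieldP.
- by move=> t /=; rewrite si.
Qed.

(** If [y] is integral for [v], so are its conjugates and the coefficients of its minimal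
    polynomial. These lie in the base, so they are integral for any other extension, and then so is
    [y]. *)
Lemma invariant_henselian :
  (forall (s : {rmorphism F -> F}), absolute_galois i s -> forall x, v (s x) = v x) ->
  henselian v (range i).
Proof.
move=> inv H w0 w0P eq_w0v; pose w := Valuation w0P.
apply: (@dominated_equivalent F T i alg G H v w [set: F]) => //.
- by apply: subfieldP.
move=> y _ vy; have [f mf] := minpoly_exists (alg y); have [_ fy _] := mf.
have [rs [e hrs]] := minpoly_split alg mf.
apply: val_integral fy _; first by rewrite e monic_prod_XsubC.
move=> k.
have : fin 0 <= v (map_poly i f)`_k.
  by rewrite e; apply: val_prod_XsubC => x /hrs[s gs <-]; rewrite inv.
rewrite coef_map /= -(val1 v) -(rmorph1 i) -eq_w0v; [|by exists 1|by exists f`_k].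
by rewrite rmorph1 -[w0 1]/(w 1) val1.
Qed.
End Henselian.

(** * Henselian subfields *)

Lemma polyOver_range (T F : fieldType) (i : {rmorphism T -> F}) (P : {poly F}) :
  (forall k, range i P`_k) -> exists p, map_poly i p = P.
Proof.
move=> h; have [k|c cE] := @choice nat T (fun k t => i t = P`_k) _.
  by have [t _ <-] := h k; exists t.
exists (\poly_(k < size P) c k); apply/polyP => k; rewrite coef_map coef_poly.
case: ltnP => [_|sk]; first exact: cE.
by rewrite (nth_default _ sk); exact: rmorph0.
Qed.

Section FixedField.
Variables (F : closedFieldType) (T : fieldType) (i : {rmorphism T -> F}).
Hypothesis alg : forall z, algebraicOver i z.
Variable s : {rmorphism F -> F}.
Hypothesis si : forall t, s (i t) = i t.

Definition fixed_set : set F := [set x | s x = x].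

Lemma fixed_set_subfield : subfield fixed_set.
Proof.
apply: subfieldP => [|x y hx hy|x y hx hy]; rewrite /fixed_set /=.
- by rewrite rmorph1.
- by rewrite rmorphB hx hy.
- by rewrite fmorph_div hx hy.
Qed.

(** The orbit of [z] lies among the roots of a polynomial over [i(T)], so it is finite, and [s],
    being injective, permutes it; [P] is the product over the orbit. *)
Lemma fixed_orbit_poly z : exists P : {poly F},
  [/\ P != 0, forall k, fixed_set P`_k &
      forall x, root P x <-> exists n, x = iter n s z].
Proof.
have [p p0 pz] := alg z.
have [rs e] := closed_field_poly_normal (map_poly i p).
have lc : lead_coef (map_poly i p) != 0 by rewrite lead_coef_eq0 map_poly_eq0.
have rootE x : root (map_poly i p) x = (x \in rs).
  by rewrite e rootZ // root_prod_XsubC.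
pose O := [seq x <- undup rs | `[< exists n, x = iter n s z >]].
have OP x : x \in O <-> exists n, x = iter n s z.
  rewrite mem_filter; split=> [/andP[/asboolP //]|ex]; rewrite asboolT //=.
  rewrite mem_undup -rootE; case: ex => n ->; elim: n => // n IH.
  by rewrite iterS; have := IH => /rootP h; apply/rootP;
    rewrite -(map_poly_horner_morph si) h rmorph0.
have uO : uniq O by rewrite filter_uniq // undup_uniq.
have sO : perm_eq (map s O) O.
  have usO : uniq (map s O) by rewrite map_inj_uniq //; exact: fmorph_inj.
  have sub : {subset map s O <= O}.
    by move=> _ /mapP[x /OP[n ->] ->]; apply/OP; exists n.+1.
  have [|_ h] := uniq_min_size usO sub; first by rewrite size_map.
  exact: uniq_perm.
exists (\prod_(x <- O) ('X - x%:P)); split.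
- by apply/monic_neq0/monic_prod_XsubC.
- move=> k; rewrite /fixed_set /= -coef_map rmorph_prod.
  rewrite (eq_bigr (fun x => 'X - (s x)%:P)); last first.
    by move=> x _; rewrite rmorphB /= map_polyX map_polyC.
  by rewrite -(big_map s xpredT (fun x => 'X - x%:P)) (perm_big _ sO).
by move=> x; rewrite root_prod_XsubC.
Qed.

(** A conjugate of [z] over the fixed field is an iterate of [s] at [z], hence has the value of
    [z]. *)
Lemma fixed_set_henselian (G : oagType) (v : valuation F G) :
  (forall x, v (s x) = v x) -> henselian v fixed_set.
Proof.
move=> vs; have [T' [i' e']] := subfield_inclusion fixed_set_subfield.
have alg' z : algebraicOver i' z.
  by apply: algebraicOver_sub (alg z); rewrite e' => _ [t _ <-]; apply: si.
rewrite -e'; apply: invariant_henselian => // t gt z.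
have [P [P0 Pk Pr]] := fixed_orbit_poly z.
have [|q qE] := @polyOver_range _ _ i' P; first by move=> k; rewrite e'.
have /Pr[n ->] : root P (t z).
  by rewrite -qE; apply: (galois_root gt); rewrite qE; apply/Pr; exists 0%N.
by elim: n => //= n; rewrite vs.
Qed.

Lemma henselization_fixed (G : oagType) (v : valuation F G) (L : set F) z :
  (forall x, v (s x) = v x) -> L `<=` fixed_set -> henselization v L z -> s z = z.
Proof.
move=> vs sL hz; apply: (hz fixed_set); split=> //.
by split; [exact: fixed_set_subfield|exact: fixed_set_henselian].
Qed.
End FixedField.

(** * Purely inseparable elements *)

Section Inseparable.
Variables (F : closedFieldType).

Lemma pchar_pow_inj p k (x y : F) : p \in [pchar F] ->
  x ^+ (p ^ k) = y ^+ (p ^ k) -> x = y.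
Proof.
move=> pF; elim: k => [|k IH]; first by rewrite expn0 !expr1.
rewrite expnSr !exprM => e; apply: IH.
by exact: (fmorph_inj (pFrobenius_aut pF)) e.
Qed.

Variables (T : fieldType) (i : {rmorphism T -> F}).
Hypothesis alg : forall z, algebraicOver i z.

Lemma minpoly_range f z : is_minpoly i f z -> (size f <= 2)%N -> range i z.
Proof.
move=> mf sf; have [mo fz _] := mf; exists (- f`_0) => //.
have s2 : size f = 2 by apply/eqP; rewrite eqn_leq sf (minpoly_size mf).
have f1 : f`_1 = 1 by move: mo; rewrite monicE lead_coefE s2 => /eqP.
move: fz; rewrite rootE horner_coef size_map_poly s2 big_ord_recl big_ord1.
rewrite !coef_map /= f1 rmorph1 mul1r mulr1 addr_eq0 => /eqP e.
by rewrite rmorphN e opprK.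
Qed.

Lemma minpoly_fixed_square f c :
  is_minpoly i f c -> (forall s, absolute_galois i s -> s c = c) ->
  (2 < size f)%N -> exists q, map_poly i f = ('X - c%:P) ^+ 2 * q.
Proof.
move=> mf fixc sf; have [rs [e hrs]] := minpoly_split alg mf.
have : size rs = (size f).-1 by rewrite -(size_map_poly i) e size_prod_XsubC.
have rc x : x \in rs -> x = c by move=> /hrs[s gs <-]; apply: fixc.
case: rs e rc {hrs} => [|x [|y rs]] e rc /= srs.
- by move: sf srs; case: (size f) => [|[|[|n]]].
- by move: sf srs; case: (size f) => [|[|[|n]]].
exists (\prod_(t <- rs) ('X - t%:P)); rewrite e !big_cons.
by rewrite (rc x) ?mem_head // (rc y) ?inE ?eqxx ?orbT // mulrA expr2.
Qed.

Lemma separable_fixed_range p c : root (map_poly i p) c -> separable_poly p ->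
  (forall s, absolute_galois i s -> s c = c) -> range i c.
Proof.
move=> pc sp fixc; have [f mf] := minpoly_exists (alg c).
have [sf|sf] := leqP (size f) 2; first exact: minpoly_range mf sf.
have [q e] := minpoly_fixed_square mf fixc sf.
have := @separable_nosquare _ (map_poly i p) ('X - c%:P) 2.
rewrite separable_map size_XsubC sp => /(_ isT isT isT) /negP[].
have fp : f %| p by rewrite -(minpolyP _ mf).
by rewrite -(divpK fp) rmorphM /= e mulrCA dvdp_mulr.
Qed.

Lemma natr_eq0_pchar n : (0 < n)%N -> n%:R = 0 :> T ->
  exists2 p, p \in [pchar F] & p \in [pchar T].
Proof.
move=> n0 /eqP/(natf0_pchar n0)[p pT]; exists p => //.
by rewrite (fmorph_pchar i).
Qed.

(** Induction on the degree of the minimal polynomial [f] of a fixed [u]. If it exceeds 1, [u] is a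
    multiple root, so the derivative of [f] vanishes at [u] and is 0 by degree; then [f] is a
    polynomial in ['X^p], and [u ^+ p] has smaller degree. *)
Lemma purely_inseparable_fixed c : (forall s, absolute_galois i s -> s c = c) ->
  range i c \/
  exists p k, [/\ p \in [pchar F] & range i (c ^+ (p ^ k))].
Proof.
move=> fixc.
have small u f : (forall s, absolute_galois i s -> s u = u) -> is_minpoly i f u ->
    (2 < size f)%N -> exists2 p, p \in [pchar F] & exists g : {poly T},
      [/\ g != 0, root (map_poly i g) (u ^+ p) & (size g < size f)%N].
  move=> fixu mf sf; have [mo fu _] := mf; have f0 := minpoly_neq0 mf.
  have [q e] := minpoly_fixed_square mf fixu sf.
  have d0 : f^`() = 0.
    have : root (map_poly i f^`()) u.
      rewrite -deriv_map e expr2 -mulrA derivM rootE hornerD.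
      rewrite [X in X + _]hornerM [X in _ + X]hornerM [X in _ * X + _]hornerM.
      by rewrite hornerXsubC subrr !(mul0r, mulr0) addr0.
    rewrite (minpolyP _ mf) => /dvdp_leq h; apply/eqP/negPn/negP => /h.
    by rewrite leqNgt lt_size_deriv.
  have dk k : f`_k.+1 *+ k.+1 = 0 by rewrite -coef_deriv d0 coef0.
  have sf1 : size f = (size f).-2.+2 by case: (size f) sf => [|[|n]].
  have [||p pF pT] := @natr_eq0_pchar (size f).-1; first by rewrite sf1.
    by have := dk (size f).-2; rewrite -[_.+1]/(_.-2.+2).-1 -sf1 -lead_coefE (monicP mo).
  have p1 : (1 < p)%N by rewrite prime_gt1 // (pcharf_prime pF).
  have p0 : (0 < p)%N by rewrite ltnW.
  have fk k : ~~ (p %| k)%N -> f`_k = 0.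
    case: k => [|k]; first by rewrite dvdn0.
    have /eqP := dk k; rewrite -mulr_natr mulf_eq0 -(dvdn_pcharf pT).
    by move=> /orP[/eqP//|->].
  pose g := \poly_(k < size f) f`_(p * k).
  have fE : f = g \Po 'X^p.
    apply/polyP => k; rewrite coef_comp_poly_Xn //; case: ifP => [pk|/negbT/fk //].
    rewrite coef_poly mulnC divnK //; case: ltnP => // h.
    by rewrite nth_default // (leq_trans h) // leq_div.
  have g0 : g != 0 by apply: contra_neq f0 => g0; rewrite fE g0 comp_poly0.
  exists p => //; exists g; split=> //.
    move: fu; rewrite {1}fE map_comp_poly /= map_polyXn !rootE horner_comp.
    by rewrite hornerXn.
  have := size_comp_poly g 'X^p; rewrite -fE size_polyXn /= => sfE.
  rewrite (polySpred g0) (polySpred f0) ltnS sfE -[X in (X < _)%N]muln1.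
  have : (0 < (size f).-1)%N by rewrite sf1.
  by rewrite sfE muln_gt0 => /andP[sg _]; rewrite ltn_pmul2l.
have fixX u n : (forall s, absolute_galois i s -> s u = u) ->
    forall s, absolute_galois i s -> s (u ^+ n) = u ^+ n.
  by move=> h s gs; rewrite rmorphXn h.
suff main n u f : (forall s, absolute_galois i s -> s u = u) ->
    is_minpoly i f u -> (size f < n)%N -> range i u \/
    exists p k, [/\ p \in [pchar F] & range i (u ^+ (p ^ k))].
  by have [f mf] := minpoly_exists (alg c); apply: main fixc mf (ltnSn _).
elim: n u f => // n IH u f fixu mf sn.
have [sf|sf] := leqP (size f) 2; first by left; apply: minpoly_range mf sf.
have [p pF [g [g0 gu sg]]] := small u f fixu mf sf.
have [f' mf'] := minpoly_exists (alg (u ^+ p)).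
have sf' : (size f' < n)%N.
  apply: leq_trans (leq_trans sg _); last by rewrite -ltnS.
  by rewrite ltnS dvdp_leq // -(minpolyP _ mf').
have [up|[q [k [qF uk]]]] := IH _ _ (fixX _ p fixu) mf' sf'.
  by right; exists p, 1; rewrite expn1.
right; exists p, k.+1; split=> //; rewrite expnS exprM.
by move: qF uk; rewrite (pcharf_eq pF) inE => /eqP ->.
Qed.

(* A maximal subfield avoiding [c] is so large that it has only purely
   inseparable algebraic extensions, since each proper one contains [c]. *)
Lemma maximal_avoiding_subfield p c : p \in [pchar F] -> ~ range i c ->
  range i (c ^+ p) -> exists M : set F, [/\ subfield M, range i `<=` M, ~ M c &
    forall z, exists k, M (z ^+ (p ^ k))].
Proof.
move=> pF nc cp.
pose P (M : set F) := M = set0 \/ [/\ subfield M, range i `<=` M & ~ M c].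
have [|M [PM Mmax]] := @Zorn_bigcup F P.
  move=> C CP tC; have [[A [CA An0]]|no] := pselect (exists A, C A /\ A !=set0).
    have CPn B x : C B -> B x -> [/\ subfield B, range i `<=` B & ~ B c].
      by move=> /CP[->|].
    have common x y : (\bigcup_(B in C) B) x -> (\bigcup_(B in C) B) y ->
        exists B, [/\ C B, subfield B, B x & B y].
      move=> [B CB Bx] [D CD Dy]; have [BD|DB] := tC _ _ CB CD.
        by exists D; have [] := CPn _ _ CD Dy; split=> //; apply: BD.
      by exists B; have [] := CPn _ _ CB Bx; split=> //; apply: DB.
    have [a Aa] := An0; have [sA iA nA] := CPn _ _ CA Aa.
    right; split.
    - apply: subfieldP; first by exists A => //; apply: subfield1.
        move=> x y Ux Uy; have [B [CB sB Bx By]] := common _ _ Ux Uy.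
        by exists B => //; apply: subfieldB.
      move=> x y Ux Uy; have [B [CB sB Bx By]] := common _ _ Ux Uy.
      by exists B => //; apply: subfield_div.
    - by move=> x ix; exists A => //; apply: iA.
    by move=> [B CB Bc]; have [_ _] := CPn _ _ CB Bc; apply.
  left; apply/seteqP; split=> // x [A CA Ax]; apply: no; exists A; split=> //.
  by exists x.
have [sM iM nMc] : [/\ subfield M, range i `<=` M & ~ M c].
  case: PM => // M0; exfalso; apply: (Mmax (range i)).
    by rewrite M0; split; [exact: sub0set|move=> /(_ (i 1)); apply; exists 1].
  by right; split=> //; exact: subfield_range.
exists M; split=> // z.
have [T' [k kE]] := subfield_inclusion sM.
have alg' y : algebraicOver k y by apply: algebraicOver_sub (alg y); rewrite kE.
(* Among the iterated [p]-th powers of [z], one of least degree over [M] is chosen, so that passing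
   to its [p]-th power does not lower the degree. *)
pose D n := `[< exists l f, is_minpoly k f (z ^+ (p ^ l)) /\ size f = n >].
have exD : exists n, D n.
  have [f mf] := minpoly_exists (alg' z).
  by exists (size f); apply/asboolP; exists 0%N, f; rewrite expn0 expr1.
have [n /asboolP[l [f [mf sf]]] nmin] := ex_minnP exD.
exists l; set u := z ^+ (p ^ l) in mf *; apply: contrapT => nMu.
have Mc : gen_field (range k `|` [set u]) c.
  apply: contrapT => nc'; apply: (Mmax (gen_field (range k `|` [set u]))).
    split; first by move=> x Mx; apply: sub_gen_field; left; rewrite kE.
    by move=> /(_ u) h; apply/nMu/h; apply: sub_gen_field; right.
  right; split=> //; first exact: gen_field_subfield.
  by move=> x /iM Mx; apply: sub_gen_field; left; rewrite kE.
move: Mc; rewrite gen_field_horner // => -[g0 _ g0E].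
pose g := g0 %% f; have [_ fu _] := mf; have f0 := minpoly_neq0 mf.
have gE : (map_poly k g).[u] = c.
  rewrite -g0E {1}(divp_eq g0 f) rmorphD rmorphM /= !hornerE (rootP fu).
  by rewrite mulr0 add0r.
have sg : (size g < size f)%N by rewrite ltn_modp.
have [t _ tE] : range k (c ^+ p) by rewrite kE; apply: iM.
(* By Frobenius, the value of [h] at [u ^+ p] is [c ^+ p], an element of [M]. As [h] has smaller
   degree than the minimal polynomial of [u ^+ p], it is constant; so [g] is constant too, and [c]
   lies in [M]. *)
pose h := \poly_(m < size g) g`_m ^+ p.
have hu : (map_poly k h).[u ^+ p] = c ^+ p.
  rewrite (@horner_coef_wide _ (size g)) ?size_map_poly ?size_poly // -gE.
  rewrite (@horner_coef_wide _ (size g) (map_poly k g)) ?size_map_poly //.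
  rewrite -[RHS](pFrobenius_autE pF) rmorph_sum; apply: eq_bigr => m _.
  rewrite !coef_map coef_poly ltn_ord /= !pFrobenius_autE exprMn rmorphXn.
  by rewrite exprAC.
have [f' mf'] := minpoly_exists (alg' (u ^+ p)).
have sf' : (size f <= size f')%N.
  rewrite sf; apply: nmin; apply/asboolP; exists l.+1, f'; split=> //.
  by rewrite expnSr exprM.
have hh : h - t%:P = 0.
  apply/eqP/negPn/negP => ht0.
  have : f' %| h - t%:P.
    rewrite -(minpolyP _ mf') rootE rmorphB /= map_polyC !hornerE hu subr_eq0.
    by apply/eqP/esym; exact: tE.
  move=> /(dvdp_leq ht0)/(leq_trans sf'); rewrite leqNgt => /negP; apply.
  apply: leq_ltn_trans (size_polyD _ _) _; rewrite size_polyN gtn_max.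
  rewrite (leq_ltn_trans (size_poly _ _) sg) /=.
  exact: leq_ltn_trans (size_polyC_leq1 _) (minpoly_size mf).
have gm m : g`_m.+1 = 0.
  have [mg|mg] := ltnP m.+1 (size g); last by rewrite nth_default.
  have /eqP : h`_m.+1 = 0.
    by rewrite -[h](subrK t%:P) hh add0r coefC.
  by rewrite coef_poly mg expf_eq0 => /andP[_ /eqP].
apply: nMc; rewrite -gE -kE; exists g`_0 => //.
have -> : g = (g`_0)%:P by apply/polyP => -[|m]; rewrite coefC //= coefC.
by rewrite map_polyC hornerC coefC.
Qed.

(** An automorphism over [M] fixes some [p]-power of each element, hence the element itself, so
    invariance is trivial. *)
Lemma purely_inseparable_henselian (G : oagType) (v : valuation F G) p (M : set F) :
  p \in [pchar F] -> subfield M -> range i `<=` M ->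
  (forall z, exists k, M (z ^+ (p ^ k))) -> henselian v M.
Proof.
move=> pF sM iM pM; have [T' [k kE]] := subfield_inclusion sM.
rewrite -kE; apply: invariant_henselian => [y|s [_ sk] x].
  by apply: algebraicOver_sub (alg y); rewrite kE.
have [n] := pM x; rewrite -kE => -[t _ tE]; congr (v _).
by apply: (pchar_pow_inj (k := n) pF); rewrite -rmorphXn -tE sk.
Qed.

End Inseparable.

(** * Monomial valuations *)

Section Monomial.
Variables (F : closedFieldType) (G : oagType) (W : valuation (ratfun F) G).
Variables (a : F) (gamma : G).
Hypothesis mono : is_monomial_valuation W a gamma.
Local Notation nu := (const_valuation W).
Implicit Types P Q : {poly F}.

(** The coefficient of [('X - a%:P) ^+ k] in [P], obtained by substitution so as to make sense in
    every characteristic. *)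
Definition taylor_coef P k : F := (P \Po ('X + a%:P))`_k.
Definition taylor_term P k : ratfun F :=
  ratconst (taylor_coef P k) * ratpoly ('X - a%:P) ^+ k.

Lemma taylor_poly P : P = (P \Po ('X + a%:P)) \Po ('X - a%:P).
Proof.
by rewrite -comp_polyA comp_polyD comp_polyX comp_polyC subrK comp_polyXr.
Qed.

Lemma val_shift : W (ratpoly ('X - a%:P)) = fin gamma.
Proof.
have := mono 'X; rewrite comp_polyX => ->; rewrite size_polyX !big_ord_recl big_ord0.
rewrite !coefX /= !rmorph0 !rmorph1 val0 val1 /= add0r mulr1n.
by apply/min_idPr.
Qed.

Lemma val_taylor_term P k :
  W (taylor_term P k) = ext_add (nu (taylor_coef P k)) (fin (gamma *+ k)).
Proof. by rewrite valM (valX k val_shift). Qed.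

Lemma taylor_sum P N : (size P <= N)%N -> ratpoly P = \sum_(k < N) taylor_term P k.
Proof.
move=> sP; rewrite {1}[P]taylor_poly comp_polyE rmorph_sum.
have sP' : (size (P \Po ('X + a%:P)) <= N)%N.
  by rewrite size_comp_poly2 // size_XaddC.
rewrite (big_ord_widen N (fun k => ratpoly ((P \Po ('X + a%:P))`_k *: ('X - a%:P) ^+ k))) //.
rewrite big_mkcond; apply: eq_bigr => k _; case: ltnP => [_|h].
  by rewrite /taylor_term /ratconst -mul_polyC rmorphM rmorphXn.
by rewrite /taylor_term /taylor_coef nth_default // rmorph0 mul0r.
Qed.

Lemma val_le_taylor P k : W (ratpoly P) <= W (taylor_term P k).
Proof.
have [kP|kP] := ltnP k (size (P \Po ('X + a%:P))); last first.
  by rewrite /taylor_term /taylor_coef nth_default // rmorph0 mul0r val0 le_infty.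
rewrite {1}[P]taylor_poly mono val_taylor_term.
exact: (bigmin_le_cond _ (j := Ordinal kP)).
Qed.

Definition is_lead P i : Prop :=
  [/\ taylor_coef P i != 0, W (taylor_term P i) = W (ratpoly P) &
      forall k, (i < k)%N -> W (ratpoly P) < W (taylor_term P k)].

Lemma is_leadP P i : taylor_coef P i != 0 ->
  (forall k, W (taylor_term P i) <= W (taylor_term P k)) ->
  (forall k, (i < k)%N -> W (taylor_term P i) < W (taylor_term P k)) ->
  is_lead P i.
Proof.
move=> ci h1 h2.
have e : W (taylor_term P i) = W (ratpoly P).
  apply: le_anti; rewrite val_le_taylor andbT (taylor_sum (leqnn _)).
  by apply: val_sum_ge => k _; apply: h1.
by split=> // k ik; rewrite -e h2.
Qed.

Lemma taylor_term_eq0 P k : (taylor_term P k == 0) = (taylor_coef P k == 0).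
Proof.
rewrite mulf_eq0 fmorph_eq0 expf_eq0 tofrac_eq0 polyXsubC_eq0 andbF orbF //.
Qed.

Lemma lead_neq0 P i : is_lead P i -> P != 0.
Proof.
by move=> [ci e _]; rewrite -tofrac_eq0 -(val_eq_infty W) -e val_eq_infty taylor_term_eq0.
Qed.

Lemma taylor_termM P Q k : taylor_term (P * Q) k =
  \sum_(l < k.+1) taylor_term P l * taylor_term Q (k - l).
Proof.
rewrite /taylor_term /taylor_coef comp_polyM coefM rmorph_sum mulr_suml.
apply: eq_bigr => l _; rewrite rmorphM mulrACA -exprD subnKC //.
by rewrite -ltnS.
Qed.

Lemma taylor_termD P Q k :
  taylor_term (P + Q) k = taylor_term P k + taylor_term Q k.
Proof. by rewrite /taylor_term /taylor_coef comp_polyD coefD rmorphD mulrDl. Qed.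

(** Gauss's lemma: a product of terms of indices [l] and [m] has strictly larger value if [i < l] or
    [j < m]. This covers every other product contributing to index [i + j], and all those beyond. *)
Lemma lead_mul P Q i j : is_lead P i -> is_lead Q j -> is_lead (P * Q) (i + j).
Proof.
move=> lP lQ; have [ci ei hi] := lP; have [cj ej hj] := lQ.
have finP : W (ratpoly P) != infty by rewrite val_eq_infty tofrac_eq0 (lead_neq0 lP).
have finQ : W (ratpoly Q) != infty by rewrite val_eq_infty tofrac_eq0 (lead_neq0 lQ).
have ge l m : W (ratpoly P * ratpoly Q) <= W (taylor_term P l * taylor_term Q m).
  rewrite (valM _ (ratpoly P)) (valM _ (taylor_term P l)).
  by apply: ext_leD; apply: val_le_taylor.
have gt l m : (i < l)%N \/ (j < m)%N ->
    W (ratpoly P * ratpoly Q) < W (taylor_term P l * taylor_term Q m).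
  rewrite (valM _ (ratpoly P)) (valM _ (taylor_term P l)) => -[il|jm].
    by apply: ext_lt_leD; [exact: hi|exact: val_le_taylor|].
  rewrite ![ext_add _ (W (_ Q _))]ext_addC ![ext_add _ (W (ratpoly Q))]ext_addC.
  by apply: ext_lt_leD; [exact: hj|exact: val_le_taylor|].
have PQfin : W (ratpoly P * ratpoly Q) < infty.
  by rewrite val_lt_infty mulf_neq0 // -(val_eq_infty W).
have e : W (taylor_term (P * Q) (i + j)) = W (ratpoly P * ratpoly Q).
  have li : (i < (i + j).+1)%N by rewrite ltnS leq_addr.
  rewrite taylor_termM (bigD1 (Ordinal li)) //= addKn.
  have eij : W (taylor_term P i * taylor_term Q j) = W (ratpoly P * ratpoly Q).
    by rewrite (valM _ (taylor_term P i)) ei ej -valM.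
  rewrite valDl eij //; apply: val_sum_gt => // l li'; apply: gt.
  have {}li' : l != i :> nat by [].
  case: (ltngtP i l) => [h|h|h]; [by left|right|by case/eqP: li'; rewrite -h].
  by rewrite -(ltn_add2l l) subnKC ?ltn_add2r // -ltnS.
apply: is_leadP.
- by rewrite -taylor_term_eq0 -(val_eq_infty W) e lt_eqF.
- by move=> k; rewrite e taylor_termM; apply: val_sum_ge.
move=> k ijk; rewrite e taylor_termM; apply: val_sum_gt => // l _; apply: gt.
have [il|li] := ltnP i l; [by left|right].
have lk : (l <= k)%N by rewrite -ltnS.
rewrite -(ltn_add2l l) subnKC //; apply: leq_ltn_trans ijk.
by rewrite leq_add2r.
Qed.

Lemma lead_add_dominant P Q i : is_lead P i ->
  (forall k, W (ratpoly P) <= W (taylor_term Q k)) ->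
  (forall k, (i <= k)%N -> W (ratpoly P) < W (taylor_term Q k)) ->
  is_lead (P + Q) i /\ W (ratpoly (P + Q)) = W (ratpoly P).
Proof.
move=> lP h1 h2; have [ci ei hi] := lP.
have e : W (taylor_term (P + Q) i) = W (ratpoly P).
  by rewrite taylor_termD valDl ei // h2.
suff l : is_lead (P + Q) i by split=> //; have [_ <- _] := l.
apply: is_leadP.
- rewrite -taylor_term_eq0 -(val_eq_infty W) e val_eq_infty tofrac_eq0.
  exact: lead_neq0 lP.
- by move=> k; rewrite e taylor_termD valD_ge // val_le_taylor.
move=> k ik; rewrite e taylor_termD valD_gt ?hi //; apply: h2; exact: ltnW.
Qed.

(** The summand of smaller value dominates; for equal values, the one of larger lead does. *)
Lemma lead_add P Q i j : is_lead P i -> is_lead Q j -> i != j ->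
  exists2 l, (l == i) || (l == j) & [/\ is_lead (P + Q) l,
    W (ratpoly (P + Q)) <= W (ratpoly P) & W (ratpoly (P + Q)) <= W (ratpoly Q)].
Proof.
have dom P' Q' i' j' : is_lead P' i' -> is_lead Q' j' ->
    (W (ratpoly P') < W (ratpoly Q')) || ((W (ratpoly P') == W (ratpoly Q')) && (j' < i')%N) ->
    [/\ is_lead (P' + Q') i', W (ratpoly (P' + Q')) <= W (ratpoly P') &
      W (ratpoly (P' + Q')) <= W (ratpoly Q')].
  move=> lP' lQ' h; have [_ _ hQ] := lQ'.
  have [|k ik|lPQ ->] := lead_add_dominant lP' (Q := Q').
  - move=> k; apply: le_trans (val_le_taylor _ _).
    by case/orP: h => [/ltW //|/andP[/eqP -> _]].
  - case/orP: h => [h|/andP[/eqP -> ji]]; last by apply: hQ; apply: leq_trans ik.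
    by apply: lt_le_trans h (val_le_taylor _ _).
  by split=> //; case/orP: h => [/ltW //|/andP[/eqP -> _]].
move=> lP lQ ij; have [h|h|h] := ltgtP (W (ratpoly P)) (W (ratpoly Q)).
- by exists i; rewrite ?eqxx //; apply: (dom _ _ _ j); rewrite ?h.
- exists j; rewrite ?eqxx ?orbT // addrC.
  by have [|l1 l2 l3] := dom _ _ _ _ lQ lP; rewrite ?h.
have [ji|ij'|e] := ltngtP j i.
- by exists i; rewrite ?eqxx //; apply: (dom _ _ _ j); rewrite ?h ?eqxx ?ji ?orbT.
- exists j; rewrite ?eqxx ?orbT // addrC.
  by have [|l1 l2 l3] := dom _ _ _ _ lQ lP; rewrite ?h ?eqxx ?ij' ?orbT //; split.
by rewrite e eqxx in ij.
Qed.

Lemma taylor_coef0 P : taylor_coef P 0 = P.[a].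
Proof.
by rewrite /taylor_coef -horner_coef0 horner_comp !hornerE.
Qed.

Lemma lead0_val P : is_lead P 0 ->
  W (ratpoly P) = nu P.[a] /\ W (ratpoly P) < W (ratpoly P - ratconst P.[a]).
Proof.
move=> lP; have [_ e h] := lP; split.
  by rewrite -e val_taylor_term taylor_coef0 mulr0n ext_addC ext_add0.
have -> : ratconst P.[a] = taylor_term P 0 by rewrite /taylor_term taylor_coef0 mulr1.
have fP : W (ratpoly P) < infty.
  by rewrite val_lt_infty tofrac_eq0 (lead_neq0 lP).
rewrite [X in _ < W (X - _)](taylor_sum (leqnSn _)) big_ord_recl /= addrC addKr.
by apply: val_sum_gt => // k _; exact: h.
Qed.

Lemma lead_const c : c != 0 -> is_lead c%:P 0.
Proof.
move=> c0; have tk k : taylor_coef c%:P k = if k == 0%N then c else 0.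
  by rewrite /taylor_coef comp_polyC coefC.
apply: is_leadP; rewrite ?tk // => -[|k] //; rewrite /taylor_term !tk /= rmorph0 mul0r val0.
  by rewrite le_infty.
by move=> _; rewrite val_lt_infty mulr1 fmorph_eq0.
Qed.

Definition near_center z : bool := fin gamma <= nu (a - z).

(** The two Taylor terms are [a - z] and [x - a]. The boolean is read as the index 0 or 1, and a tie
    gives 1, the last index of least value. *)
Lemma lead_linear z : is_lead ('X - z%:P) (near_center z).
Proof.
have tk k : taylor_coef ('X - z%:P) k =
    if k == 0%N then a - z else if k == 1%N then 1 else 0.
  rewrite /taylor_coef comp_polyB comp_polyX comp_polyC -addrA -polyCB.
  rewrite coefD coefX coefC; case: k => [|[|k]]; rewrite ?add0r ?addr0 //=.
have v0 : W (taylor_term ('X - z%:P) 0) = nu (a - z).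
  by rewrite val_taylor_term tk mulr0n ext_addC ext_add0.
have v1 : W (taylor_term ('X - z%:P) 1) = fin gamma.
  by rewrite val_taylor_term tk mulr1n val1 ext_add0.
have vk k : W (taylor_term ('X - z%:P) k.+2) = infty.
  by rewrite /taylor_term tk rmorph0 mul0r val0.
rewrite /near_center; have [h|h] := leP (fin gamma) (nu (a - z)); apply: is_leadP => /=.
- by rewrite tk /= oner_eq0.
- by move=> [|[|k]]; rewrite ?v0 ?v1 ?vk ?le_infty.
- by move=> [|[|k]]; rewrite ?v0 ?v1 ?vk.
- by rewrite tk /= -(val_eq_infty nu) lt_eqF // (lt_trans h).
- by move=> [|[|k]]; rewrite ?v0 ?v1 ?vk ?le_infty // ltW.
- by move=> [|[|k]]; rewrite ?v0 ?v1 ?vk // (lt_trans h).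
Qed.

Lemma lead_prod (rs : seq F) :
  is_lead (\prod_(z <- rs) ('X - z%:P)) (count near_center rs).
Proof.
elim: rs => [|z rs IH]; first by rewrite big_nil -[1]/(1%:P); apply/lead_const/oner_neq0.
by rewrite big_cons /=; apply: lead_mul IH; apply: lead_linear.
Qed.

Lemma lead_exists P : P != 0 -> exists i, is_lead P i.
Proof.
move=> P0; have [rs ->] := closed_field_poly_normal P.
exists (0 + count near_center rs)%N.
rewrite -mul_polyC; apply: lead_mul (lead_prod _).
by apply: lead_const; rewrite lead_coef_eq0.
Qed.

Lemma lead_shiftX k : is_lead (('X - a%:P) ^+ k) k.
Proof.
elim: k => [|k IH]; first by apply/lead_const/oner_neq0.
rewrite exprS -add1n; apply: lead_mul IH.
by have := lead_linear a; rewrite /near_center subrr val0 le_infty.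
Qed.

End Monomial.

Lemma ratmap_poly (K F : fieldType) (f : {rmorphism K -> F}) (p : {poly K}) :
  ratmap f (ratpoly p) = ratpoly (map_poly f p).
Proof.
rewrite -[ratpoly p]divr1 -(rmorph1 (@FracField.tofrac _)) ratmapE ?oner_neq0 //.
by rewrite rmorph1 rmorph1 divr1.
Qed.

Lemma common_denominator (K : fieldType) n (r : 'I_n -> ratfun K) :
  exists (g : {poly K}) (f : 'I_n -> {poly K}), g != 0 /\
    forall k, r k = ratpoly (f k) / ratpoly g.
Proof.
have [k|pq pqE] := @choice 'I_n ({poly K} * {poly K})%type
    (fun k pq => pq.2 != 0 /\ r k = ratpoly pq.1 / ratpoly pq.2) _.
  by have [p [q [q0 e]]] := ratfunP (r k); exists (p, q).
exists (\prod_k (pq k).2), (fun k => (pq k).1 * \prod_(l | l != k) (pq l).2).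
split; first by apply/prodf_neq0 => k _; case: (pqE k).
move=> k; have [q0 ->] := pqE k.
set R := \prod_(l | l != k) _.
have -> : \prod_l (pq l).2 = (pq k).2 * R by rewrite (bigD1 k).
rewrite !rmorphM /= invfM mulrACA mulfV ?mulr1 //.
by rewrite tofrac_eq0; apply/prodf_neq0 => l _; case: (pqE l).
Qed.

Section Base.
Variables (K : fieldType) (F : closedFieldType) (iota : {rmorphism K -> F}).
Hypothesis alg : forall z : F, algebraicOver iota z.
Variables (G : oagType) (W : valuation (ratfun F) G) (a : F) (gamma : G).
Hypothesis mp : minimal_pair iota W a gamma.
Variable Q : {poly K}.
Hypothesis mQ : is_minpoly iota Q a.
Local Notation nu := (const_valuation W).
Local Notation lead := (is_lead W a).
Local Notation px p := (ratpoly (map_poly iota p) : ratfun F).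
Local Notation y := (ratpoly ('X - a%:P) : ratfun F).
Local Notation base := (base_ratfun iota).

Let mono : is_monomial_valuation W a gamma := mp.1.2.

Lemma near_center_size z f : near_center W a gamma z -> is_minpoly iota f z ->
  (size Q <= size f)%N.
Proof.
move=> nz mf; have := mp.2 z _ _ nz (adjoin_degree mQ) (adjoin_degree mf).
by rewrite (polySpred (minpoly_neq0 mQ)) (polySpred (minpoly_neq0 mf)) ltnS.
Qed.

(** The lead counts the roots near [a]; such a root would have degree at most that of [f], hence
    less than that of [a]. *)
Lemma lead_lt_minpoly (f : {poly K}) : f != 0 -> (size f < size Q)%N -> lead (map_poly iota f) 0.
Proof.
move=> f0 sf; have [rs e] := closed_field_poly_normal (map_poly iota f).
have lc : lead_coef (map_poly iota f) != 0 by rewrite lead_coef_eq0 map_poly_eq0.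
have := lead_mul mono (lead_const mono lc) (lead_prod mono rs).
rewrite mul_polyC -e add0n; suff -> : count (near_center W a gamma) rs = 0%N by [].
apply/eqP; rewrite -leqn0 leqNgt -has_count; apply/hasPn => z zr; apply/negP => nz.
have [h mh] := minpoly_exists (alg z).
have fz : root (map_poly iota f) z by rewrite e rootZ // root_prod_XsubC.
have := near_center_size nz mh; rewrite leqNgt => /negP; apply.
apply: leq_ltn_trans sf; apply: dvdp_leq => //.
by rewrite -(minpolyP _ mh).
Qed.

Variable rs : seq F.
Hypothesis QE : map_poly iota Q = \prod_(z <- rs) ('X - z%:P).
Let d := count (near_center W a gamma) rs.

Lemma lead_minpoly : lead (map_poly iota Q) d.
Proof. by rewrite QE; apply: lead_prod. Qed.

Lemma near_count_gt0 : (0 < d)%N.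
Proof.
rewrite -has_count; apply/hasP; exists a.
  by have [_ Qa _] := mQ; rewrite -root_prod_XsubC -QE.
by rewrite /near_center subrr val0 le_infty.
Qed.

(** Division by [Q]: the remainder has lead 0, and the product of [Q] with the quotient has, by
    induction, a positive multiple of [d]. The leads differ, so one of them survives in the sum. *)
Lemma lead_base (f : {poly K}) : f != 0 -> exists m, lead (map_poly iota f) (d * m).
Proof.
have [n] := ubnP (size f); elim: n f => // n IH f sf f0.
have Q0 := minpoly_neq0 mQ.
have [sfQ|sfQ] := ltnP (size f) (size Q).
  by exists 0%N; rewrite muln0; apply: lead_lt_minpoly.
pose g := f %/ Q; pose r := f %% Q.
have fE : f = r + Q * g by rewrite addrC mulrC -divp_eq.
have g0 : g != 0 by rewrite divp_eq0 negb_or f0 negb_or Q0 -leqNgt.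
have [|m lg] := IH g _ g0.
  rewrite size_divp //; apply: (@leq_trans (size f)); last by rewrite -ltnS.
  rewrite ltn_subrL size_poly_gt0 f0 andbT.
  by have := minpoly_size mQ; case: (size Q) => [|[|]].
have lQg : lead (map_poly iota (Q * g)) (d * m.+1).
  by rewrite rmorphM /= mulnS; apply: lead_mul lg => //; apply: lead_minpoly.
have [r0|r0] := eqVneq r 0; first by exists m.+1; rewrite fE r0 add0r.
have lr : lead (map_poly iota r) 0 by apply: lead_lt_minpoly => //; rewrite ltn_modp.
have [|l lE [lf _ _]] := lead_add mono lr lQg.
  by rewrite eq_sym muln_eq0 negb_or -lt0n near_count_gt0.
case/orP: lE => /eqP lE; rewrite lE -rmorphD -fE in lf.
  by exists 0%N; rewrite muln0.
by exists m.+1.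
Qed.

(** The nonzero terms have leads congruent to their index modulo [d], hence distinct, so nothing
    cancels. This is the independence of the powers of [y] below [d], at the level of values. *)
Lemma lead_combination (f : nat -> {poly K}) m : (m <= d)%N ->
  let S := \sum_(i < m) map_poly iota (f i) * ('X - a%:P) ^+ i in
  (forall i, (i < m)%N -> f i = 0) \/
  exists l, [/\ lead S l, (l %% d < m)%N &
    forall i, (i < m)%N -> W (ratpoly S) <= W (px (f i) * y ^+ i)].
Proof.
elim: m => [|m IH] md; first by left.
rewrite big_ord_recr /=; set S := \sum_(i < m) _.
have pfX i : ratpoly (map_poly iota (f i) * ('X - a%:P) ^+ i) = px (f i) * y ^+ i.
  by rewrite rmorphM rmorphXn.
have [f0|f0] := eqVneq (f m) 0.
  rewrite f0 rmorph0 mul0r addr0.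
  have [h|[l [lS lm hl]]] := IH (ltnW md).
    by left=> i; rewrite ltnS leq_eqVlt => /predU1P[->|/h].
  right; exists l; split=> //; first exact: ltnW.
  move=> i; rewrite ltnS leq_eqVlt => /predU1P[->|/hl //].
  by rewrite f0 !rmorph0 mul0r val0 le_infty.
have [q lf] := lead_base f0.
have lfm := lead_mul mono lf (lead_shiftX mono m).
have dm : ((d * q + m) %% d = m)%N by rewrite mulnC modnMDl modn_small.
right; have [h|[l [lS lm hl]]] := IH (ltnW md).
  have -> : S = 0 by rewrite /S big1 // => i _; rewrite h // rmorph0 mul0r.
  rewrite add0r; exists (d * q + m)%N; split=> //; first by rewrite dm.
  move=> i; rewrite ltnS leq_eqVlt => /predU1P[->|/h ->]; first by rewrite pfX.
  by rewrite !rmorph0 mul0r val0 le_infty.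
have [|l' l'E [lead' le1 le2]] := lead_add mono lS lfm.
  by apply: contraTneq lm => ->; rewrite dm ltnn.
exists l'; split=> //.
  by case/orP: l'E => /eqP ->; rewrite ?dm // ltnW.
move=> i; rewrite ltnS leq_eqVlt => /predU1P[->|/hl].
  by rewrite -pfX.
exact: le_trans.
Qed.

Lemma base_poly p : base (px p).
Proof. by exists (ratpoly p) => //; rewrite ratmap_poly. Qed.

Lemma base_subfield : subfield base. Proof. exact: subfield_range. Qed.

(* By minimality of the pair, elements of [K(a)] are residually constant
   polynomials over [K]. *)
Lemma adjoin_approx c : adjoin iota a c -> exists2 f, base f &
  W f = W (ratconst c) /\ forall z t, z != 0 -> t < infty ->
    t <= W (ratconst c * z) -> t < W ((f - ratconst c) * z).
Proof.
move=> Kc; have := Kc; rewrite /adjoin gen_field_horner // => -[g0 _ g0E].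
pose g := g0 %% Q; have [_ Qa _] := mQ; have Q0 := minpoly_neq0 mQ.
have gE : (map_poly iota g).[a] = c.
  rewrite -g0E {1}(divp_eq g0 Q) rmorphD rmorphM /= !hornerE (rootP Qa).
  by rewrite mulr0 add0r.
have [g_0|g_0] := eqVneq g 0.
  have c0 : c = 0 by rewrite -gE g_0 rmorph0 horner0.
  exists 0; first exact: subfield0 base_subfield.
  by rewrite c0 rmorph0; split=> // z t z0 tf _; rewrite subrr mul0r val0.
have lg : lead (map_poly iota g) 0 by apply: lead_lt_minpoly => //; rewrite ltn_modp.
have [e1 e2] := lead0_val mono lg; rewrite gE in e1 e2.
exists (px g); first exact: base_poly.
split=> // z t z0 tf ct; apply: le_lt_trans ct _.
by rewrite ![_ * z]mulrC valMl_lt //; move: e1 e2 => /= <-.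
Qed.

Lemma taylor_coef_adjoin (P : {poly F}) k : (forall l, adjoin iota a P`_l) ->
  adjoin iota a (taylor_coef a P k).
Proof.
move=> hP; have sA : subfield (adjoin iota a) by exact: gen_field_subfield.
have [T [i iE]] := subfield_inclusion sA.
have [|p pE] := @polyOver_range _ _ i P; first by move=> l; rewrite iE.
have [t _ tE] : range i a by rewrite iE; apply: sub_gen_field; right.
rewrite -iE /taylor_coef -pE -tE -map_polyC -(map_polyX i) -rmorphD -map_comp_poly.
by rewrite coef_map; exists (p \Po ('X + t%:P))`_k.
Qed.

Lemma adjoin_base c : range iota c -> adjoin iota a c.
Proof. by move=> h; apply: sub_gen_field; left. Qed.

Lemma adjoin_gen : adjoin iota a a.
Proof. by apply: sub_gen_field; right. Qed.

(** As [a] is algebraic, [K(a, x)] consists of polynomials in [a] over [K(x)], and a common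
    denominator of their coefficients lies in [K[x]]. *)
Lemma adjoin_ratfun_repr u : adjoin_ratfun iota a u ->
  exists (P : {poly F}) (g : {poly K}), [/\ forall l, adjoin iota a P`_l, g != 0 &
    u = ratpoly P / px g].
Proof.
have alga : algebraicOver (ratmap iota) (ratconst a).
  have [f mf fa] := alg a; exists (map_poly (@ratconst K) f).
    by rewrite map_poly_eq0.
  have -> : map_poly (ratmap iota) (map_poly (@ratconst K) f) =
      map_poly (@ratconst F) (map_poly iota f).
    rewrite -!map_poly_comp; apply: eq_map_poly => c /=.
    by rewrite /ratconst ratmap_poly map_polyC.
  by rewrite fmorph_root.
rewrite /adjoin_ratfun gen_field_horner // => -[h _ <-].
have [g [f [g0 hE]]] := common_denominator (fun k : 'I_(size h) => h`_k).
exists (\sum_(k < size h) map_poly iota (f k) * (a ^+ k)%:P), g; split=> //.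
  have sA : subfield (adjoin iota a) by exact: gen_field_subfield.
  move=> l; rewrite coef_sum; apply: (subfield_sum sA) => k _.
  rewrite coefMC coef_map; apply: (subfieldM sA).
    by apply: adjoin_base; exists (f k)`_l.
  by apply: (subfieldX sA); apply: adjoin_gen.
rewrite horner_coef size_map_poly rmorph_sum mulr_suml; apply: eq_bigr => k _.
rewrite coef_map hE /= ratmapE // tofracM mulrAC; congr (_ * _).
by rewrite -[ratpoly _%:P]/(ratconst _) rmorphXn.
Qed.
End Base.

(** * Index and residue degree *)

Section IndexAndDegree.
Variables (K : fieldType) (F : closedFieldType) (iota : {rmorphism K -> F}).
Hypothesis alg : forall z : F, algebraicOver iota z.
Variables (G : oagType) (W : valuation (ratfun F) G) (a : F) (gamma : G).
Hypothesis mp : minimal_pair iota W a gamma.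
Variable Q : {poly K}.
Hypothesis mQ : is_minpoly iota Q a.
Variable rs : seq F.
Hypothesis QE : map_poly iota Q = \prod_(z <- rs) ('X - z%:P).
Let d := count (near_center W a gamma) rs.
Local Notation lead := (is_lead W a).
Local Notation px p := (ratpoly (map_poly iota p) : ratfun F).
Local Notation y := (ratpoly ('X - a%:P) : ratfun F).
Local Notation base := (base_ratfun iota).

Let mono : is_monomial_valuation W a gamma := mp.1.2.
Let sbase : subfield base := base_subfield iota.
Let y_neq0 : y != 0.
Proof. by rewrite tofrac_eq0 polyXsubC_eq0. Qed.

Lemma lead_value P k : lead P k -> W (ratpoly P) = W (ratconst (taylor_coef a P k) * y ^+ k).
Proof. by move=> [_ <- _]. Qed.

(** The minimal polynomial has the value of its Taylor term of index [d]; dividing it by an element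
    of [K(x)] with the value of the coefficient leaves that of [y ^+ d]. *)
Lemma base_value_shift : exists b, [/\ base b, b != 0 & W b = W (y ^+ d)].
Proof.
have lQ := lead_minpoly mp QE; have [cd _ _] := lQ.
have Kc : adjoin iota a (taylor_coef a (map_poly iota Q) d).
  by apply: taylor_coef_adjoin => l; apply: adjoin_base; rewrite coef_map; exists Q`_l.
have [f bf [Wf _]] := adjoin_approx alg mp mQ Kc.
have f0 : f != 0 by rewrite -(val_eq_infty W) Wf val_eq_infty fmorph_eq0.
have Q0 : px Q != 0 by rewrite tofrac_eq0 map_poly_eq0 (minpoly_neq0 mQ).
exists (px Q / f); split.
- by apply: (subfield_div sbase) => //; apply: base_poly.
- exact: div_neq0 Q0 f0.
apply: (valMl_eq f0).
by rewrite mulrC (mulfVK f0) (lead_value lQ) !valM Wf.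
Qed.

Lemma adjoin_ratfun_value u : adjoin_ratfun iota a u -> u != 0 ->
  exists b k, [/\ base b, b != 0, (k < d)%N & W u = W (b * y ^+ k)].
Proof.
move=> /(adjoin_ratfun_repr alg)[P [g [hP g0 uE]]] u0.
have gx0 : px g != 0 by rewrite tofrac_eq0 map_poly_eq0.
have P0 : P != 0.
  by apply: contraNneq u0 => P0; rewrite uE P0 rmorph0 mul0r.
have [k lP] := lead_exists mono P0.
have [f bf [Wf _]] := adjoin_approx alg mp mQ (taylor_coef_adjoin k hP).
have [ck _ _] := lP.
have f0 : f != 0 by rewrite -(val_eq_infty W) Wf val_eq_infty fmorph_eq0.
have [b [bb b0 Wb]] := base_value_shift.
exists (f / px g * b ^+ (k %/ d)), (k %% d)%N; split.
- apply: (subfieldM sbase); last exact: (subfieldX sbase).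
  by apply: (subfield_div sbase) => //; apply: base_poly.
- exact: mulf_neq0 (div_neq0 f0 gx0) (expf_neq0 _ b0).
- by rewrite ltn_pmod // (near_count_gt0 W gamma mQ QE).
apply: (valMl_eq gx0); rewrite uE mulrC (mulfVK gx0).
rewrite !mulrA [px g * f]mulrC (mulfK gx0) (lead_value lP) !valM Wf.
rewrite -ext_addA; congr ext_add; rewrite -valM.
rewrite {1}(divn_eq k d) exprD mulnC exprM !valM; congr ext_add.
elim: (k %/ d)%N => [|n IH]; first by rewrite !expr0.
by rewrite !exprS !valM IH Wb.
Qed.

Lemma value_group_ratmap (omega : valuation (ratfun K) G) :
  extends (ratmap iota) W omega ->
  value_group omega [set: ratfun K] = value_group W base.
Proof.
move=> e; apply/seteqP; split=> [g [r _ rg]|g [_ [r _ <-] rg]].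
  by exists (ratmap iota r); [exists r|rewrite e].
by exists r => //; rewrite -e.
Qed.

(** After clearing denominators, an equality of values compares monomials [c * y ^+ m] whose
    exponents differ modulo [d], by divisibility of leads. A positive multiple of [gamma] would then
    be the value of a constant. *)
Lemma base_value_shift_mod :
  (forall n c, (0 < n)%N -> W (ratconst c) != W (y ^+ n)) ->
  forall b b' k k', base b -> base b' -> b != 0 -> b' != 0 ->
  (k < d)%N -> (k' < d)%N -> W (b * y ^+ k) = W (b' * y ^+ k') -> k = k'.
Proof.
move=> ntor.
suff main b b' k k' : base b -> base b' -> b != 0 -> b' != 0 ->
    (k < k')%N -> (k' < d)%N -> W (b * y ^+ k) <> W (b' * y ^+ k').
  move=> b b' k k' bb bb' b0 b'0 kd kd' e.
  by have [h|h|//] := ltngtP k k'; [case: (main b b' k k')|case: (main b' b k' k)].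
move=> bb bb' b0 b'0 kk' kd' e.
have [r _ rE] : base (b / b') by exact: (subfield_div sbase).
have [f [g [g0 fgE]]] := ratfunP r; move: rE; rewrite fgE ratmapE // => rE.
have gx0 : px g != 0 by rewrite tofrac_eq0 map_poly_eq0.
have f0 : f != 0.
  apply: contraNneq b0 => f0; rewrite f0 !rmorph0 mul0r in rE.
  by rewrite -[b](mulfVK b'0) -rE mul0r.
have eyk : y ^+ k' = y ^+ (k' - k) * y ^+ k by rewrite -exprD subnK // ltnW.
have e1 : W (px f) = W (y ^+ (k' - k) * px g).
  apply: (valMl_eq (mulf_neq0 (div_neq0 b'0 gx0) (expf_neq0 k y_neq0))).
  have -> : b' / px g * y ^+ k * px f = b * y ^+ k.
    rewrite -[b](mulfVK b'0) -rE mulrAC; congr (_ * _).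
    by rewrite mulrAC [RHS]mulrC mulrA.
  have -> : b' / px g * y ^+ k * (y ^+ (k' - k) * px g) = b' * y ^+ k'.
    by rewrite [y ^+ _ * px g]mulrC mulrACA (mulfVK gx0) [y ^+ k * _]mulrC -eyk.
  exact: e.
have [m1 lf] := lead_base alg mp mQ QE f0.
have [m2 lg] := lead_base alg mp mQ QE g0.
have [cf _ _] := lf; have [cg _ _] := lg.
have {}e1 : W (ratconst (taylor_coef a (map_poly iota f) (d * m1)) * y ^+ (d * m1)) =
    W (ratconst (taylor_coef a (map_poly iota g) (d * m2)) * y ^+ (k' - k + d * m2)).
  rewrite -(lead_value lf) e1 valM (lead_value lg) -valM; congr (W _).
  by rewrite mulrCA -exprD.
move: e1; set c := taylor_coef _ _ _; set c' := taylor_coef _ _ _ => e1.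
have rc0 : ratconst c != 0 by rewrite fmorph_eq0.
have rc'0 : ratconst c' != 0 by rewrite fmorph_eq0.
have km : (k' - k + d * m2)%N != (d * m1)%N.
  apply/eqP => /(congr1 (modn^~ d)); rewrite addnC mulnC modnMDl [(d * m1)%N]mulnC modnMl.
  rewrite modn_small ?(leq_ltn_trans (leq_subr _ _)) // => /eqP.
  by rewrite subn_eq0 leqNgt kk'.
have key m n x x' : ratconst x != 0 -> ratconst x' != 0 ->
    W (ratconst x * y ^+ m) = W (ratconst x' * y ^+ n) -> (m < n)%N -> False.
  move=> x0 x'0 ex mn; have := ntor (n - m)%N (x / x'); rewrite subn_gt0 mn.
  move=> /(_ isT)/eqP; apply.
  apply: (valMl_eq (mulf_neq0 x'0 (expf_neq0 m y_neq0))).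
  rewrite -[X in _ = W X]mulrA -exprD (subnKC (ltnW mn)) -ex fmorph_div.
  by congr (W _); rewrite mulrAC; congr (_ * _); rewrite mulrC (mulfVK x'0).
case: (ltngtP (k' - k + d * m2)%N (d * m1)%N) km => [h _|h _|_ km].
- exact: key rc'0 rc0 (esym e1) h.
- exact: key rc0 rc'0 e1 h.
by [].
Qed.

Lemma base_adjoin_ratfun : base `<=` adjoin_ratfun iota a.
Proof. by move=> r br; apply: sub_gen_field; left. Qed.

Lemma shift_adjoin_ratfun : adjoin_ratfun iota a y.
Proof.
rewrite rmorphB; apply: (subfieldB (@gen_field_subfield _ _)).
  by apply: base_adjoin_ratfun; rewrite -(map_polyX iota); apply: base_poly.
by apply: sub_gen_field; right.
Qed.

Lemma value_index :
  (forall n c, (0 < n)%N -> W (ratconst c) != W (y ^+ n)) ->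
  group_index (value_group W (adjoin_ratfun iota a)) (value_group W base) d.
Proof.
move=> ntor; have vy := val_shift mono.
have sA : subfield (adjoin_ratfun iota a) by exact: gen_field_subfield.
pose B := value_group W base.
have BD g h : B g -> B h -> B (g + h).
  move=> [b bb bg] [c bc ch]; exists (b * c); first exact: (subfieldM sbase).
  by rewrite valM bg ch.
have BN g : B g -> B (- g).
  by move=> [b bb bg]; exists b^-1; [exact: (subfieldV sbase)|exact: valV].
pose f k := [set gamma *+ k + h | h in B].
rewrite /group_index -/B.
have -> : [set [set g + h | h in B] | g in value_group W (adjoin_ratfun iota a)] =
    f @` `I_d.
  apply/seteqP; split=> [_ [g [u Au ug] <-]|_ [k kd <-]]; last first.
    exists (gamma *+ k) => //; exists (y ^+ k); last exact: valX.
    by apply: (subfieldX sA); apply: shift_adjoin_ratfun.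
  have u0 : u != 0 by rewrite -(val_eq_infty W) ug.
  have [b [k [bb b0 kd Wu]]] := adjoin_ratfun_value Au u0.
  have [h bh] := val_neq0 W b0.
  have gE : g = gamma *+ k + h.
    by apply: (@fin_inj G); rewrite -ug Wu valM bh (valX k vy) /= addrC.
  have Bh : B h by exists b.
  exists k => //; apply/seteqP; split=> [_ [h' Bh' <-]|_ [h' Bh' <-]].
    by exists (- h + h'); [apply: BD => //; exact: BN|rewrite gE addrA addrK].
  by exists (h + h'); [exact: BD|rewrite gE addrA].
apply: inj_card_eq => k k' /set_mem kd /set_mem kd' e.
have : f k (gamma *+ k) by exists 0; [exists 1; [exact: subfield1|exact: val1]|rewrite addr0].
rewrite e => -[h [b bb bh] hE].
have b0 : b != 0 by rewrite -(val_eq_infty W) bh.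
apply: (base_value_shift_mod ntor (b := 1) (b' := b)); rewrite ?oner_neq0 //.
  exact: subfield1.
by rewrite mul1r valM bh !(valX _ vy) -hE /= addrC.
Qed.

(** Residual membership in the span of the powers of [y] below [d], every term being integral. The
    powers are not scaled to value 0, so no element of [K(x)] of value [gamma] is involved yet. *)
Definition shift_spanned (u : ratfun F) : Prop :=
  exists2 r : 'I_d -> ratfun F, (forall i, base (r i) /\ fin 0 <= W (r i * y ^+ i)) &
    fin 0 < W (u - \sum_i r i * y ^+ i).

Lemma shift_spanned0 : shift_spanned 0.
Proof.
exists (fun=> 0) => [i|].
  by split; [exact: (subfield0 sbase)|rewrite mul0r val0 le_infty].
by rewrite big1 ?subrr ?val0 // => i _; rewrite mul0r.
Qed.

Lemma shift_spannedD u w : shift_spanned u -> shift_spanned w -> shift_spanned (u + w).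
Proof.
move=> [r hr ur] [s hs ws]; exists (fun i => r i + s i) => [i|].
  have [br vr] := hr i; have [bs vs] := hs i.
  by split; [exact: (subfieldD sbase)|rewrite mulrDl valD_ge].
rewrite (eq_bigr _ (fun i _ => mulrDl (r i) (s i) (y ^+ i))) big_split /=.
by rewrite opprD addrACA; apply: valD_gt.
Qed.

Lemma shift_spanned_sum (I : Type) (s : seq I) (P : pred I) (f : I -> ratfun F) :
  (forall i, P i -> shift_spanned (f i)) ->
  shift_spanned (\sum_(i <- s | P i) f i).
Proof.
by move=> h; elim/big_ind: _ => //; [exact: shift_spanned0|exact: shift_spannedD].
Qed.

Lemma shift_spanned_approx u u' : fin 0 < W (u - u') -> shift_spanned u' ->
  shift_spanned u.
Proof.
move=> uu' [r hr ur]; exists r => //.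
by rewrite -[u](subrK u') -addrA; apply: valD_gt.
Qed.

(** The Taylor expansion of the minimal polynomial, divided by its coefficient of index [d], is
    solved for [y ^+ d]: terms beyond [d] are negligible, and the constants from [K(a)] are replaced
    by approximations in [K(x)]. *)
Lemma shift_power_reduction : exists s (r : 'I_d -> ratfun F),
  [/\ base s, W (y ^+ d) <= W s,
    forall l, base (r l) /\ W (y ^+ d) <= W (r l * y ^+ l) &
    W (y ^+ d) < W (y ^+ d - (s + \sum_l r l * y ^+ l))].
Proof.
have lQ := lead_minpoly mp QE; have [cd eQ gtQ] := lQ.
set P := map_poly iota Q in lQ cd eQ gtQ.
pose c k := taylor_coef a P k; pose e := ratconst (c d).
have e0 : e != 0 by rewrite fmorph_eq0.
have Kc k : adjoin iota a (c k).
  by apply: taylor_coef_adjoin => l; apply: adjoin_base; rewrite coef_map; exists Q`_l.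
have sA : subfield (adjoin iota a) by exact: gen_field_subfield.
have Kcd k : adjoin iota a (c k / c d) by exact: (subfield_div sA).
have yd : W (y ^+ d) < infty by rewrite val_lt_infty; exact: expf_neq0 _ y_neq0.
have term k : ratconst (c k / c d) * y ^+ k = e^-1 * taylor_term a P k.
  by rewrite fmorph_div mulrAC mulrC /taylor_term.
have Wyd : W (y ^+ d) = W (e^-1 * ratpoly P).
  by rewrite valM -eQ -valM -term divff // rmorph1 mul1r.
have ge k : W (y ^+ d) <= W (ratconst (c k / c d) * y ^+ k).
  by rewrite term Wyd valMl_le ?invr_eq0 //; apply: val_le_taylor.
have gt k : (d < k)%N -> W (y ^+ d) < W (ratconst (c k / c d) * y ^+ k).
  by move=> dk; rewrite term Wyd valMl_lt ?invr_eq0 //; apply: gtQ.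
have [f bf [Wf hf]] := adjoin_approx alg mp mQ (subfieldV sA (Kc d)).
have [k|r rP] := @choice 'I_d (ratfun F) (fun k r => base r /\
    (W r = W (ratconst (c k / c d)) /\ forall z t, z != 0 -> t < infty ->
      t <= W (ratconst (c k / c d) * z) -> t < W ((r - ratconst (c k / c d)) * z))) _.
  by have [r br hr] := adjoin_approx alg mp mQ (Kcd k); exists r.
have P0 : ratpoly P != 0 by rewrite tofrac_eq0 (lead_neq0 lQ).
exists (f * ratpoly P), (fun k => - r k); split.
- by apply: (subfieldM sbase) => //; apply: base_poly.
- by rewrite valM Wf fmorphV -valM Wyd.
- move=> l; have [br [Wr _]] := rP l.
  split; first exact: (subfieldN sbase).
  by rewrite mulNr valN valM Wr -valM ge.
have sP : (size P <= d.+1 + size P)%N by rewrite leq_addl.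
have PE : e^-1 * ratpoly P = \sum_(k < d) ratconst (c k / c d) * y ^+ k + y ^+ d +
    \sum_(d.+1 <= k < d.+1 + size P) ratconst (c k / c d) * y ^+ k.
  rewrite (taylor_sum a sP) mulr_sumr -(big_mkord xpredT (fun k => e^-1 * taylor_term a P k)).
  rewrite (@big_cat_nat _ _ _ d.+1) ?leq_addr //= big_nat_recr //= big_mkord.
  rewrite -term divff // rmorph1 mul1r; congr (_ + _ + _).
    by apply: eq_bigr => k _; rewrite term.
  by apply: eq_bigr => k _; rewrite term.
(* The error splits into that of approximating the lower coefficients, that of approximating the
   inverse of [c d], and the Taylor terms beyond [d]. *)
have -> : y ^+ d - (f * ratpoly P + \sum_(l < d) - r l * y ^+ l) =
    \sum_(k < d) (r k - ratconst (c k / c d)) * y ^+ k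
    - (f - ratconst (c d)^-1) * ratpoly P
    - \sum_(d.+1 <= k < d.+1 + size P) ratconst (c k / c d) * y ^+ k.
  rewrite (eq_bigr _ (fun (k : 'I_d) _ => mulrBl (y ^+ k) (r k) (ratconst (c k / c d)))) sumrB.
  rewrite (eq_bigr _ (fun (k : 'I_d) _ => mulNr (r k) (y ^+ k))) sumrN.
  rewrite mulrBl fmorphV -/e PE.
  set S := \sum_(k < d) r k * _; set C := \sum_(k < d) _ * _; set R := \sum_(_ <= k < _) _.
  have -> : C + y ^+ d + R = y ^+ d + (C + R) by rewrite addrA [C + _]addrC.
  rewrite !opprB [RHS]addrAC -[S - C - R]addrA -opprD [RHS]addrA.
  by rewrite [S - _ + _]addrACA addNr addr0 addrCA addrA.
rewrite -addrA -opprD; apply: valB_gt.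
  apply: val_sum_gt => // k _; have [_ [_ h]] := rP k.
  exact: h (expf_neq0 _ y_neq0) yd (ge k).
apply: valD_gt; first by apply: (hf _ _ P0 yd); rewrite fmorphV Wyd; exact: lexx.
rewrite big_nat; apply: val_sum_gt => // k /andP[dk _]; exact: gt.
Qed.

(** For [k >= d], replacing one factor [y ^+ d] by its reduction gives integral monomials of
    exponents [k - d] and [k - d + l] with [l < d], all below [k]. *)
Lemma shift_spanned_monomial k r : base r -> fin 0 <= W (r * y ^+ k) ->
  shift_spanned (r * y ^+ k).
Proof.
elim/ltn_ind: k r => k IH r br rk; have [kd|dk] := ltnP k d.
  exists (fun i => if i == k :> nat then r else 0) => [i|].
    case: eqP => [->|_] //.
    by split; [exact: (subfield0 sbase)|rewrite mul0r val0 le_infty].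
  rewrite (bigD1 (Ordinal kd)) //= eqxx big1 ?addr0 ?subrr ?val0 // => i ik.
  by rewrite -val_eqE /= in ik; rewrite (negPf ik) mul0r.
have [r0|r0] := eqVneq r 0; first by rewrite r0 mul0r; apply: shift_spanned0.
have d0 : (0 < d)%N by apply: (near_count_gt0 W gamma mQ QE).
have [s [q [bs Ws bq Wq]]] := shift_power_reduction.
pose z := r * y ^+ (k - d); have z0 : z != 0 by exact: mulf_neq0 r0 (expf_neq0 _ y_neq0).
have zE : r * y ^+ k = z * y ^+ d by rewrite -mulrA -exprD subnK.
apply: (@shift_spanned_approx _ (z * (s + \sum_l q l * y ^+ l))).
  rewrite zE -mulrBr; apply: le_lt_trans rk _.
  by rewrite zE valMl_lt.
rewrite mulrDr mulr_sumr; apply: shift_spannedD.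
  rewrite /z mulrAC; apply: IH; first by rewrite ltn_subrL d0 (leq_trans d0).
    exact: (subfieldM sbase).
  by rewrite -mulrAC; apply: le_trans rk _; rewrite zE valMl_le.
apply: shift_spanned_sum => l _; have [bl Wl] := bq l.
have e : z * (q l * y ^+ l) = r * q l * y ^+ (k - d + l).
  by rewrite exprD mulrACA !mulrA.
rewrite e; apply: IH; first by rewrite -ltn_subRL subKn.
  exact: (subfieldM sbase).
by rewrite -e; apply: le_trans rk _; rewrite zE valMl_le.
Qed.

(** No Taylor term has smaller value than the whole polynomial, so each term of [u] is integral; its
    coefficient is then approximated in [K(x)]. *)
Lemma adjoin_ratfun_spanned u : adjoin_ratfun iota a u -> fin 0 <= W u ->
  shift_spanned u.
Proof.
move=> /(adjoin_ratfun_repr alg)[P [g [hP g0 ->]]] Wu.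
have gx0 : px g != 0 by rewrite tofrac_eq0 map_poly_eq0.
rewrite (taylor_sum a (leqnn _)) mulr_suml; apply: shift_spanned_sum => k _.
have [f bf [Wf hf]] := adjoin_approx alg mp mQ (taylor_coef_adjoin k hP).
have te : taylor_term a P k / px g = ratconst (taylor_coef a P k) * (y ^+ k / px g).
  by rewrite /taylor_term mulrA.
have t0 : fin 0 <= W (taylor_term a P k / px g).
  apply: le_trans Wu _; rewrite ![_ / px g]mulrC valMl_le ?invr_eq0 //.
  exact: val_le_taylor.
apply: (@shift_spanned_approx _ (f * (y ^+ k / px g))).
  rewrite -opprB valN te -mulrBl.
  apply: (hf _ _ (div_neq0 (expf_neq0 k y_neq0) gx0) (fin_ltoo 0)).
  by rewrite -te; exact: t0.
have -> : f * (y ^+ k / px g) = (f / px g) * y ^+ k by rewrite mulrCA mulrC.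
apply: shift_spanned_monomial.
  by apply: (subfield_div sbase) => //; apply: base_poly.
have -> : f / px g * y ^+ k = f * (y ^+ k / px g) by rewrite mulrAC mulrA.
by rewrite valM Wf -valM -te.
Qed.
End IndexAndDegree.

(** * Residues and the residue degree *)

Section ResidueOf.
Variables (F : fieldType) (G : oagType) (v : valuation F G).
Implicit Types u w : F.

(* Junk if [v u < 0]. *)
Definition residue_of u : resfield v := residue (insubd (0 : vring v) u).

Lemma vring_insubd u : fin 0 <= v u -> val (insubd (0 : vring v) u) = u.
Proof. by move=> vu; rewrite insubdK // unfold_in. Qed.

Lemma residue_ofD u w : fin 0 <= v u -> fin 0 <= v w ->
  residue_of (u + w) = residue_of u + residue_of w.
Proof.
move=> vu vw; rewrite /residue_of /residue -rmorphD; congr (\pi_ _ _)%qT.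
by apply: val_inj; rewrite rmorphD /= !vring_insubd // valD_ge.
Qed.

Lemma residue_ofM u w : fin 0 <= v u -> fin 0 <= v w ->
  residue_of (u * w) = residue_of u * residue_of w.
Proof.
move=> vu vw; rewrite /residue_of /residue -rmorphM; congr (\pi_ _ _)%qT.
by apply: val_inj; rewrite rmorphM /= !vring_insubd // valM_ge0.
Qed.

Lemma residue_of_eq0 u : fin 0 <= v u -> (residue_of u == 0) = (fin 0 < v u).
Proof. by move=> vu; rewrite residue_eq0 unfold_in /maxideal vring_insubd. Qed.

Lemma residue_of0 : residue_of 0 = 0.
Proof. by apply/eqP; rewrite residue_of_eq0 val0. Qed.

Lemma residue_of_sum (I : Type) (s : seq I) (P : pred I) (f : I -> F) :
  (forall i, P i -> fin 0 <= v (f i)) ->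
  residue_of (\sum_(i <- s | P i) f i) = \sum_(i <- s | P i) residue_of (f i).
Proof.
move=> h.
suff [_ e] : fin 0 <= v (\sum_(i <- s | P i) f i) /\
  residue_of (\sum_(i <- s | P i) f i) = \sum_(i <- s | P i) residue_of (f i) by [].
elim/big_rec2: _ => [|i x u Pi [vu ux]]; first by rewrite val0 residue_of0.
by rewrite valD_ge ?residue_ofD ?ux ?h.
Qed.

Lemma residue_setP (L : set F) x :
  residue_set v L x <-> exists u, [/\ L u, fin 0 <= v u & x = residue_of u].
Proof.
split=> [[z Lz <-]|[u [Lu vu ->]]].
  by exists (val z); split=> //; [have := valP z|rewrite /residue_of valKd].
by exists (insubd (0 : vring v) u) => //=; rewrite vring_insubd.
Qed.
End ResidueOf.

Section ResidueDegree.
Variables (K : fieldType) (F : closedFieldType) (iota : {rmorphism K -> F}).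
Hypothesis alg : forall z : F, algebraicOver iota z.
Variables (G : oagType) (W : valuation (ratfun F) G) (a : F) (gamma : G).
Hypothesis mp : minimal_pair iota W a gamma.
Variable Q : {poly K}.
Hypothesis mQ : is_minpoly iota Q a.
Variable rs : seq F.
Hypothesis QE : map_poly iota Q = \prod_(z <- rs) ('X - z%:P).
Let d := count (near_center W a gamma) rs.
Local Notation px p := (ratpoly (map_poly iota p) : ratfun F).
Local Notation y := (ratpoly ('X - a%:P) : ratfun F).
Local Notation base := (base_ratfun iota).

Let mono : is_monomial_valuation W a gamma := mp.1.2.
Let sbase : subfield base := base_subfield iota.
Let y_neq0 : y != 0.
Proof. by rewrite tofrac_eq0 polyXsubC_eq0. Qed.

(** The basis consists of the residues of powers of the unit [t]. For independence, a combination of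
    positive value has, by [lead_combination], only terms of positive value. *)
Lemma residue_degree : value_group W base gamma ->
  is_degree (residue_set W base) (residue_set W (adjoin_ratfun iota a)) d.
Proof.
move=> [g0 bg0 Wg0].
have g00 : g0 != 0 by rewrite -(val_eq_infty W) Wg0.
pose t := y / g0.
have Wt : W t = fin 0 by apply/(val_div_eq0 W _ g00); rewrite Wg0 (val_shift mono).
have Wti i : W (t ^+ i) = fin 0 by rewrite (valX i Wt) mul0rn.
have Wti0 i : fin 0 <= W (t ^+ i) by rewrite Wti.
have sA : subfield (adjoin_ratfun iota a) by exact: gen_field_subfield.
have At : adjoin_ratfun iota a t.
  apply: (subfield_div sA); first exact: shift_adjoin_ratfun.
  exact: base_adjoin_ratfun.
have tE r i : r * t ^+ i = r / g0 ^+ i * y ^+ i.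
  by rewrite /t exprMn exprVn mulrCA mulrC.
have Wrt r i : W (r * t ^+ i) = W r by rewrite valM Wti ext_addC ext_add0.
exists (fun i => residue_of W (t ^+ i)); split.
- move=> i; apply/residue_setP; exists (t ^+ i); split=> //.
  exact: (subfieldX sA).
- move=> c hc c0.
  have [i|r rP] := @choice 'I_d (ratfun F) (fun i u =>
      [/\ base u, fin 0 <= W u & c i = residue_of W u]) _.
    by have /residue_setP[u] := hc i; exists u.
  have Wr i : fin 0 <= W (r i * t ^+ i) by rewrite Wrt; have [] := rP i.
  have pos : fin 0 < W (\sum_i r i * t ^+ i).
    rewrite -residue_of_eq0; last by apply: val_sum_ge => i _.
    rewrite residue_of_sum // -[X in _ == X]c0; apply/eqP; apply: eq_bigr => i _.
    by have [_ vr ->] := rP i; rewrite residue_ofM.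
  have [i|R RE] := @choice 'I_d (ratfun K) (fun i u => ratmap iota u = r i / g0 ^+ i) _.
    have [br _ _] := rP i.
    have [u _ uE] : base (r i / g0 ^+ i).
      by apply: (subfield_div sbase) => //; exact: (subfieldX sbase).
    by exists u.
  have [g [f [gn0 fE]]] := common_denominator R.
  have gx0 : px g != 0 by rewrite tofrac_eq0 map_poly_eq0.
  have rE i : r i * t ^+ i = px (f i) * y ^+ i / px g.
    by rewrite tE -RE fE ratmapE // mulrAC.
  pose f' k := if insub k is Some i then f (i : 'I_d) else 0.
  have f'E (i : 'I_d) : f' i = f i by rewrite /f' valK.
  move=> i; have [_ vr ->] := rP i; apply/eqP; rewrite residue_of_eq0 //.
  have [h|[l [_ _ hl]]] := lead_combination alg mp mQ QE f' (leqnn d).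
    have fi0 : f i = 0 by rewrite -f'E h.
    by rewrite -(Wrt _ i) rE fi0 !rmorph0 !mul0r val0.
  rewrite -(Wrt _ i); apply: lt_le_trans pos _.
  have -> : \sum_i r i * t ^+ i =
      ratpoly (\sum_(i < d) map_poly iota (f' i) * ('X - a%:P) ^+ i) / px g.
    rewrite rmorph_sum mulr_suml; apply: eq_bigr => k _.
    by rewrite rE f'E rmorphM rmorphXn.
  rewrite rE ![_ / px g]mulrC valMl_le ?invr_eq0 //.
  by rewrite -f'E; apply: hl.
move=> _ /residue_setP[u [Au vu ->]].
have [r hr ur] := adjoin_ratfun_spanned alg mp mQ QE Au vu.
have rt i : r i * y ^+ i = (r i * g0 ^+ i) * t ^+ i.
  by rewrite tE (mulfK (expf_neq0 i g00)).
exists (fun i => residue_of W (r i * g0 ^+ i)) => [i|].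
  have [br vr] := hr i; apply/residue_setP; exists (r i * g0 ^+ i); split=> //.
    by apply: (subfieldM sbase) => //; exact: (subfieldX sbase).
  by rewrite -(Wrt _ i) -rt.
have vri i : fin 0 <= W (r i * g0 ^+ i) by rewrite -(Wrt _ i) -rt; have [] := hr i.
have vs : fin 0 <= W (\sum_i r i * y ^+ i).
  by apply: val_sum_ge => i _; have [] := hr i.
have -> : u = (u - \sum_i r i * y ^+ i) + \sum_i r i * y ^+ i by rewrite subrK.
rewrite residue_ofD ?(ltW ur) //.
have /eqP -> : residue_of W (u - \sum_i r i * y ^+ i) == 0.
  by rewrite residue_of_eq0 // ltW.
rewrite add0r residue_of_sum; last by move=> i _; have [] := hr i.
by apply: eq_bigr => i _; rewrite rt residue_ofM.
Qed.
End ResidueDegree.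

(** * Implicit constants *)

Lemma algebraicOver_trans (T F1 F2 : fieldType) (i : {rmorphism T -> F1})
    (k : {rmorphism F1 -> F2}) (l : {rmorphism T -> F2}) :
  (forall t, l t = k (i t)) -> (forall z, algebraicOver i z) ->
  (forall z, algebraicOver k z) -> forall z, algebraicOver l z.
Proof.
move=> lE alg1 alg2 z; have [p p0 pz] := alg2 z.
apply/integral_algebraic; apply: (@integral_root _ _ l (map_poly k p) z).
- by rewrite map_poly_eq0.
- exact: pz.
move=> c /(nthP 0)[n _ <-]; rewrite coef_map.
apply/integral_algebraic; have [q q0 qp] := alg1 p`_n.
exists q => //; have -> : map_poly l q = map_poly k (map_poly i q).
  by rewrite -map_poly_comp; apply: eq_map_poly => t; rewrite lE.
by rewrite fmorph_root.
Qed.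

Section HenselianPreimage.
Variables (F1 F2 : closedFieldType) (T0 : fieldType) (i0 : {rmorphism T0 -> F1}).
Variables (k : {rmorphism F1 -> F2}) (E : set F2).
Hypotheses (alg1 : forall z, algebraicOver i0 z) (sE : subfield E).
Hypothesis iE : forall t, E (k (i0 t)).
Hypothesis alg2 : forall (T : fieldType) (i : {rmorphism T -> F2}),
  range i = E -> forall z, algebraicOver i z.

Lemma preimage_subfield : subfield [set x | E (k x)].
Proof.
apply: subfieldP => [|x y hx hy|x y hx hy] /=.
- by rewrite rmorph1; apply: subfield1.
- by rewrite rmorphB; apply: subfieldB.
- by rewrite fmorph_div; apply: subfield_div.
Qed.

(* Minimal polynomials over the preimage of [E] remain irreducible over [E],
   because the roots of a polynomial over [i0(T0)] all come from [F1]. *)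
Lemma henselian_preimage (G : oagType) (v1 : valuation F1 G) (v2 : valuation F2 G) :
  (forall x, v2 (k x) = v1 x) -> henselian v2 E -> henselian v1 [set x | E (k x)].
Proof.
move=> v12 hE; have [T1 [i1 i1E]] := subfield_inclusion preimage_subfield.
have [T2 [i2 i2E]] := subfield_inclusion sE.
have i01 : range i0 `<=` range i1 by rewrite i1E => _ [t _ <-]; apply: iE.
have algi1 z : algebraicOver i1 z by exact: algebraicOver_sub (alg1 z).
have algi2 := alg2 i2E.
rewrite -i1E; apply: invariant_henselian => // s gs z.
have [f mf] := minpoly_exists (algi2 (k z)).
have [rs [fE hrs]] := minpoly_split algi2 mf.
have [g g0 gz] := alg1 z.
(* The roots of [f] are also roots of [g], hence come from [F1]; so the coefficients of [f] do
   too. *)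
have [p pE] : exists p, map_poly k p = map_poly i2 f.
  have [zs zsE] := closed_field_poly_normal (map_poly i0 g).
  have rsk x : x \in rs -> exists y, k y = x.
    move=> xr.
    have fx : root (map_poly i2 f) x by rewrite fE root_prod_XsubC.
    have [|g2 g2E] := @polyOver_range _ _ i2 (map_poly k (map_poly i0 g)).
      by move=> n; rewrite i2E !coef_map; apply: iE.
    have fg : f %| g2 by rewrite -(minpolyP _ mf) g2E fmorph_root.
    have : root (map_poly k (map_poly i0 g)) x.
      by rewrite -g2E; move/dvdpP: fg => [q ->]; rewrite rmorphM rootM fx orbT.
    rewrite zsE map_polyZ rootZ; last by rewrite fmorph_eq0 lead_coef_eq0 map_poly_eq0.
    rewrite rmorph_prod (eq_bigr (fun y => 'X - (k y)%:P)); last first.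
      by move=> y _; rewrite rmorphB /= map_polyX map_polyC.
    rewrite -(big_map k xpredT (fun y => 'X - y%:P)) root_prod_XsubC.
    by move=> /mapP[y _ ->]; exists y.
  rewrite fE; elim: (rs) rsk => [|x xs IH] h; first by exists 1; rewrite rmorph1 big_nil.
  have [y yE] := h x (mem_head _ _).
  have [|q qE] := IH; first by move=> x' x'xs; apply: h; rewrite inE x'xs orbT.
  by exists (('X - y%:P) * q); rewrite big_cons rmorphM /= qE rmorphB /= map_polyX map_polyC /= yE.
have [|p1 p1E] := @polyOver_range _ _ i1 p.
  move=> n; rewrite i1E /= -(coef_map k) pE coef_map -i2E.
  by exists f`_n.
have p1z : root (map_poly i1 p1) z.
  by have [_ fz _] := mf; rewrite p1E -(fmorph_root k) pE.
have := galois_root gs p1z; rewrite p1E -(fmorph_root k) pE => fsz.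
(* An automorphism over [E] realises the move from [k z] to [k (s z)], and it preserves [v2]. *)
have [s2 gs2 e] := galois_conjugate algi2 mf fsz.
rewrite -!v12 -e; apply: henselian_invariant gs2 _ => //.
by rewrite i2E.
Qed.
End HenselianPreimage.

Lemma ratmap_comp (F1 F2 F3 : fieldType) (f : {rmorphism F1 -> F2})
    (g : {rmorphism F2 -> F3}) (h : {rmorphism F1 -> F3}) :
  (forall x, h x = g (f x)) -> forall r, ratmap g (ratmap f r) = ratmap h r.
Proof.
move=> hE r; have [p [q [q0 ->]]] := ratfunP r.
rewrite !ratmapE ?map_poly_eq0 // -!map_poly_comp.
have e : g \o f =1 h by move=> x; rewrite hE.
by rewrite !(eq_map_poly e).
Qed.

Lemma ratmap_const (F1 F2 : fieldType) (f : {rmorphism F1 -> F2}) c :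
  ratmap f (ratconst c) = ratconst (f c).
Proof. by rewrite /ratconst ratmap_poly map_polyC. Qed.

(** If [c] is the image of [p / q], comparing coefficients at the leading index of [q] exhibits [c]
    as a quotient of elements of the range. *)
Lemma ratconst_ratmap (F1 F2 : fieldType) (f : {rmorphism F1 -> F2}) c r :
  ratmap f r = ratconst c -> range f c.
Proof.
have [p [q [q0 ->]]] := ratfunP r; rewrite ratmapE // => e.
have fq0 : (ratpoly (map_poly f q) : ratfun F2) != 0.
  by rewrite tofrac_eq0 map_poly_eq0.
move/(congr1 (fun u => u * ratpoly (map_poly f q))): e.
rewrite (mulfVK fq0) /ratconst -tofracM => /eqP.
rewrite tofrac_eq => /eqP/polyP/(_ (size q).-1).
rewrite coefCM !coef_map /= => pc; exists (p`_(size q).-1 / q`_(size q).-1) => //.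
by rewrite fmorph_div pc mulfK // fmorph_eq0 -lead_coefE lead_coef_eq0.
Qed.

Lemma ratmap_range (F1 F2 F3 : fieldType) (f : {rmorphism F1 -> F3})
    (g : {rmorphism F2 -> F3}) :
  range f `<=` range g -> range (ratmap f) `<=` range (ratmap g).
Proof.
move=> fg _ [r _ <-]; have [p [q [q0 ->]]] := ratfunP r.
have lift (u : {poly F1}) : exists w, map_poly g w = map_poly f u.
  by apply: polyOver_range => n; apply: fg; rewrite coef_map; exists u`_n.
have [p' p'E] := lift p; have [q' q'E] := lift q.
have q'0 : q' != 0 by rewrite -(map_poly_eq0 g) q'E map_poly_eq0.
by exists (ratpoly p' / ratpoly q') => //; rewrite !ratmapE // p'E q'E.
Qed.

Lemma val_linear (F : closedFieldType) (G : oagType) (W : valuation (ratfun F) G)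
    (a : F) (gamma : G) z : is_monomial_valuation W a gamma ->
  W (ratpoly ('X - z%:P)) =
    if near_center W a gamma z then fin gamma else W (ratconst (a - z)).
Proof.
move=> mono; have [_ <- _] := lead_linear mono z; rewrite (val_taylor_term mono).
rewrite /taylor_coef comp_polyB comp_polyX comp_polyC -addrA -polyCB.
rewrite coefD coefX coefC; case: (near_center W a gamma z) => /=.
  by rewrite addr0 rmorph1 val1 ext_add0.
by rewrite add0r ext_addC ext_add0.
Qed.

Lemma ratmap_alg (K F : fieldType) (iota : {rmorphism K -> F}) :
  (forall z : F, algebraicOver iota z) -> forall r, algebraicOver (ratmap iota) r.
Proof.
move=> K_alg.
have alg_poly (p : {poly F}) : algebraicOver (ratmap iota) (ratpoly p).
  have algc (b : F) : algebraicOver (ratmap iota) (ratconst b).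
    have [f f0 fb] := K_alg b; exists (map_poly (@ratconst K) f).
      by rewrite map_poly_eq0.
    have -> : map_poly (ratmap iota) (map_poly (@ratconst K) f) =
        map_poly (@ratconst F) (map_poly iota f).
      by rewrite -!map_poly_comp; apply: eq_map_poly => b' /=; rewrite ratmap_const.
    by rewrite fmorph_root.
  have algX : algebraicOver (ratmap iota) (ratpoly 'X).
    by rewrite -(map_polyX iota) -ratmap_poly; apply: algebraic_id.
  elim/poly_ind: p => [|p b IH]; first by rewrite tofrac0; apply: algebraic0.
  rewrite tofracD tofracM.
  exact: (algebraic_add (algebraic_mul IH algX) (algc b)).
by move=> r; have [p [q [_ ->]]] := ratfunP r; exact: (algebraic_div (alg_poly p) (alg_poly q)).
Qed.

Section GaloisAction.
Variables (K : fieldType) (F : closedFieldType) (iota : {rmorphism K -> F}).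
Variables (G : oagType) (W : valuation (ratfun F) G) (a : F) (gamma : G).
Hypothesis mono : is_monomial_valuation W a gamma.
Local Notation nu := (const_valuation W).
Variable s : {rmorphism F -> F}.
Hypothesis nus : forall c, nu (s c) = nu c.
Hypothesis near_sa : near_center W a gamma (s a).

(** [a - s z] differs from [s (a - z)] by [a - s a], of value at least [gamma], and [s (a - z)] has
    the value of [a - z]. *)
Lemma near_center_galois z : near_center W a gamma (s z) = near_center W a gamma z.
Proof.
rewrite /near_center; have e : a - s z = (a - s a) + s (a - z).
  by rewrite rmorphB addrA subrK.
have [h|h] := leP (fin gamma) (nu (a - z)).
  by rewrite e; apply: valD_ge => //; rewrite nus.
apply/negbTE; rewrite -ltNge e addrC valDl nus //.
exact: lt_le_trans h _.
Qed.

Lemma far_center_galois z : ~~ near_center W a gamma z -> nu (a - s z) = nu (a - z).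
Proof.
rewrite -ltNge => h; have -> : a - s z = s (a - z) + (a - s a).
  by rewrite rmorphB [RHS]addrC addrA subrK.
by rewrite valDl nus //; apply: lt_le_trans h _.
Qed.

(** On linear factors: the value of [x - z] is [gamma] for [z] near [a] and [nu (a - z)] otherwise,
    and [s] changes neither the nearness nor the latter value. *)
Lemma val_ratmap_galois r : W (ratmap s r) = W r.
Proof.
have poly (p : {poly F}) : W (ratpoly (map_poly s p)) = W (ratpoly p).
  have [zs ->] := closed_field_poly_normal p; rewrite -mul_polyC [map_poly s _]rmorphM /=.
  rewrite map_polyC rmorph_prod !tofracM valM [RHS]valM; congr ext_add.
    exact: nus.
  elim: zs => [|z zs IH]; first by rewrite !big_nil.
  rewrite !big_cons !tofracM valM [RHS]valM IH; congr ext_add.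
  rewrite rmorphB /= map_polyX map_polyC /= !(val_linear _ mono) near_center_galois.
  by case: ifP => // /negbT/far_center_galois.
have [p [q [q0 ->]]] := ratfunP r; rewrite ratmapE //.
have fq0 : (ratpoly q : ratfun F) != 0 by rewrite tofrac_eq0.
have fsq0 : (ratpoly (map_poly s q) : ratfun F) != 0 by rewrite tofrac_eq0 map_poly_eq0.
have [g vg] := val_neq0 W fq0.
rewrite valM [RHS]valM poly (valV vg) (valV (g := g)) //.
by rewrite poly.
Qed.

Variables (Omega : closedFieldType) (j : {rmorphism ratfun F -> Omega}).
Hypothesis Omega_alg : forall z : Omega, algebraicOver j z.
Variable v : valuation Omega G.
Hypothesis vj : extends j v W.

Lemma galois_lift : exists t : {rmorphism Omega -> Omega},
  (forall r, t (j r) = j (ratmap s r)) /\ (forall x, v (t x) = v x).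
Proof.
pose js : {rmorphism ratfun F -> Omega} := GRing.RMorphism.clone _ _ (j \o ratmap s) _.
apply: (@valued_extension Omega _ j js) => // r.
by rewrite /js /= !vj val_ratmap_galois.
Qed.

Hypothesis K_alg : forall z : F, algebraicOver iota z.
Hypothesis siota : forall c, s (iota c) = iota c.

Lemma implicit_constant_fixed c : implicit_constant_field iota j v c -> s c = c.
Proof.
move=> ICc; have [t [tj tv]] := galois_lift.
pose ji : {rmorphism ratfun K -> Omega} := GRing.RMorphism.clone _ _ (j \o ratmap iota) _.
have tji r : t (ji r) = ji r.
  by rewrite /ji /= tj (@ratmap_comp _ _ _ iota s iota) // => x; rewrite siota.
have algji : forall z, algebraicOver ji z.
  exact: (algebraicOver_trans (i := ratmap iota) (k := j) _ (ratmap_alg K_alg)).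
have : t (j (ratconst c)) = j (ratconst c).
  apply: (henselization_fixed algji tji tv _ ICc).
  by move=> _ [_ [r _ <-] <-]; apply: tji.
rewrite tj ratmap_const => e.
have {}e := @fmorph_inj _ _ j _ _ e.
exact: (@fmorph_inj _ _ (@ratconst F) _ _ e).
Qed.
End GaloisAction.

Section ImplicitConstants.
Variables (K : fieldType) (F : closedFieldType) (iota : {rmorphism K -> F}).
Hypothesis K_alg : forall z : F, algebraicOver iota z.
Variables (G : oagType) (W : valuation (ratfun F) G) (a : F) (gamma : G).
Hypothesis mono : is_monomial_valuation W a gamma.
Variables (Omega : closedFieldType) (j : {rmorphism ratfun F -> Omega}).
Hypothesis Omega_alg : forall z : Omega, algebraicOver j z.
Variable v : valuation Omega G.
Hypothesis vj : extends j v W.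
Local Notation nu := (const_valuation W).
Local Notation IC := (implicit_constant_field iota j v).
Local Notation base := (base_ratfun iota).

Let near_a : near_center W a gamma a.
Proof. by rewrite /near_center subrr val0 le_infty. Qed.

Lemma ratfun_alg : forall z : Omega,
  algebraicOver (GRing.RMorphism.clone _ _ (j \o ratmap iota) _) z.
Proof. exact: (algebraicOver_trans (i := ratmap iota) (k := j) _ (ratmap_alg K_alg)). Qed.

Lemma range_alg (T : fieldType) (i : {rmorphism T -> Omega}) :
  j @` base `<=` range i -> forall z, algebraicOver i z.
Proof.
move=> h z; apply: algebraicOver_sub (ratfun_alg z) => _ [r _ <-] /=.
by apply: h; exists (ratmap iota r) => //; exists r.
Qed.

(** For a henselian [E] containing [K(a)], automorphisms over [E] preserve [nu] and fix [a], so they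
    fix [c], which is thus purely inseparable over [E]. If [c] were outside [E], some [c ^+ (p ^ n)]
    would be outside with its [p]-th power inside. *)
Lemma implicit_constant_sub : IC `<=` henselization nu (adjoin iota a).
Proof.
move=> c ICc E [[sE hE] aE].
have [T [i iE]] := subfield_inclusion sE.
have Ei b : range iota b -> E b by move=> h; apply: aE; apply: sub_gen_field; left.
have iotai : range iota `<=` range i by rewrite iE => b; apply: Ei.
have alg z : algebraicOver i z by exact: algebraicOver_sub (K_alg z).
have fixc s : absolute_galois i s -> s c = c.
  move=> gs; have [_ si] := gs.
  have sE' b : E b -> s b = b by rewrite -iE => -[t _ <-]; apply: si.
  have sa : s a = a by apply: sE'; apply: aE; apply: sub_gen_field; right.
  apply: (implicit_constant_fixed mono (s := s) _ _ Omega_alg vj K_alg _ ICc).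
  - by move=> b; apply: (henselian_invariant alg _ gs); rewrite iE.
  - by rewrite sa.
  - by move=> b; apply/sE'/Ei; exists b.
rewrite -iE; have [//|[p [k [pF ck]]]] := purely_inseparable_fixed alg fixc.
apply: contrapT => nc.
have [n [nn n1]] : exists n, ~ range i (c ^+ (p ^ n)) /\ range i (c ^+ (p ^ n.+1)).
  elim: k ck => [|k IH] ck; first by rewrite expn0 expr1 in ck.
  by have [/IH|h] := pselect (range i (c ^+ (p ^ k))) => //; exists k.
pose ji : {rmorphism ratfun T -> Omega} := GRing.RMorphism.clone _ _ (j \o ratmap i) _.
pose c' := j (ratconst (c ^+ (p ^ n))).
have baseji : j @` base `<=` range ji.
  move=> _ [r br <-]; have [u _ uE] := ratmap_range iotai br.
  by exists u => //; rewrite /ji /= uE.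
have algji : forall z, algebraicOver ji z by exact: range_alg.
have pO : p \in [pchar Omega].
  by rewrite (fmorph_pchar j) (fmorph_pchar (@ratconst F)).
have [||M [sM jM nM pM]] := maximal_avoiding_subfield algji (c := c') pO.
- move=> [r _ rE]; apply: nn; apply: (@ratconst_ratmap _ _ i _ r).
  exact: (@fmorph_inj _ _ j _ _ rE).
- have [t _ tE] := n1; exists (ratconst t) => //.
  by rewrite /ji /= ratmap_const tE expnSr exprM /c' !rmorphXn.
(* [M] is henselian and contains [K(x)], so it contains [c], and with it the power that it was
   chosen to avoid. *)
apply: nM; rewrite /c' rmorphXn rmorphXn; apply: (subfieldX sM).
apply: (ICc M); split; last by apply: subset_trans baseji jM.
by split=> //; exact: (@purely_inseparable_henselian _ _ _ algji _ v _ _ pO sM jM pM).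
Qed.

Section Separable.
Variable Q : {poly K}.
Hypothesis mQ : is_minpoly iota Q a.
Hypothesis sQ : separable_poly Q.
Variable rs : seq F.
Hypothesis QE : map_poly iota Q = \prod_(z <- rs) ('X - z%:P).

Lemma mem_conjugates b : conjugates iota a b <-> b \in rs.
Proof.
rewrite -root_prod_XsubC -QE; split=> [[s gs <-]|bQ].
  by apply: (galois_root gs); case: mQ.
by have [s gs sb] := galois_conjugate K_alg mQ bQ; exists s.
Qed.

Lemma conjugates_uniq : uniq rs.
Proof. by rewrite -separable_prod_XsubC -QE separable_map. Qed.

Lemma kras_lt_conjugate b : kras iota nu a < fin gamma -> b \in rs ->
  near_center W a gamma b -> b = a.
Proof.
move=> + /mem_conjugates[t gt tb] nb; rewrite /kras.
(* The default [infty] of [kras] is not below [fin gamma], so the maximum exists. *)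
case: xgetP => [k _ [_ kmax]|_]; last by rewrite ltNge le_infty.
move=> kg; apply: contrapT => ba.
have gid : absolute_galois iota (GRing.RMorphism.clone _ _ idfun _).
  exact: galois_of_fix.
suff : nu (a - b) <= k by rewrite leNgt => /negP; apply; apply: lt_le_trans kg _.
apply: kmax; exists (GRing.RMorphism.clone _ _ idfun _), t; split=> //=.
  by rewrite tb; apply/eqP => e; apply: ba.
by rewrite tb.
Qed.

(* Krasner's lemma: an automorphism over a henselian field containing [x]
   moves [a] to a conjugate [b] with [nu (a - b) >= gamma], i.e. to [a]. *)
Lemma krasner E : kras iota nu a < fin gamma -> subfield E -> henselian v E ->
  j @` base `<=` E -> E (j (ratconst a)).
Proof.
move=> kg sE hE bE; have [T [i iE]] := subfield_inclusion sE.
have alg : forall z, algebraicOver i z by apply: range_alg; rewrite iE.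
have constE b : E (j (ratconst (iota b))).
  by apply: bE; exists (ratconst (iota b)) => //; exists (ratconst b) => //;
    rewrite ratmap_const.
pose k : {rmorphism F -> Omega} := GRing.RMorphism.clone _ _ (j \o @ratconst F) _.
have [|q qE] := @polyOver_range _ _ i (map_poly k (map_poly iota Q)).
  by move=> n; rewrite iE !coef_map; apply: constE.
have [_ Qa _] := mQ.
rewrite -iE -[j _]/(k a); apply: (separable_fixed_range alg (p := q)).
- by rewrite qE fmorph_root.
- by rewrite -(separable_map i) qE !separable_map.
move=> s gs.
have : root (map_poly k (map_poly iota Q)) (s (k a)).
  by rewrite -qE; apply: (galois_root gs); rewrite qE fmorph_root.
rewrite QE rmorph_prod (eq_bigr (fun z => 'X - (k z)%:P)); last first.
  by move=> z _; rewrite rmorphB /= map_polyX map_polyC.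
rewrite -(big_map k xpredT (fun z => 'X - z%:P)) root_prod_XsubC => /mapP[b br sb].
rewrite sb; congr (k _); apply: kras_lt_conjugate => //.
have vs := henselian_invariant alg _ gs.
pose X := j (ratpoly 'X).
have sX : s X = X.
  have : E X by apply: bE; exists (ratpoly 'X) => //; rewrite -(map_polyX iota); apply: base_poly.
  by rewrite -iE => -[t _ <-]; case: gs => _ ->.
have vXa : v (X - k a) = fin gamma.
  rewrite -(val_shift mono) -vj; congr (v _); rewrite /X /k /= -rmorphB.
  by congr (j _); rewrite /ratconst tofracB.
(* [s] fixes [X], sends [k a] to [k b] and preserves [v]; so [X] is as close to [k b] as to
   [k a]. *)
have vXb : v (X - k b) = fin gamma.
  by rewrite -sb -sX -rmorphB vs ?iE.
rewrite /near_center /= -vj -[j _]/(k _) rmorphB.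
have -> : k a - k b = (X - k b) - (X - k a) by rewrite opprB [RHS]addrC addrA subrK.
by apply: valB_ge; rewrite ?vXa ?vXb.
Qed.

(** The preimage in the constants of a henselian field over [K(x)] is henselian, and it contains [a]
    by [krasner]. *)
Lemma implicit_constant_sup : kras iota nu a < fin gamma ->
  henselization nu (adjoin iota a) `<=` IC.
Proof.
move=> kg c hc E [[sE hE] bE].
pose k : {rmorphism F -> Omega} := GRing.RMorphism.clone _ _ (j \o @ratconst F) _.
have constE b : E (k (iota b)).
  by apply: bE; exists (ratconst (iota b)) => //; exists (ratconst b) => //;
    rewrite ratmap_const.
apply: (hc [set x | E (k x)]); split.
  split; first exact: preimage_subfield.
  apply: (henselian_preimage K_alg sE constE _ _ hE) => [T i iE|x].
    by apply: range_alg; rewrite iE.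
  by rewrite /k /= vj.
apply: (gen_field_min (preimage_subfield k sE)).
move=> _ [[b _ <-]|->]; first exact: constE.
exact: (krasner kg sE hE bE).
Qed.
End Separable.
End ImplicitConstants.

Lemma seq_max_exists (d : Order.disp_t) (T : orderType d) (s : seq T) x :
  x \in s -> exists2 m, m \in s & forall z, z \in s -> (z <= m)%O.
Proof.
elim: s x => // y s IH x _; case: s IH => [|z s] IH.
  by exists y => [|z]; rewrite ?mem_head // inE => /eqP ->.
have [m ms mmax] := IH z (mem_head _ _).
have [le|/ltW le] := leP m y.
  exists y; first exact: mem_head.
  by move=> t; rewrite inE => /predU1P[->//|/mmax/le_trans]; apply.
exists m; first by rewrite inE ms orbT.
by move=> t; rewrite inE => /predU1P[->|/mmax].
Qed.

Lemma fset_set_filter (T : choiceType) (s : seq T) (P : pred T) (A : set T) :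
  uniq s -> (forall x, A x <-> x \in s /\ P x) -> #|` fset_set A| = count P s.
Proof.
move=> us AE; have -> : A = [set` [fset x in [seq x <- s | P x]]%fset].
  apply/seteqP; split=> x; rewrite /= inE mem_filter => h.
    by apply/andP; have [] := (AE x).1 h.
  by apply/AE; have [] := andP h.
by rewrite set_fsetK card_fseq undup_id ?filter_uniq // size_filter.
Qed.

(** * Automorphisms that move the generator *)

Section MovingAutomorphism.
Variables (K : fieldType) (F : closedFieldType) (iota : {rmorphism K -> F}).
Hypothesis K_alg : forall z : F, algebraicOver iota z.
Variables (G : oagType) (nu : valuation F G) (a : F).
Variables (Q : {poly K}) (rs : seq F).
Hypotheses (mQ : is_minpoly iota Q a) (sQ : separable_poly Q).
Hypothesis QE : map_poly iota Q = \prod_(z <- rs) ('X - z%:P).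
Hypothesis notin : ~ range iota a.
Hypothesis uniq_ext : unique_extension nu (range iota) (adjoin iota a).

Lemma adjoin_invariant s : absolute_galois iota s ->
  forall y, adjoin iota a y -> nu (s y) = nu y.
Proof.
move=> [_ si] y Ky; have sA : subfield (adjoin iota a) by exact: gen_field_subfield.
apply/esym/(@eq_of_equivalent F K iota G nu (restriction s nu) (adjoin iota a)) => //.
- by move=> b; apply: adjoin_base.
- by move=> t /=; rewrite si.
apply: uniq_ext; last by move=> _ _ [b _ <-] [c _ <-] /=; rewrite !si.
have [h1 h2 h3] := valuationP (restriction s nu).
by split=> *; [apply: h1|apply: h2|apply: h3].
Qed.

(** [s] may change [nu] elsewhere, but not on [K(a)], where the extension is unique; its restriction
    to [K(a)] is extended anew, preserving values. *)
Lemma invariant_extension s : absolute_galois iota s ->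
  exists2 t, absolute_galois iota t & t a = s a /\ forall x, nu (t x) = nu x.
Proof.
move=> gs; have [_ si] := gs.
have sA : subfield (adjoin iota a) by exact: gen_field_subfield.
have [T [i iE]] := subfield_inclusion sA.
pose i2 : {rmorphism T -> F} := GRing.RMorphism.clone _ _ (s \o i) _.
have [z|t|t [ti tnu]] := @valued_extension F T i i2 G nu nu.
- by apply: algebraicOver_sub (K_alg z); rewrite iE => b; apply: adjoin_base.
- by rewrite /i2 /= adjoin_invariant // -iE; exists t.
have tE y : adjoin iota a y -> t y = s y by rewrite -iE => -[u _ <-]; apply: ti.
exists t; last by split=> //; apply: tE; apply: adjoin_gen.
apply: galois_of_fix => // b; rewrite tE ?si //.
by apply: adjoin_base; exists b.
Qed.

(** The differences of conjugates are finite in number, and there is a nonzero one because [a] is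
    separable and outside [K]; so the default of [kras] does not occur. *)
Lemma kras_attained : exists s t : {rmorphism F -> F},
  [/\ absolute_galois iota s, absolute_galois iota t, s a != t a &
    kras iota nu a = nu (s a - t a)].
Proof.
rewrite /kras; set D := (X in xget _ [set k | X k /\ _]).
have urs := conjugates_uniq sQ QE.
have ars : a \in rs by have [_ Qa _] := mQ; rewrite -root_prod_XsubC -QE.
have gid : absolute_galois iota (GRing.RMorphism.clone _ _ idfun _).
  exact: galois_of_fix.
have [k Dk] : exists k, D k.
  have [b br ba] : exists2 b, b \in rs & b != a.
    apply: contrapT => no; apply: notin; apply: (minpoly_range mQ).
    rewrite -(size_map_poly iota) QE size_prod_XsubC ltnS.
    have /uniq_leq_size -> // : {subset rs <= [:: a]}.
    move=> b br; rewrite inE; apply: contraT => ba.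
    by exfalso; apply: no; exists b.
  have [s gs sb] := (mem_conjugates K_alg mQ QE b).2 br.
  exists (nu (s a - a)), s, (GRing.RMorphism.clone _ _ idfun _).
  by split; rewrite ?sb.
pose L := [seq nu (x - y) | x <- rs, y <- rs].
have DL k' : D k' -> k' \in L.
  move=> [s [t [gs gt _ ->]]]; apply/allpairsP; exists (s a, t a); split=> //=.
    by apply/(mem_conjugates K_alg mQ QE); exists s.
  by apply/(mem_conjugates K_alg mQ QE); exists t.
have [|m] := @seq_max_exists _ _ [seq k <- L | `[< D k >]] k.
  by rewrite mem_filter DL // andbT; apply/asboolP.
rewrite mem_filter => /andP[/asboolP Dm _] mmax.
case: xgetP => [k0 _ [Dk0 _]|no]; first by have [s [t [gs gt st ->]]] := Dk0; exists s, t.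
exfalso; apply: (no m); split=> // k' Dk'; apply: mmax.
by rewrite mem_filter DL // andbT; apply/asboolP.
Qed.

Lemma moving_automorphism (g : ext G) : g <= kras iota nu a ->
  exists s : {rmorphism F -> F}, [/\ forall c, s (iota c) = iota c,
    forall x, nu (s x) = nu x, s a != a & g <= nu (a - s a)].
Proof.
move=> gk; have [s [t [gs gt st e]]] := kras_attained.
have [s' gs' [s'a s'nu]] := invariant_extension gs.
have [t' gt' [t'a t'nu]] := invariant_extension gt.
have surj x : algebraicOver s' x.
  have [[g' _ K'] _] := gs'; rewrite -[x]K'; exact: algebraic_id.
(* [u] is the inverse of [s'], obtained as a morphism by extending the identity along [s']; then
   [u o t'] moves [a] by an element whose value is the Krasner constant. *)
have [||u [us' unu]] := @valued_extension F F s' (GRing.RMorphism.clone _ _ idfun _) G nu nu.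
- exact: surj.
- by move=> x; rewrite s'nu.
have us x : u (s' x) = x by exact: us'.
have utE : a - u (t' a) = u (s' a - t' a) by rewrite rmorphB us.
exists (GRing.RMorphism.clone _ _ (u \o t') _); split=> [c|x||] /=.
- have [_ ->] := gt'; have [_ s'i] := gs'.
  by rewrite -{1}(s'i c) us.
- by rewrite unu t'nu.
- apply: contra st => /eqP e'; rewrite -s'a -t'a -subr_eq0 -(fmorph_eq0 u).
  by rewrite -utE e' subrr.
by rewrite utE unu s'a t'a -e.
Qed.
End MovingAutomorphism.

Section NonTorsion.
Variables (K : fieldType) (F : closedFieldType) (iota : {rmorphism K -> F}).
Hypothesis K_alg : forall z : F, algebraicOver iota z.
Variables (G : oagType) (omega : valuation (ratfun K) G).
Variables (W : valuation (ratfun F) G) (a : F) (gamma : G).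
Hypothesis mono : is_monomial_valuation W a gamma.
Hypothesis omegaW : extends (ratmap iota) W omega.
Hypothesis vt : value_transcendental omega.
Local Notation y := (ratpoly ('X - a%:P) : ratfun F).

Let vy : W y = fin gamma := val_shift mono.

Lemma poly_value (p : {poly F}) : p != 0 ->
  exists c k, c != 0 /\ W (ratpoly p) = W (ratconst c * y ^+ k).
Proof.
move=> p0; have [k [ck e _]] := lead_exists mono p0.
by exists (taylor_coef a p k), k; split.
Qed.

(** Otherwise a multiple of every value on [K(x)] would be the value of a constant, and a further
    multiple the value of an element of [K], against value transcendence. *)
Lemma shift_nontorsion n c : (0 < n)%N -> W (ratconst c) != W (y ^+ n).
Proof.
move=> n0; apply/eqP => e.
have [g [r _ rg] [gfree _]] := vt.
have Wr : W (ratmap iota r) = fin g by rewrite omegaW.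
have [p [q [q0 rE]]] := ratfunP r.
have p0 : p != 0.
  apply: contra_eq_neq rg => p0; rewrite rE p0 tofrac0 mul0r val0 //.
move: Wr; rewrite rE ratmapE //.
have ip0 : map_poly iota p != 0 by rewrite map_poly_eq0.
have iq0 : map_poly iota q != 0 by rewrite map_poly_eq0.
have [c1 [k1 [c10 e1]]] := poly_value ip0.
have [c2 [k2 [c20 e2]]] := poly_value iq0.
have [h1 vh1] := val_neq0 (const_valuation W) c10.
have [h2 vh2] := val_neq0 (const_valuation W) c20.
have c0 : c != 0.
  by apply: contra_eq_neq e => ->; rewrite (valX n vy) rmorph0 val0.
have [h vh] := val_neq0 (const_valuation W) c0.
move: (vh) => /= wh; rewrite wh (valX n vy) in e; have {}e := @fin_inj _ _ _ e.
rewrite valM (valX k1 vy) [W (ratconst c1)]vh1 in e1.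
rewrite valM (valX k2 vy) [W (ratconst c2)]vh2 in e2.
rewrite valM e1 (valV e2) => /fin_inj gE.
(* In [n] times the value of [p / q], each multiple of [gamma *+ n] is replaced by that of the value
   of [c]. *)
pose E := c1 ^+ n / c2 ^+ n * (c ^+ k1 / c ^+ k2).
have E0 : E != 0 by exact: mulf_neq0 (div_neq0 (expf_neq0 _ c10) (expf_neq0 _ c20))
  (div_neq0 (expf_neq0 _ c0) (expf_neq0 _ c0)).
have vE : const_valuation W E = fin (g *+ n).
  rewrite valM (valM _ (c1 ^+ n)) (valM _ (c ^+ k1)).
  rewrite (valX n vh1) (valV (valX n vh2)) (valX k1 vh) (valV (valX k2 vh)) /=.
  congr fin; rewrite -gE e mulrnBl !mulrnDl -!mulrnA ![(n * _)%N]mulnC.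
  by rewrite opprD addrACA.
have [m [t [m0 t0 mt]]] := algebraic_value K_alg (const_valuation W) E0.
apply: (gfree (n * m)%N); first by rewrite muln_gt0 n0.
exists (ratconst t); first by exists t.
rewrite -omegaW ratmap_const -[W _]/(const_valuation W (iota t)) -mt.
by rewrite (valX m vE) mulrnA.
Qed.
End NonTorsion.

Theorem theorem1p3
    (G : oagType)
    (* the valued field (K, nu) and the extension omega to K(x) *)
    (K : fieldType) (nu : valuation K G)
    (omega : valuation (ratfun K) G)
    (nu_omega : extends (@ratconst K) omega nu)
    (omega_vt : valuation_transcendental omega)
    (* an algebraic closure of K *)
    (Kbar : closedFieldType) (iota : {rmorphism K -> Kbar})
    (Kbar_alg : forall z : Kbar, algebraicOver iota z)
    (* the extension of omega to Kbar(x), with minimal pair (a, gamma) *)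
    (omegabar : valuation (ratfun Kbar) G)
    (omega_omegabar : extends (ratmap iota) omegabar omega)
    (a : Kbar) (gamma : G)
    (a_gamma : minimal_pair iota omegabar a gamma)
    (* an algebraic closure of Kbar(x), and the extension of omegabar to it *)
    (Omega : closedFieldType) (j : {rmorphism ratfun Kbar -> Omega})
    (Omega_alg : forall z : Omega, algebraicOver j z)
    (omegahat : valuation Omega G)
    (omegabar_omegahat : extends j omegahat omegabar)
    (a_sep : separable_over iota a)
    (a_notin_K : ~ range iota a) :
  let nubar := const_valuation omegabar in
  let IC := implicit_constant_field iota j omegahat in
  let Ka_h := henselization nubar (adjoin iota a) in
  let unique_on_Ka := unique_extension nubar (range iota) (adjoin iota a) in
  [/\ (* (i) *)
      kras iota nubar a < fin gamma -> IC = Ka_h,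
      (* (ii) *)
      value_transcendental omega -> unique_on_Ka ->
      fin gamma < kras iota nubar a ->
        group_index (value_group omegabar (adjoin_ratfun iota a))
          (value_group omega [set: ratfun K])
          #|` fset_set [set b | conjugates iota a b /\
                                fin gamma < nubar (a - b)]| /\
        IC `<` Ka_h
    & (* (iii) *)
      residue_transcendental omega -> unique_on_Ka ->
      fin gamma <= kras iota nubar a ->
        (value_group omegabar (adjoin_ratfun iota a)
           <> value_group omega [set: ratfun K] \/
         is_degree (residue_set omegabar (base_ratfun iota))
           (residue_set omegabar (adjoin_ratfun iota a))
           #|` fset_set [set b | conjugates iota a b /\
                                 fin gamma <= nubar (a - b)]|) /\
        IC `<` Ka_h].

Proof.
move=> nubar IC Ka_h unique_on_Ka.
have [[gammaW mono] _] := a_gamma; rewrite -/nubar in a_gamma mono *.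
have [Q mQ] := minpoly_exists (Kbar_alg a).
have sQ : separable_poly Q.
  have [p [_ pa sp]] := a_sep; apply: dvdp_separable sp.
  by rewrite -(minpolyP _ mQ).
have [rs [QE _]] := minpoly_split Kbar_alg mQ.
have urs := conjugates_uniq sQ QE.
have vgE := value_group_ratmap omega_omegabar.
have ICsub : IC `<=` Ka_h.
  exact: (implicit_constant_sub Kbar_alg mono Omega_alg omegabar_omegahat).
have strict : unique_on_Ka -> fin gamma <= kras iota nubar a -> IC `<` Ka_h.
  move=> uK gk; split=> // sub.
  have [s [si snu sa gs]] := moving_automorphism Kbar_alg mQ sQ QE a_notin_K uK gk.
  have ICa : IC a.
    by apply: sub => E [_ aE]; apply: aE; apply: adjoin_gen.
  case/eqP: sa.
  exact: (implicit_constant_fixed mono snu gs Omega_alg omegabar_omegahat Kbar_alg si ICa).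
split.
- move=> kg; apply/seteqP; split=> //.
  exact: (implicit_constant_sup Kbar_alg mono Omega_alg omegabar_omegahat mQ sQ QE kg).
- move=> vt uK gk; split; last exact: strict uK (ltW gk).
  have ntor := shift_nontorsion Kbar_alg mono omega_omegabar vt.
  rewrite vgE (@fset_set_filter _ rs (near_center omegabar a gamma)) //.
    exact: (value_index Kbar_alg a_gamma mQ QE ntor).
  move=> b; split=> [[cb gb]|[br nb]].
    by split; [exact/(mem_conjugates Kbar_alg mQ QE)|exact: ltW].
  split; first exact/(mem_conjugates Kbar_alg mQ QE).
  (* Equality is excluded since [gamma] is not the value of a constant, so strict and weak
     inequality select the same conjugates. *)
  rewrite lt_neqAle [X in _ && X]nb andbT eq_sym.
  by have := ntor 1%N (a - b) isT; rewrite expr1 (val_shift mono).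
move=> rt uK gk; split; last exact: strict uK gk.
rewrite vgE (@fset_set_filter _ rs (near_center omegabar a gamma)) //; last first.
  move=> b; split=> [[cb gb]|[br nb]]; split=> //; exact/(mem_conjugates Kbar_alg mQ QE).
have [e|ne] := pselect (value_group omegabar (adjoin_ratfun iota a) =
  value_group omegabar (base_ratfun iota)); last by left.
right; apply: (residue_degree Kbar_alg a_gamma mQ QE).
(* With equal value groups, [gamma], the value of [x - a], is also a value on [K(x)]. *)
rewrite -e; exists (ratpoly ('X - a%:P)); first exact: shift_adjoin_ratfun.
exact: val_shift.
Qed.
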